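(* Let $k$ be a field of characteristic $n$ and let $a,b$ be two coprime positive integers such that $n$ is a divisor of $a$. Then the Hochschild cohomology algebra $\mathrm{HH}^*(k[s^a,s^b])$ of $k[s^a,s^b]\subseteq k[s]$ is isomorphic to the quotient ring $$k[X_1,X_2,Y,T]/\mathcal{I},$$ where $k[X_1,X_2,Y,T]$ is the weighted graded commutative polynomial ring with $\deg(X_1)=\deg(X_2)=0$, $\deg(Y)=1$, $\deg(T)=2$, and $\mathrm{wt}(X_1)=a$, $\mathrm{wt}(X_2)=b$, $\mathrm{wt}(Y)=-b$, $\mathrm{wt}(T)=-ab$, and where the ideal $\mathcal{I}$ is generated by - $X_1^{b}-X_2^{a}$, $X_1^{b-1}T$ and $Y^2-X_2^{a-2}T$, if $\mathrm{char}(k)=2$ and $4\nmid a$; - $X_1^{b}-X_2^{a}$, $X_1^{b-1}T$ and $Y^2$, otherwise.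
   Context: For a commutative $k$-algebra $A$, $\mathrm{HH}^*(A)=\bigoplus_{i\ge 0}\mathrm{Ext}^i_{A^e}(A,A)$ with $A^e=A\otimes_k A^{op}$, made into a $k$-algebra by the cup product (equivalently the Yoneda product). Since $a>0$, the hypothesis $n\mid a$ forces $n$ to be a prime. ''deg'' is the cohomological degree and ''wt'' is the internal weight induced by giving $s$ weight $1$. The polynomial ring has the single odd-degree generator $Y$; no relation on $Y^2$ is imposed other than those in $\mathcal{I}$. *)

(* Defs.v *)
From HB Require Import structures.
From mathcomp Require Import all_boot all_order all_algebra.
From mathcomp Require Import boolp functions.
From mathcomp Require Import mpoly zify.

Set Implicit Arguments.
Unset Strict Implicit.
Unset Printing Implicit Defensive.

Import GRing.Theory.
Local Open Scope ring_scope.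

(* Ext over A^e = A (x) A^op is computed from the bar resolution
     ... -> A^(x)(i+3) -> A^(x)(i+2) -> ... -> A (x) A -> A,
     a_0 (x) ... (x) a_n |->
       sum_(j < n) (-1)^j a_0 (x) ... (x) a_j a_(j+1) (x) ... (x) a_n,
   which is a resolution of A by free A^e-modules because k is a field (A^e acts
   on the two outer tensor factors). By the universal property of the tensor
   product, an element f of Hom_(A^e)(A^(x)(i+2), A) is a k-multilinear function
   of i+2 arguments that is A-linear in the first one and in the last one: its
   value on a_0 (x) ... (x) a_(i+1) is f [:: a_0; ...; a_(i+1)]. A function
   f : seq A -> A gathers one component for each i, the one of degree i being
   its restriction to the sequences of size i+2. *)
Section BarCochains.
Variables (k : fieldType) (A : comAlgType k).
Implicit Types (f g h : seq A -> A) (s u v : seq A).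

(* Elements of the direct sum over i >= 0 of the Hom_(A^e)(A^(x)(i+2), A):
   cochain_bounded leaves finitely many nonzero components (direct sum, not
   product), and cochain_small says that there is none below degree 0. *)
Record is_cochain f : Prop := IsCochain {
  cochain_bounded : exists N, forall s, (N < size s)%N -> f s = 0;
  cochain_small : forall s, (size s < 2)%N -> f s = 0;
  cochain_multilin : forall u v c x y,
    f (u ++ (c *: x + y) :: v) = c *: f (u ++ x :: v) + f (u ++ y :: v);
  cochain_left : forall c x u, f (c * x :: u) = c * f (x :: u);
  cochain_right : forall u x c, f (rcons u (x * c)) = f (rcons u x) * c
}.

Definition bar_face (i : nat) s : seq A :=
  take i s ++ (nth 0 s i * nth 0 s i.+1) :: drop i.+2 s.

(* composition with the differential of the bar resolution *)
Definition bar_d f : seq A -> A :=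
  fun s => \sum_(0 <= i < (size s).-1) (-1) ^+ i * f (bar_face i s).

(* For f of degree p and g of degree q only the term j = p+1 is nonzero on a
   sequence of size p+q+2; it is f(a_0, ..., a_p, 1) g(1, a_(p+1), ..., a_(p+q+1)),
   which for f = a_0 f'(a_1, ..., a_p) a_(p+1) and g likewise is the classical
   a_0 f'(a_1, ..., a_p) g'(a_(p+1), ..., a_(p+q)) a_(p+q+1). *)
Definition cup f g : seq A -> A :=
  fun s => \sum_(1 <= j < size s) f (rcons (take j s) 1) * g (1 :: drop j s).

Definition cup_unit : seq A -> A :=
  fun s => if s is [:: x; y] then x * y else 0.

Definition cochain_pred : {pred seq A -> A} := fun f => `[< is_cochain f >].

Lemma cochain_predP f : reflect (is_cochain f) (f \in cochain_pred).
Proof. exact: asboolP. Qed.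

Lemma cochain_submod : submod_closed cochain_pred.
Proof.
split.
  apply/asboolP; split=> //=.
  - by exists 0%N.
  - by move=> *; rewrite scaler0 addr0.
  - by move=> *; rewrite mulr0.
  - by move=> *; rewrite mul0r.
move=> a f g /cochain_predP[[N fN] f2 fm fl fr] /cochain_predP[[M gM] g2 gm gl gr].
apply/cochain_predP; split.
- exists (maxn N M) => s; rewrite gtn_max => /andP[sN sM].
  by rewrite !fctE fN // gM // scaler0 addr0.
- by move=> s s2; rewrite fctE !fctE f2 // g2 // scaler0 addr0.
- move=> u v c x y; rewrite !fctE fm gm !scalerDr !scalerA [a * c]mulrC.
  by rewrite addrACA.
- by move=> c x u; rewrite !fctE fl gl mulrDr scalerAr.
- by move=> u x c; rewrite !fctE fr gr mulrDl scalerAl.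
Qed.

HB.instance Definition _ :=
  GRing.isSubmodClosed.Build k (seq A -> A) cochain_pred cochain_submod.

Lemma cup_cochain f g : is_cochain f -> is_cochain g -> is_cochain (cup f g).
Proof.
move=> [[N fN] f2 fm fl fr] [[M gM] g2 gm gl gr]; split.
- exists (N + M)%N => s sNM; rewrite /cup big_nat big1 // => j /andP[j1 js].
  have [Nj|jN] := ltnP N j.
    by rewrite fN ?mul0r // size_rcons size_takel // ltnW // ltnW.
  rewrite gM ?mulr0 //= size_drop ltnS leq_subRL ?(ltnW js) //.
  by apply: leq_trans (ltnW sNM); rewrite leq_add2r.
- by move=> [|x [|y s]] //= _; rewrite /cup big_geq.
- move=> u v c x y; rewrite /cup !size_cat /= scaler_sumr -big_split /=.
  rewrite big_nat [RHS]big_nat; apply: eq_bigr => j /andP[j1 js].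
  rewrite !take_cat !drop_cat; case: ltnP => ju.
    by rewrite -!cat_cons gm mulrDr scalerAr.
  case: (j - size u)%N => [|i] /=; last first.
    by rewrite !rcons_cat /= fm mulrDl scalerAl.
  by rewrite (gm [:: 1]) mulrDr scalerAr.
- move=> c x u; rewrite /cup /= mulr_sumr.
  rewrite big_nat [RHS]big_nat; apply: eq_bigr => -[//|j] _ /=.
  by rewrite fl mulrA.
- move=> u x c; rewrite /cup !size_rcons mulr_suml.
  rewrite big_nat [RHS]big_nat; apply: eq_bigr => j /andP[j1 js].
  rewrite !drop_rcons // -!rcons_cons gr mulrA.
  by rewrite -!cats1 !takel_cat.
Qed.

Lemma cup_unit_cochain : is_cochain cup_unit.
Proof.
split.
- by exists 2 => -[|x [|y [|z s]]].
- by move=> [|x [|y s]].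
- move=> [|x0 [|x1 [|x2 u]]] [|y0 [|y1 v]] c x y /=;
  by rewrite ?scaler0 ?addr0 // ?mulrDl ?mulrDr -?scalerAl -?scalerAr.
- by move=> c x [|y [|z u]] /=; rewrite ?mulr0 ?mulrA.
- by move=> [|y [|z [|t u]]] x c /=; rewrite ?mul0r ?mulrA.
Qed.

Lemma cup_unitl f : is_cochain f -> cup cup_unit f = f.
Proof.
move=> [_ f2 _ fl _]; apply/funext => s; rewrite /cup.
case: s => [|x [|y s]]; [by rewrite big_geq ?f2|by rewrite big_geq ?f2|].
rewrite big_ltn //= big_nat big1 ?addr0; last first.
  by move=> [|[|j]] // _; case: s => [|? ?] /=; rewrite ?mul0r //; case: j => *;
     rewrite /= ?mul0r.
by rewrite mulr1 -fl mulr1.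
Qed.

Lemma cup_unitr f : is_cochain f -> cup f cup_unit = f.
Proof.
move=> [_ f2 _ _ fr]; apply/funext => s; rewrite /cup.
case: (lastP s) => [|u x]; first by rewrite big_geq ?f2.
rewrite size_rcons; case: (posnP (size u)) => [u0|u0].
  by rewrite big_geq ?u0 // f2 // size_rcons u0.
rewrite big_nat_recr //= big_nat big1 ?add0r; last first.
  move=> j /andP[j1 ju]; rewrite drop_rcons ?(ltnW ju) //.
  case E: (drop j u) => [|y [|z v]] /=; rewrite ?mulr0 //.
  by move: (size_drop j u); rewrite E /= => /esym/eqP; rewrite subn_eq0 leqNgt ju.
rewrite drop_rcons // drop_size /= mul1r -[in take _ _]cats1 takel_cat // take_size.
by rewrite -fr mul1r.
Qed.

Lemma cupA f g h : cup f (cup g h) = cup (cup f g) h.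
Proof.
apply/funext => s; rewrite /cup; set n := size s.
pose F i j := f (rcons (take i s) 1) * g (1 :: rcons (drop i (take j s)) 1) *
  h (1 :: drop j s).
transitivity (\sum_(1 <= i < n) \sum_(1 <= j < n | (i <= j)%N) F i j).
  rewrite big_nat [RHS]big_nat; apply: eq_bigr => i /andP[i1 i_n] /=.
  transitivity (\sum_(0 + i <= j < n) F i j); last by rewrite (big_nat_widenl i 1).
  rewrite mulr_sumr size_drop -/n big_add1 /= (big_addn 0 n i xpredT (F i)).
  rewrite big_nat [RHS]big_nat; apply: eq_bigr => j _.
  by rewrite /F drop_drop take_drop mulrA.
rewrite (exchange_big_dep_nat xpredT) //= big_nat [RHS]big_nat.
apply: eq_bigr => j /andP[j1 jn]; rewrite size_rcons size_takel ?(ltnW jn) //.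
rewrite mulr_suml [RHS](big_nat_widen _ _ n) //.
rewrite big_nat_cond [RHS]big_nat_cond; apply: eq_big => [i|i].
  by rewrite ltnS.
move=> /andP[_ ij].
have szj : size (take j s) = j by rewrite size_takel // ltnW.
by rewrite drop_rcons ?szj // -[in take i _]cats1 takel_cat ?szj // take_takel.
Qed.

Lemma cupDl f g h : cup (f + g) h = cup f h + cup g h.
Proof.
apply/funext => s; rewrite -[RHS]/(cup f h s + cup g h s) /cup -big_split.
by apply: eq_bigr => j _; exact: mulrDl.
Qed.

Lemma cupDr f g h : cup f (g + h) = cup f g + cup f h.
Proof.
apply/funext => s; rewrite -[RHS]/(cup f g s + cup f h s) /cup -big_split.
by apply: eq_bigr => j _; exact: mulrDr.
Qed.

Lemma cupZl c f g : c *: cup f g = cup (c *: f) g.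
Proof.
apply/funext => s; rewrite -[LHS]/(c *: cup f g s) /cup scaler_sumr.
by apply: eq_bigr => j _; exact: scalerAl.
Qed.

Lemma cupZr c f g : c *: cup f g = cup f (c *: g).
Proof.
apply/funext => s; rewrite -[LHS]/(c *: cup f g s) /cup scaler_sumr.
by apply: eq_bigr => j _; exact: scalerAr.
Qed.

Lemma bar_dP c f g : bar_d (c *: f + g) = c *: bar_d f + bar_d g.
Proof.
apply/funext => s; rewrite -[RHS]/(c *: bar_d f s + bar_d g s) /bar_d.
rewrite scaler_sumr -big_split; apply: eq_bigr => i _.
by rewrite scalerAr; exact: mulrDr.
Qed.

(* (-1)^i on the component of degree i, as i = size s - 2 *)
Definition sgn_twist f : seq A -> A := fun s => (-1) ^+ size s * f s.

Lemma sgn_twistK : involutive sgn_twist.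
Proof. by move=> f; apply/funext => s; rewrite /sgn_twist signrMK. Qed.

Lemma size_bar_face i s : (i < (size s).-1)%N -> size (bar_face i s) = (size s).-1.
Proof.
case: s => [|x s] //= i_s; rewrite /bar_face size_cat /= size_drop /=.
by rewrite size_takel /=; lia.
Qed.

Lemma take_bar_face i j s : (i < j)%N -> (j < size s)%N ->
  take j (bar_face i s) = bar_face i (take j.+1 s).
Proof.
move=> ij js; have szi : size (take i s) = i by rewrite size_takel; lia.
have jiE : (j - i)%N = (j - i.+1).+1 by lia.
rewrite /bar_face take_cat szi ltnNge (ltnW ij) /= jiE /= take_drop.
have -> : (j - i.+1 + i.+2)%N = j.+1 by lia.
have ij1 : (i <= j.+1)%N by lia.
by rewrite (take_takel _ ij1) !nth_take //; lia.
Qed.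

Lemma drop_bar_face i j s : (i < j)%N -> (j < size s)%N ->
  drop j (bar_face i s) = drop j.+1 s.
Proof.
move=> ij js; have szi : size (take i s) = i by rewrite size_takel; lia.
have jiE : (j - i)%N = (j - i.+1).+1 by lia.
rewrite /bar_face drop_cat szi ltnNge (ltnW ij) /= jiE /= drop_drop.
by congr drop; lia.
Qed.

Lemma take_bar_face_ge i j s : (j <= i)%N -> (i < size s)%N ->
  take j (bar_face i s) = take j s.
Proof.
by move=> ji i_s; rewrite /bar_face takel_cat ?size_takel ?(ltnW i_s) // take_takel.
Qed.

Lemma drop_bar_face_ge i j s : (i + j < size s)%N ->
  drop j (bar_face (i + j) s) = bar_face i (drop j s).
Proof.
move=> ijs; rewrite /bar_face drop_cat size_takel ?(ltnW ijs) //.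
rewrite !nth_drop drop_drop !addSn addnS (addnC j).
case: ltnP => [_|]; first by rewrite -take_drop.
by rewrite -[X in (_ <= X)%N]add0n leq_add2r leqn0 => /eqP ->; rewrite add0n subnn take0.
Qed.

Lemma bar_face_rcons i s x : (i < (size s).-1)%N ->
  bar_face i (rcons s x) = rcons (bar_face i s) x.
Proof.
case: s => [|y s] //= i_s; rewrite /bar_face -rcons_cons -!cats1.
rewrite takel_cat ?(leqW (ltnW i_s)) // !nth_cat /= ltnS (ltnW i_s).
rewrite ltnS i_s -catA /=; congr (_ ++ _ :: _).
case: (ltnP i.+1 (size s)) => i1s; first by rewrite drop_cat i1s.
have -> : i.+1 = size s by lia.
by rewrite drop_size_cat // drop_size.
Qed.

Lemma cup_leibniz f g : is_cochain f -> is_cochain g ->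
  bar_d (cup f g) = cup (bar_d f) g + cup (sgn_twist f) (bar_d g).
Proof.
move=> [_ f2 _ _ fr] [_ g2 _ gl _]; apply/funext => s; rewrite fctE.
case: (posnP (size s)) => [/size0nil -> | s0].
  by rewrite /bar_d /cup !big_geq ?addr0.
have [m sm] : exists m, size s = m.+1 by exists (size s).-1; lia.
pose P i j := (-1) ^+ i * (f (rcons (take j (bar_face i s)) 1) *
  g (1 :: drop j (bar_face i s))).
pose F j := (-1) ^+ j * (f (rcons (take j s) 1) * nth 0 s j *
  g (1 :: drop j.+1 s)).
have F0 : F 0%N = 0 by rewrite /F take0 f2 // !mul0r mulr0.
have Fm : F m = 0 by rewrite /F drop_oversize ?sm // g2 // !mulr0.
have lhsE : bar_d (cup f g) s = \sum_(1 <= j < m) \sum_(0 <= i < m) P i j.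
  rewrite exchange_big_nat /= /bar_d sm /= big_nat [RHS]big_nat.
  apply: eq_bigr => i /= im; rewrite mulr_sumr size_bar_face ?sm //.
have dfE : cup (bar_d f) g s =
    \sum_(0 <= j < m) \sum_(0 <= i < j) P i j + \sum_(0 <= j < m) F j.
  rewrite -big_split /= /cup sm big_add1 /= big_nat [RHS]big_nat.
  apply: eq_bigr => j /= jm.
  have szj : size (take j.+1 s) = j.+1 by rewrite size_takel ?sm // ltnS ltnW.
  rewrite /bar_d size_rcons szj /= big_nat_recr //= mulrDl; congr (_ + _).
    rewrite mulr_suml; apply: eq_big_nat => i /= ij.
    rewrite /P take_bar_face ?drop_bar_face ?sm ?ltnS ?(ltnW jm) // mulrA.
    by rewrite bar_face_rcons // szj.
  rewrite -mulrA /F; congr (_ * (_ * _)).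
  rewrite /bar_face -cats1 takel_cat ?szj // take_takel // !nth_cat szj ltnSn ltnn.
  rewrite subnn /= nth_take // mulr1 drop_oversize; last first.
    by rewrite size_cat szj addn1.
  by rewrite cats1 -fr mul1r.
have dgE : cup (sgn_twist f) (bar_d g) s =
    \sum_(1 <= j < m.+1) \sum_(j <= i < m) P i j - \sum_(1 <= j < m.+1) F j.
  rewrite -sumrB /cup sm big_nat [RHS]big_nat.
  apply: eq_bigr => j /andP[j1 jm].
  have szj : size (take j s) = j by rewrite size_takel ?sm // ltnW.
  rewrite /bar_d /sgn_twist size_rcons szj /= size_drop sm subSn //=.
  rewrite big_nat_recl //= mulrDr addrC; congr (_ + _); last first.
    rewrite /bar_face take0 /= expr0 !mul1r nth_drop addn0 drop_drop add1n.
    by rewrite -[X in g (X :: _)]mulr1 gl /F exprS mulN1r !mulNr !mulrA.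
  rewrite mulr_sumr -[X in _ = \sum_(X <= _ < _) _]add0n big_addn.
  apply: eq_big_nat => i /= im.
  have ijm : (i + j < m)%N by rewrite addnC -ltn_subRL.
  rewrite /P take_bar_face_ge ?leq_addl ?sm ?(leqW ijm) //.
  rewrite drop_bar_face_ge ?sm ?(leqW ijm) //.
  rewrite -[bar_face i.+1 _]/(1 :: bar_face i (drop j s)) !exprS exprD.
  by rewrite !mulN1r !mulNr !mulrN opprK !mulrA; congr (_ * _); rewrite mulrAC [X in X * _ = _]mulrC.
rewrite lhsE dfE dgE.
have -> : \sum_(0 <= j < m) F j = \sum_(1 <= j < m.+1) F j.
  transitivity (\sum_(0 <= j < m.+1) F j).
    by rewrite big_nat_recr //= Fm addr0.
  by rewrite big_ltn // F0 add0r.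
rewrite addrACA subrr addr0.
case: m {sm s0 Fm lhsE dfE dgE} => [|m]; first by rewrite !big_geq // addr0.
rewrite [X in _ = X + _]big_ltn // [X in X + _ + _]big_geq // add0r.
rewrite [X in _ + X]big_nat_recr //= [X in _ + (_ + X)]big_geq // addr0.
rewrite -big_split /=; apply: eq_big_nat => j /andP[_ jm].
by rewrite -big_cat_nat // ltnW.
Qed.

Lemma sgn_twist_cochain f : is_cochain f -> is_cochain (sgn_twist f).
Proof.
move=> [[N fN] f2 fm fl fr]; split; rewrite /sgn_twist.
- by exists N => s sN; rewrite fN // mulr0.
- by move=> s s2; rewrite f2 // mulr0.
- by move=> u v c x y; rewrite fm !size_cat /= mulrDr scalerAr.
- by move=> c x u; rewrite fl /= mulrCA.
- by move=> u x c; rewrite fr !size_rcons mulrA.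
Qed.

Lemma bar_d_sgn_twist f : bar_d (sgn_twist f) = - sgn_twist (bar_d f).
Proof.
apply/funext => s; rewrite -[RHS]/(- ((-1) ^+ size s * bar_d f s)) /bar_d.
rewrite mulr_sumr -sumrN; apply: eq_big_nat => i /= i_s.
rewrite /sgn_twist size_bar_face //.
have -> : size s = (size s).-1.+1 by lia.
by rewrite /= exprS mulN1r mulNr opprK mulrCA.
Qed.

Lemma cup0l g : cup (fun=> 0) g = 0.
Proof. by apply/funext => s; apply: big1 => j _; rewrite mul0r. Qed.

Lemma cup0r f : cup f (fun=> 0) = 0.
Proof. by apply/funext => s; apply: big1 => j _; rewrite mulr0. Qed.

Lemma bar_d_cup_unit : bar_d cup_unit = 0.
Proof.
apply/funext => s; rewrite /bar_d.
have [s3|s3] := eqVneq (size s) 3.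
  move: s s3 => [|x [|y [|z [|]]]] //= _.
  rewrite big_nat_recr //= big_nat_recr //= big_geq // add0r.
  by rewrite /bar_face /= expr0 expr1 mul1r mulN1r mulrA subrr.
rewrite big_nat big1 // => i /= i_s.
have := size_bar_face i_s; case: (bar_face i s) => [|x [|y [|]]] //=;
  rewrite ?mulr0 //; lia.
Qed.

Record cochain := Cochain {
  cochain_fun :> seq A -> A;
  cochain_mem : cochain_fun \in cochain_pred
}.

HB.instance Definition _ := [isSub for cochain_fun].
HB.instance Definition _ := [Choice of cochain by <:].
HB.instance Definition _ := [SubChoice_isSubLmodule of cochain by <:].

Lemma cochainP (f : cochain) : is_cochain f.
Proof. exact/cochain_predP/cochain_mem. Qed.

Definition cochain_one : cochain := Cochain (asboolT cup_unit_cochain).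
Definition cochain_mul (f g : cochain) : cochain :=
  Cochain (asboolT (cup_cochain (cochainP f) (cochainP g))).

Fact cochain_mulA : associative cochain_mul.
Proof. by move=> f g h; apply: val_inj; apply: cupA. Qed.
Fact cochain_mul1 : left_id cochain_one cochain_mul.
Proof. by move=> f; apply: val_inj; apply/cup_unitl/cochainP. Qed.
Fact cochain_mulr1 : right_id cochain_one cochain_mul.
Proof. by move=> f; apply: val_inj; apply/cup_unitr/cochainP. Qed.
Fact cochain_mulDl : left_distributive cochain_mul +%R.
Proof. by move=> f g h; apply: val_inj; apply: cupDl. Qed.
Fact cochain_mulDr : right_distributive cochain_mul +%R.
Proof. by move=> f g h; apply: val_inj; apply: cupDr. Qed.
Fact cochain_one_neq0 : cochain_one != 0.
Proof.
apply/eqP => /(congr1 (fun f : cochain => f [:: 1; 1])) /eqP.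
by rewrite /= mulr1 oner_eq0.
Qed.

HB.instance Definition _ := GRing.Zmodule_isNzRing.Build cochain
  cochain_mulA cochain_mul1 cochain_mulr1 cochain_mulDl cochain_mulDr
  cochain_one_neq0.

Fact cochain_scalerAl (c : k) (f g : cochain) : c *: (f * g) = (c *: f) * g.
Proof. by apply: val_inj; apply: cupZl. Qed.
Fact cochain_scalerAr (c : k) (f g : cochain) : c *: (f * g) = f * (c *: g).
Proof. by apply: val_inj; apply: cupZr. Qed.

HB.instance Definition _ :=
  GRing.Lmodule_isLalgebra.Build k cochain cochain_scalerAl.
HB.instance Definition _ :=
  GRing.Lalgebra_isAlgebra.Build k cochain cochain_scalerAr.

Definition cocycle_pred : {pred cochain} := fun z : cochain => bar_d z == 0.

Fact cocycle_subalg : subalg_closed cocycle_pred.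
Proof.
split.
- by apply/eqP; apply: bar_d_cup_unit.
- move=> c f g /eqP df /eqP dg; apply/eqP.
  by rewrite [LHS]bar_dP df dg scaler0 addr0.
- move=> f g /eqP df /eqP dg; apply/eqP.
  rewrite [LHS](cup_leibniz (cochainP f) (cochainP g)) df dg.
  by rewrite [X in X + _]cup0l [X in _ + X]cup0r addr0.
Qed.

HB.instance Definition _ :=
  GRing.isSubalgClosed.Build k cochain cocycle_pred cocycle_subalg.

Record cocycle := Cocycle {
  cocycle_cochain :> cochain;
  cocycle_mem : cocycle_cochain \in cocycle_pred
}.

HB.instance Definition _ := [isSub for cocycle_cochain].
HB.instance Definition _ := [Choice of cocycle by <:].
HB.instance Definition _ := [SubChoice_isSubAlgebra of cocycle by <:].

Definition coboundary_pred : {pred cocycle} :=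
  fun z => `[< exists h : cochain, z = bar_d h :> (seq A -> A) >].

Lemma cocycleP (z : cocycle) : bar_d z = 0.
Proof. exact/eqP/cocycle_mem. Qed.

Fact coboundary_zmod : zmod_closed coboundary_pred.
Proof.
split.
  apply/asboolP; exists 0; apply/funext => s.
  by rewrite /bar_d big1 // => i _; rewrite mulr0.
move=> z w /asboolP[g zg] /asboolP[h wh]; apply/asboolP; exists ((-1) *: h + g).
rewrite [RHS](bar_dP (-1) h g) -wh -zg scaleN1r addrC.
by [].
Qed.

HB.instance Definition _ :=
  GRing.isZmodClosed.Build cocycle coboundary_pred coboundary_zmod.

Fact coboundary_one : 1 \notin coboundary_pred.
Proof.
apply/negP => /asboolP[h] /(congr1 (fun f => f [:: 1; 1])) /=.
rewrite /bar_d big_nat1 /bar_face /= mulr1 expr0 mul1r.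
by rewrite cochain_small ?[X in X = _]/(1 * 1) ?mulr1;
   [move/eqP; rewrite oner_eq0 | apply: cochainP |].
Qed.

Fact coboundary_mull (z w : cocycle) :
  w \in coboundary_pred -> z * w \in coboundary_pred.
Proof.
move=> /asboolP[h wh]; apply/asboolP.
have sz := sgn_twist_cochain (cochainP z).
exists (Cochain (asboolT (cup_cochain sz (cochainP h)))).
rewrite [RHS](cup_leibniz sz (cochainP h)) bar_d_sgn_twist cocycleP sgn_twistK -wh.
suff -> : - sgn_twist (0 : seq A -> A) = 0 by rewrite [X in X + _]cup0l add0r.
by apply/funext => s; rewrite -[LHS]/(- ((-1) ^+ size s * 0)) mulr0 oppr0.
Qed.

Fact coboundary_mulr (z w : cocycle) :
  w \in coboundary_pred -> w * z \in coboundary_pred.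
Proof.
move=> /asboolP[h wh]; apply/asboolP; exists (h * z).
rewrite [RHS](cup_leibniz (cochainP h) (cochainP z)) cocycleP -wh.
by rewrite [X in _ + X]cup0r addr0.
Qed.

End BarCochains.

(* Proper two-sided ideals, and the quotient of a k-algebra by such an ideal: the
   library's ring quotient only covers commutative rings and forgets scalars. *)
Record tsideal (R : nzRingType) := TSIdeal {
  tsideal_zmod :> zmodClosed R;
  tsideal_proper : 1 \notin tsideal_zmod;
  tsideal_mull : forall x y, y \in tsideal_zmod -> x * y \in tsideal_zmod;
  tsideal_mulr : forall x y, y \in tsideal_zmod -> y * x \in tsideal_zmod
}.

Section AlgQuotient.
Variables (k : pzRingType) (R : algType k) (I : tsideal R).
Local Open Scope quotient_scope.

Definition alg_quot := Quotient.quot I.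

HB.instance Definition _ := GRing.Zmodule.on alg_quot.
HB.instance Definition _ := ZmodQuotient.on alg_quot.

Definition to_alg_quot (x : R) : alg_quot := \pi_alg_quot x.

Definition alg_quot_one : alg_quot := to_alg_quot 1.
Definition alg_quot_mul (x y : alg_quot) : alg_quot := to_alg_quot (repr x * repr y).
Definition alg_quot_scale (c : k) (x : alg_quot) : alg_quot := to_alg_quot (c *: repr x).

Lemma alg_quot_eq (x y : R) : x - y \in I -> to_alg_quot x = to_alg_quot y.
Proof. by rewrite Quotient.idealrBE => /eqP. Qed.

Lemma alg_quot_repr (x : R) : x - repr (to_alg_quot x) \in I.
Proof. by rewrite Quotient.idealrBE reprK. Qed.

Lemma pi_alg_quotM (x y : R) :
  to_alg_quot (x * y) = alg_quot_mul (to_alg_quot x) (to_alg_quot y).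
Proof.
apply: alg_quot_eq; set x' := repr _; set y' := repr _.
have -> : x * y - x' * y' = (x - x') * y + x' * (y - y').
  by rewrite mulrBl mulrBr addrA subrK.
by apply: rpredD; [apply: tsideal_mulr|apply: tsideal_mull]; apply: alg_quot_repr.
Qed.

Lemma pi_alg_quotZ c (x : R) :
  to_alg_quot (c *: x) = alg_quot_scale c (to_alg_quot x).
Proof.
apply: alg_quot_eq; set x' := repr _; rewrite -scalerBr -[x - x']mul1r scalerAl.
by apply: tsideal_mull; apply: alg_quot_repr.
Qed.

Lemma pi_alg_quotD (x y : R) : to_alg_quot (x + y) = to_alg_quot x + to_alg_quot y.
Proof. by rewrite /to_alg_quot piE. Qed.

Lemma alg_quotP (x : alg_quot) : exists y : R, x = to_alg_quot y.
Proof. by exists (repr x); rewrite /to_alg_quot reprK. Qed.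

Fact alg_quot_mulA : associative alg_quot_mul.
Proof.
by move=> x y z; case: (alg_quotP x) (alg_quotP y) (alg_quotP z)
  => [{}x ->] [{}y ->] [{}z ->]; rewrite -!pi_alg_quotM mulrA.
Qed.
Fact alg_quot_mul1r : left_id alg_quot_one alg_quot_mul.
Proof. by move=> x; case: (alg_quotP x) => [{}x ->]; rewrite -pi_alg_quotM mul1r. Qed.
Fact alg_quot_mulr1 : right_id alg_quot_one alg_quot_mul.
Proof. by move=> x; case: (alg_quotP x) => [{}x ->]; rewrite -pi_alg_quotM mulr1. Qed.
Fact alg_quot_mulDl : left_distributive alg_quot_mul +%R.
Proof.
by move=> x y z; case: (alg_quotP x) (alg_quotP y) (alg_quotP z)
  => [{}x ->] [{}y ->] [{}z ->];
  rewrite -pi_alg_quotD -!pi_alg_quotM -pi_alg_quotD mulrDl.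
Qed.
Fact alg_quot_mulDr : right_distributive alg_quot_mul +%R.
Proof.
by move=> x y z; case: (alg_quotP x) (alg_quotP y) (alg_quotP z)
  => [{}x ->] [{}y ->] [{}z ->];
  rewrite -pi_alg_quotD -!pi_alg_quotM -pi_alg_quotD mulrDr.
Qed.
Fact alg_quot_one_neq0 : alg_quot_one != 0.
Proof.
by rewrite /alg_quot_one /to_alg_quot piE Quotient.equivE subr0 tsideal_proper.
Qed.

HB.instance Definition _ := GRing.Zmodule_isNzRing.Build alg_quot
  alg_quot_mulA alg_quot_mul1r alg_quot_mulr1 alg_quot_mulDl alg_quot_mulDr
  alg_quot_one_neq0.

Fact alg_quot_scalerA c d x :
  alg_quot_scale c (alg_quot_scale d x) = alg_quot_scale (c * d) x.
Proof. by case: (alg_quotP x) => [{}x ->]; rewrite -!pi_alg_quotZ scalerA. Qed.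
Fact alg_quot_scale1r : left_id 1 alg_quot_scale.
Proof. by move=> x; case: (alg_quotP x) => [{}x ->]; rewrite -pi_alg_quotZ scale1r. Qed.
Fact alg_quot_scalerDr : right_distributive alg_quot_scale +%R.
Proof.
by move=> c x y; case: (alg_quotP x) (alg_quotP y) => [{}x ->] [{}y ->];
  rewrite -pi_alg_quotD -!pi_alg_quotZ -pi_alg_quotD scalerDr.
Qed.
Fact alg_quot_scalerDl x : {morph alg_quot_scale^~ x : c d / c + d}.
Proof.
by move=> c d /=; case: (alg_quotP x) => [{}x ->];
  rewrite -!pi_alg_quotZ -pi_alg_quotD scalerDl.
Qed.

HB.instance Definition _ := GRing.Zmodule_isLmodule.Build k alg_quot
  alg_quot_scalerA alg_quot_scale1r alg_quot_scalerDr alg_quot_scalerDl.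

Lemma to_alg_quotZ c (x : R) : to_alg_quot (c *: x) = c *: to_alg_quot x.
Proof. exact: pi_alg_quotZ. Qed.
Lemma to_alg_quotM (x y : R) :
  to_alg_quot (x * y) = to_alg_quot x * to_alg_quot y.
Proof. exact: pi_alg_quotM. Qed.

Fact alg_quot_scalerAl c (x y : alg_quot) : c *: (x * y) = (c *: x) * y.
Proof.
case: (alg_quotP x) (alg_quotP y) => [{}x ->] [{}y ->].
by rewrite -to_alg_quotM -!to_alg_quotZ -to_alg_quotM scalerAl.
Qed.
Fact alg_quot_scalerAr c (x y : alg_quot) : c *: (x * y) = x * (c *: y).
Proof.
case: (alg_quotP x) (alg_quotP y) => [{}x ->] [{}y ->].
by rewrite -to_alg_quotM -!to_alg_quotZ -to_alg_quotM scalerAr.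
Qed.

HB.instance Definition _ :=
  GRing.Lmodule_isLalgebra.Build k alg_quot alg_quot_scalerAl.
HB.instance Definition _ :=
  GRing.Lalgebra_isAlgebra.Build k alg_quot alg_quot_scalerAr.

End AlgQuotient.

Section Hochschild.
Variables (k : fieldType) (A : comAlgType k).

Definition coboundary_ideal : tsideal (cocycle A) :=
  @TSIdeal (cocycle A) (@coboundary_pred k A : zmodClosed (cocycle A))
    (@coboundary_one k A)
    (@coboundary_mull k A) (@coboundary_mulr k A).

(* cocycles modulo coboundaries, with the product induced by the cup product:
   the direct sum over i of the Ext^i_(A^e)(A, A) *)
Definition HH : Type := alg_quot coboundary_ideal.

HB.instance Definition _ := GRing.Algebra.on HH.

Definition HH_class (z : cocycle A) : HH := to_alg_quot coboundary_ideal z.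

Definition has_degree (i : nat) (f : seq A -> A) : Prop :=
  forall s, size s != i.+2 -> f s = 0.

(* hom d x reads: x is homogeneous of weight d in A. A homogeneous f of weight w
   sends homogeneous arguments of weights d_0, ..., d_n to an element of weight
   d_0 + ... + d_n + w. *)
Definition has_weight (hom : int -> A -> Prop) (w : int) (f : seq A -> A) : Prop :=
  forall s : seq (int * A), (forall p, p \in s -> hom p.1 p.2) ->
    hom ((\sum_(p <- s) p.1) + w) (f [seq p.2 | p <- s]).

(* the component of HH of cohomological degree i and internal weight w *)
Definition HH_bihom (hom : int -> A -> Prop) (i : nat) (w : int) (x : HH) : Prop :=
  exists z : cocycle A, [/\ x = HH_class z, has_degree i z & has_weight hom w z].

End Hochschild.

Section SemigroupAlgebra.
Variables (k : fieldType) (a b : nat).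

(* k[s^a, s^b], the smallest k-subalgebra of k[s] containing s^a and s^b *)
Definition sgalg_pred : {pred {poly k}} := fun p =>
  `[< forall S : {pred {poly k}}, subalg_closed S ->
        'X^a \in S -> 'X^b \in S -> p \in S >].

Fact sgalg_subalg : subalg_closed sgalg_pred.
Proof.
split.
- by apply/asboolP => S [].
- move=> c p q /asboolP pS /asboolP qS; apply/asboolP => S HS Sa Sb.
  by case: (HS) => _ + _; apply; [apply: pS | apply: qS].
- move=> p q /asboolP pS /asboolP qS; apply/asboolP => S HS Sa Sb.
  by case: (HS) => _ _; apply; [apply: pS | apply: qS].
Qed.

HB.instance Definition _ :=
  GRing.isSubalgClosed.Build k {poly k} sgalg_pred sgalg_subalg.

Record sgalg := SGAlg { sgalg_val :> {poly k}; sgalg_mem : sgalg_val \in sgalg_pred }.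

HB.instance Definition _ := [isSub for sgalg_val].
HB.instance Definition _ := [Choice of sgalg by <:].
HB.instance Definition _ := [SubChoice_isSubAlgebra of sgalg by <:].
HB.instance Definition _ := [SubNzRing_isSubComNzRing of sgalg by <:].

(* x is a scalar multiple of s^w; only 0 is homogeneous of weight w < 0 *)
Definition sgalg_hom (w : int) (x : sgalg) : Prop :=
  forall i : nat, (x : {poly k})`_i != 0 -> i%:Z = w.

End SemigroupAlgebra.

Section Presentation.
Variables (k : fieldType) (a b : nat).

Definition iX1 : 'I_4 := @Ordinal 4 0 isT.
Definition iX2 : 'I_4 := @Ordinal 4 1 isT.
Definition iY : 'I_4 := @Ordinal 4 2 isT.
Definition iT : 'I_4 := @Ordinal 4 3 isT.

(* k[X1,X2,Y,T] is the ordinary commutative polynomial ring: Y is the only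
   generator of odd degree, so graded commutativity could only add 2 Y^2 = 0, and
   when char k <> 2 the ideal contains Y^2. *)
Definition relations : seq {mpoly k[4]} :=
  [:: 'X_iX1 ^+ b - 'X_iX2 ^+ a;
      'X_iX1 ^+ b.-1 * 'X_iT;
      if (2 \in [pchar k]) && ~~ (4 %| a)%N
      then 'X_iY ^+ 2 - 'X_iX2 ^+ (a - 2) * 'X_iT
      else 'X_iY ^+ 2 ].

Definition relations_pred : {pred {mpoly k[4]}} := fun p =>
  `[< exists c : nat -> {mpoly k[4]},
        p = \sum_(i < size relations) c i * relations`_i >].

Fact relations_zmod : zmod_closed relations_pred.
Proof.
split.
  by apply/asboolP; exists (fun=> 0); rewrite big1 // => i _; rewrite mul0r.
move=> _ _ /asboolP[c ->] /asboolP[d ->]; apply/asboolP; exists (c - d).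
by rewrite -sumrB; apply: eq_bigr => i _; rewrite -mulrBl.
Qed.

HB.instance Definition _ :=
  GRing.isZmodClosed.Build {mpoly k[4]} relations_pred relations_zmod.

Fact relations_proper : 1 \notin relations_pred.
Proof.
apply/negP => /asboolP[c] /(congr1 (meval (fun i : 'I_4 => (i < 2)%N%:R))).
rewrite rmorph1 rmorph_sum big1 => [/eqP|i _]; first by rewrite oner_eq0.
rewrite rmorphM /=.
suff -> : meval (fun i : 'I_4 => (i < 2)%N%:R) relations`_i = 0 by rewrite mulr0.
case: i => [[|[|[|//]]] _] /=.
- by rewrite rmorphB !rmorphXn /= !mevalXU !expr1n subrr.
- by rewrite rmorphM /= mevalXU mulr0.
- by case: ifP => _; rewrite ?rmorphB ?rmorphM ?rmorphXn /= !mevalXU /= ?expr0n ?mulr0 ?subrr ?subr0.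
Qed.

Fact relations_mull (p q : {mpoly k[4]}) :
  q \in relations_pred -> p * q \in relations_pred.
Proof.
move=> /asboolP[c ->]; apply/asboolP; exists (fun i => p * c i).
by rewrite mulr_sumr; apply: eq_bigr => i _; rewrite mulrA.
Qed.

Fact relations_mulr (p q : {mpoly k[4]}) :
  q \in relations_pred -> q * p \in relations_pred.
Proof. by rewrite mulrC; apply: relations_mull. Qed.

Definition relations_ideal : tsideal {mpoly k[4]} :=
  @TSIdeal {mpoly k[4]} (relations_pred : zmodClosed {mpoly k[4]})
    relations_proper relations_mull relations_mulr.

(* k[X1,X2,Y,T] / I *)
Definition presented : Type := alg_quot relations_ideal.

HB.instance Definition _ := GRing.Algebra.on presented.

Definition mon_deg (m : 'X_{1..4}) : nat := (m iY + 2 * m iT)%N.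
Definition mon_wt (m : 'X_{1..4}) : int :=
  a%:Z *+ m iX1 + b%:Z *+ m iX2 - b%:Z *+ m iY - (a * b)%N%:Z *+ m iT.

Definition presented_bihom (i : nat) (w : int) (x : presented) : Prop :=
  exists p : {mpoly k[4]}, x = to_alg_quot relations_ideal p /\
    {in msupp p, forall m, mon_deg m = i /\ mon_wt m = w}.

End Presentation.

(* Main.v *)
Require Import Defs.
From HB Require Import structures.
From mathcomp Require Import all_boot all_order all_algebra.
From mathcomp Require Import boolp functions.
From mathcomp Require Import mpoly zify ring.

(* Put x = s^a and y = s^b, so that A = k[x,y]/(x^b - y^a) is free over k[y] with
   basis 1, x, ..., x^(b-1). As a = 0 in k, Y = d/dy is a derivation of A. Adding
   coboundaries, a cocycle can be normalized and made k[y]-linear slot by slot, up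
   to its last slot, where it is a derivation along y; so it is cohomologous to
   f0 + f1 Y with f0 and f1 cocycles relative to k[y]. A relative cocycle can in
   turn be arranged to vanish on (x, x^j, ...) for j < b - 1, and the cocycle
   condition then shows that in degrees >= 2 it is T * t, where t is its value on
   (x, x^(b-1), ...) and T is the carry cocycle of the basis x^i. Degree 1 does
   not contribute, since d/dx has boundary b x^(b-1) T and b is invertible in k.
   Hence every class is a sum of c T^m and c T^m Y with c in A, and the same
   reductions applied to a primitive show that the only relations among these are
   the multiples of x^(b-1) T. Finally T Y - Y T is the boundary of Y o T, and
   Y^2 + binomial(a,2) y^(a-2) T is a boundary, by means of the divided second
   derivative in y; in characteristic 2 with a even, binomial(a,2) is odd exactly
   when 4 does not divide a. All these steps preserve weights. *)

Set Implicit Arguments.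
Unset Strict Implicit.
Unset Printing Implicit Defensive.

Import GRing.Theory.
Local Open Scope ring_scope.

(** * Cochains as multilinear functions of their inner arguments *)

(** The obstacle is that d/dx does not descend to A: on k[x,y] it sends x^b - y^a to b x^(b-1). As n
    divides a and a, b are coprime, b is invertible in k, and b x^(b-1) is not a zero divisor.
    Cancelling it yields the cocycle identity for the carry without any comparison of exponents, and
    it also removes the degree 1 term of a relative cocycle. A cochain mixes several degrees, so
    inductions run on a bound for the number of arguments. The reductions see A only through a basis
    with linear extension, the relation and the regularity of x ([coordinates]), and through a
    predicate stable under the operations ([weights]). With the predicate constantly true they give
    the ungraded statements, with homogeneity the graded ones. Commutativity of the cohomology is
    not presupposed. It is extracted from the normal form, and only then can polynomials be
    evaluated on the generators. *)

Section Inner.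
Variables (k : fieldType) (A : comAlgType k).
Implicit Types (f g h : cochain A) (F G H : seq A -> A) (s u v : seq A).

Definition mlin F := forall u v c x y,
  F (u ++ (c *: x + y) :: v) = c *: F (u ++ x :: v) + F (u ++ y :: v).

Definition bounded (N : nat) F := forall s, (N <= size s)%N -> F s = 0.

(* [f] is determined by [inner f], its restriction to the tensors whose outer
   factors are 1. *)
Definition inner (f : seq A -> A) : seq A -> A := fun s => f (1 :: rcons s 1).

Definition outer F : seq A -> A := fun s =>
  match s with
  | x :: y :: s' => x * F (belast y s') * last y s'
  | _ => 0
  end.

Lemma outerE F x s y : outer F (x :: rcons s y) = x * F s * y.
Proof.
case: s => [|z s] //=.
by case: (rcons s y) (belast_rcons z s y) (last_rcons z s y) => [|t r] //= -> ->.
Qed.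

Lemma seq_outer s : (1 < size s)%N -> exists x u y, s = x :: rcons u y.
Proof.
by case: s => [|x s] //; case/lastP: s => // u y _; exists x, u, y.
Qed.

Lemma outer_small F s : (size s < 2)%N -> outer F s = 0.
Proof. by case: s => [|x [|y s]]. Qed.

Lemma innerE f x s y : f (x :: rcons s y) = x * inner f s * y.
Proof.
case: (cochainP f) => _ _ _ fl fr; rewrite /inner.
by rewrite -[x in LHS]mulr1 fl -rcons_cons -[y in LHS]mul1r fr mulrA.
Qed.

Lemma cochain_inner_eq f g : (forall s, inner f s = inner g s) -> f = g.
Proof.
move=> fg; apply: val_inj; apply/funext => s /=.
have [s2|] := ltnP (size s) 2.
  by rewrite !(cochain_small (cochainP _)).
by case/seq_outer => x [u [y ->]]; rewrite !innerE fg.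
Qed.

Lemma outer_is_cochain F : mlin F -> (exists N, bounded N F) -> is_cochain (outer F).
Proof.
move=> Fm [N FN]; split.
- exists N.+2 => s sN; case: (@seq_outer s); first by lia.
  move=> x [u [y es]]; subst s; rewrite outerE FN ?mulr0 ?mul0r //.
  by move: sN; rewrite /= size_rcons; lia.
- by move=> s; apply: outer_small.
- move=> u v c x y; case: u => [|x0 u].
    case/lastP: v => [|v z]; first by rewrite !outer_small // scaler0 addr0.
    by rewrite !cat0s !outerE !mulrDl -!scalerAl.
  case/lastP: v => [|v z].
    case: u => [|z u]; first by rewrite /= mulrDr scalerAr.
    by rewrite !cats1 !(rcons_cons x0) !outerE mulrDr scalerAr.
  by rewrite !cat_cons -!rcons_cons -!rcons_cat !outerE Fm !(mulrDl, mulrDr)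
       -!(scalerAl, scalerAr).
- move=> c x u; case/lastP: u => [|u z]; first by rewrite !outer_small // mulr0.
  by rewrite !outerE -!mulrA.
- move=> u x c; case: u => [|z u]; first by rewrite !outer_small // mul0r.
  by rewrite !rcons_cons !outerE mulrA.
Qed.

Lemma inner_bounded f : exists N, bounded N (inner f).
Proof.
case: (cochainP f) => -[N fN] _ _ _ _; exists N => s sN.
by rewrite /inner fN //= size_rcons; lia.
Qed.

Lemma inner_mlin f : mlin (inner f).
Proof.
move=> u v c x y; rewrite /inner !rcons_cat /= -!cat_cons.
exact: cochain_multilin (cochainP f) _ _ _ _ _.
Qed.

Lemma mk_cochain F : mlin F -> (exists N, bounded N F) ->
  exists f, inner f = F.
Proof.
move=> Fm FN; exists (Cochain (asboolT (outer_is_cochain Fm FN))).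
by apply/funext => s; rewrite [LHS]outerE mul1r mulr1.
Qed.

Lemma innerD f g s : inner (f + g) s = inner f s + inner g s.
Proof. by []. Qed.

Lemma innerN f s : inner (- f) s = - inner f s.
Proof. by []. Qed.

Lemma innerB f g s : inner (f - g) s = inner f s - inner g s.
Proof. by []. Qed.

Lemma innerZ c f s : inner (c *: f) s = c *: inner f s.
Proof. by []. Qed.

Lemma inner0 s : inner (0 : cochain A) s = 0.
Proof. by []. Qed.

Lemma inner1 s : inner (1 : cochain A) s = if s is [::] then 1 else 0.
Proof. by case: s => [|x [|y s]] //=; rewrite /inner /= mulr1. Qed.

Lemma innerM f g s :
  inner (f * g) s = \sum_(j < (size s).+1) inner f (take j s) * inner g (drop j s).
Proof.
rewrite {1}/inner /= /cup big_add1 /= size_rcons big_mkord.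
apply: eq_bigr => j _; rewrite /inner /= drop_rcons -1?ltnS //.
by rewrite -[rcons s 1]cats1 takel_cat // -ltnS.
Qed.

(** Once the first face is peeled off, what remains is the differential of the function with its
    first argument frozen. This makes inductions on the list possible. *)
Lemma bar_d_cons (F : seq A -> A) x y s :
  bar_d F (x :: y :: s) = F (x * y :: s) - bar_d (fun r => F (x :: r)) (y :: s).
Proof.
rewrite /bar_d /= big_nat_recl //= expr0 mul1r /bar_face /= drop0; congr (_ + _).
by rewrite -sumrN; apply: eq_bigr => i _; rewrite exprS mulN1r mulNr.
Qed.

Lemma bar_d1 (F : seq A -> A) x : bar_d F [:: x] = 0.
Proof. by rewrite /bar_d big_geq. Qed.

Lemma bar_d_eq (F G : seq A -> A) s :
  (forall x r, F (x :: r) = G (x :: r)) -> bar_d F s = bar_d G s.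
Proof.
move=> FG; apply: eq_bigr => i _; rewrite /bar_face.
by case: (take i s) => [|z r]; rewrite /= FG.
Qed.

Lemma bar_dB (F G : seq A -> A) s :
  bar_d (fun r => F r - G r) s = bar_d F s - bar_d G s.
Proof. by rewrite /bar_d -sumrB; apply: eq_bigr => i _; rewrite mulrBr. Qed.

Lemma bar_dd (F : seq A -> A) s : bar_d (bar_d F) s = 0.
Proof.
elim: s F => [|x [|y s] IH] F; first by rewrite /bar_d big_geq.
  exact: bar_d1.
case: s IH => [|z s] IH; first by rewrite bar_d_cons !bar_d1 subr0.
rewrite bar_d_cons [bar_d F _]bar_d_cons.
(* [G] is the inner differential unfolded with [x] frozen in front. Its value at [[::]] does not
   matter, as every face is nonempty. *)
pose G r := (if r is t :: r' then F (x * t :: r') else 0) -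
  bar_d (fun r' => F (x :: r')) r.
rewrite [X in _ - X](@bar_d_eq _ G); last by move=> ? ?; rewrite bar_d_cons.
by rewrite bar_dB IH subr0 [X in _ - X]bar_d_cons mulrA subrr.
Qed.

Lemma bar_d_left (F : seq A -> A) : (forall c x u, F (c * x :: u) = c * F (x :: u)) ->
  forall c x u, bar_d F (c * x :: u) = c * bar_d F (x :: u).
Proof.
move=> Fl c x [|y u]; first by rewrite !bar_d1 mulr0.
rewrite !bar_d_cons mulrBr -mulrA Fl; congr (_ - _).
rewrite /bar_d mulr_sumr; apply: eq_bigr => i _; rewrite Fl mulrCA.
by [].
Qed.

Lemma bar_d_right (F : seq A -> A) :
  (forall u x c, F (rcons u (x * c)) = F (rcons u x) * c) ->
  forall u x c, bar_d F (rcons u (x * c)) = bar_d F (rcons u x) * c.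
Proof.
move=> Fr u; elim: u F Fr => [|y [|z u] IH] F Fr x c.
- by rewrite !bar_d1 mul0r.
- by rewrite /= !bar_d_cons !bar_d1 !subr0 mulrA (Fr [::]).
- rewrite !rcons_cons !bar_d_cons mulrBl -!rcons_cons Fr IH //.
  by move=> v t e; rewrite -!rcons_cons Fr.
Qed.

(** This is the Hochschild differential with coefficients in the commutative algebra [A], arranged
    as a recursion: the term [b * F (a :: t)] cancels the leading term of the recursive call. On one
    argument the two outer actions agree, hence the value 0. *)
Fixpoint dd F s : A :=
  match s with
  | a :: s' =>
    match s' with
    | b :: t => a * F s' - F (a * b :: t) + b * F (a :: t) -
                dd (fun r => F (a :: r)) s'
    | _ => 0
    end
  | _ => 0
  end.

Arguments dd : simpl never.

Lemma dd1 F a : dd F [:: a] = 0.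
Proof. by []. Qed.

Lemma dd_cons F a b t : dd F (a :: b :: t) =
  a * F (b :: t) - F (a * b :: t) + b * F (a :: t) -
  dd (fun r => F (a :: r)) (b :: t).
Proof. by []. Qed.

Lemma inner_bar_d f s : inner (bar_d f) s = dd (inner f) s.
Proof.
case: (cochainP f) => _ f2 _ fl fr; case: s => [|a s].
  by rewrite /inner bar_d_cons bar_d1 subr0 f2.
rewrite /inner; elim: s a {f f2} (f : seq A -> A) fl fr => [|b t IH] a F Fl Fr.
  have e1 : F [:: a; 1] = a * F [:: 1; 1] by rewrite -{1}[a]mulr1 Fl.
  have e2 : F [:: 1; a] = F [:: 1; 1] * a by rewrite -{1}[a]mul1r (Fr [:: 1]).
  by rewrite dd1 /= !bar_d_cons bar_d1 subr0 mul1r mulr1 e1 e2 mulrC subrr.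
have FE x u : F (x :: u) = x * F (1 :: u) by rewrite -{1}[x]mulr1 Fl.
(* Freezing [a] in second place while the outer factor stays free gives a function that is again
   linear at both ends, so the induction hypothesis applies to it. *)
pose Fa r := if r is z :: r' then F (z :: a :: r') else 0.
rewrite dd_cons -[dd _ (b :: t)]/(dd (fun s => Fa (1 :: rcons s 1)) (b :: t)).
rewrite -IH; first last.
- case=> [|z v] x c; first by rewrite /= mulrC Fl mulrC.
  by rewrite /= -!rcons_cons Fr.
- by move=> c x u; rewrite /= Fl.
rewrite !rcons_cons; move: (rcons t 1) => t1.
rewrite bar_d_cons mul1r [F (a :: _)]FE [bar_d _ (a :: _)]bar_d_cons.
rewrite [bar_d Fa _]bar_d_cons mul1r /= [F (b :: _)]FE.
move: (bar_d _ _) => D; ring.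
Qed.

Lemma bar_d_inner f x s y :
  bar_d f (x :: rcons s y) = x * dd (inner f) s * y.
Proof.
case: (cochainP f) => _ _ _ fl fr; rewrite -inner_bar_d /inner.
rewrite -[x in LHS]mulr1 (bar_d_left fl) -rcons_cons -[y in LHS]mul1r.
by rewrite (bar_d_right fr) mulrA.
Qed.

Lemma dd_lin c F G H s : (forall a r, F (a :: r) = c * G (a :: r) + H (a :: r)) ->
  dd F s = c * dd G s + dd H s.
Proof.
elim: s F G H => [|a [|b t] IH] F G H FGH; rewrite ?dd1 ?mulr0 ?addr0 // !dd_cons.
rewrite (IH (fun r => F (a :: r)) (fun r => G (a :: r)) (fun r => H (a :: r))) //.
by rewrite !FGH; ring.
Qed.

Lemma dd_eq F G s : (forall a r, F (a :: r) = G (a :: r)) -> dd F s = dd G s.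
Proof.
move=> FG; rewrite (@dd_lin 0 F G G) ?mul0r ?add0r // => a r.
by rewrite mul0r add0r.
Qed.

Lemma dd_eq0 F s : (forall a r, F (a :: r) = 0) -> dd F s = 0.
Proof.
by move=> F0; rewrite (@dd_lin (-1) F F F) ?mulN1r ?addNr // => a r;
  rewrite F0 mulr0 addr0.
Qed.

Lemma dd_mulC (G : seq A -> A) c F s :
  (forall a r, F (a :: r) = c * G (a :: r)) -> dd F s = c * dd G s.
Proof.
move=> FG; rewrite (@dd_lin c F G (fun=> 0)) => [|a r]; last by rewrite addr0.
by rewrite (@dd_eq0 (fun=> 0)) // addr0.
Qed.

Definition slot_linear (y : A) F := forall u a v,
  F (u ++ (y * a) :: v) = y * F (u ++ a :: v).
Definition normalized F := forall u v, F (u ++ 1 :: v) = 0.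

(** Scaling becomes a product in [A], so that goals mixing both can be closed by [ring]. *)
Lemma scale_mul (c : k) : exists e : A, forall z, c *: z = e * z.
Proof. by exists c%:A => z; rewrite mulr_algl. Qed.

Lemma mlin_cons F a : mlin F -> mlin (fun r => F (a :: r)).
Proof. by move=> Fm u v c x y; apply: (Fm (a :: u)). Qed.

Lemma dd_mlin F : mlin F -> mlin (dd F).
Proof.
move=> Fm u v c; have [e eE] := scale_mul c.
elim: u F Fm => [|a [|b u] IH] F Fm x y.
- case: v => [|b t]; first by rewrite !dd1 scaler0 addr0.
  rewrite !cat0s !dd_cons.
  rewrite (@dd_lin e _ (fun r => F (x :: r)) (fun r => F (y :: r))); last first.
    by move=> *; rewrite (Fm [::]) eE.
  by rewrite [(_ + _) * b]mulrDl -scalerAl !(Fm [::]) !eE; ring.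
- have := IH _ (mlin_cons a Fm) x y; rewrite !cat_cons ?cat0s !dd_cons => ->.
  by rewrite mulrDr -scalerAr !(Fm [::]) !eE; ring.
- have := IH _ (mlin_cons a Fm) x y; rewrite !cat_cons ?cat0s !dd_cons => ->.
  by rewrite (Fm (b :: u)) (Fm (a * b :: u)) (Fm (a :: u)) !eE; ring.
Qed.

Lemma dd_slot_linear y F : slot_linear y F -> slot_linear y (dd F).
Proof.
move=> Fm u; elim: u F Fm => [|a [|b u] IH] F Fm x v.
- case: v => [|b t]; first by rewrite !dd1 mulr0.
  rewrite !cat0s !dd_cons.
  rewrite (@dd_mulC (fun r => F (x :: r)) y); last by move=> *; rewrite (Fm [::]).
  by rewrite -[y * x * b]mulrA !(Fm [::]); ring.
- have := IH (fun r => F (a :: r)) (fun w => Fm (a :: w)) x v;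
    rewrite !cat_cons ?cat0s !dd_cons => ->.
  by rewrite [a * (y * x)]mulrCA !(Fm [::]); ring.
- have := IH (fun r => F (a :: r)) (fun w => Fm (a :: w)) x v;
    rewrite !cat_cons ?cat0s !dd_cons => ->.
  by rewrite (Fm (b :: u)) (Fm (a * b :: u)) (Fm (a :: u)); ring.
Qed.

(** The two terms that multiply the 1 into its neighbours cancel; in the others it stays in one of
    the first [l] slots. The bound is needed because units are removed one slot after the other. *)
Lemma dd_normalized_upto l F :
  (forall u v, (size u < l)%N -> F (u ++ 1 :: v) = 0) ->
  forall u v, (size u < l)%N -> dd F (u ++ 1 :: v) = 0.
Proof.
move=> F1 u; elim: u l F F1 => [|a [|b u] IH] [//|l] F F1 v ul.
- have F10 r : F (1 :: r) = 0 by exact: (F1 [::]).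
  case: v => [|b t] //; rewrite cat0s dd_cons dd_eq0; last by move=> *;
    exact: (F1 [::]).
  by rewrite !mul1r F10 subrr add0r mulr0 subr0.
- have F10 r : F (1 :: r) = 0 by exact: (F1 [::]).
  have := IH l (fun r => F (a :: r)) (fun w r => F1 (a :: w) r) v;
    rewrite !cat_cons ?cat0s !dd_cons => -> //.
  by rewrite mulr1 F10 mulr0 sub0r mul1r addNr subr0.
- have := IH l (fun r => F (a :: r)) (fun w r => F1 (a :: w) r) v;
    rewrite !cat_cons ?cat0s !dd_cons => -> //.
  by rewrite (F1 (b :: u) v (ltnW ul)) (F1 (a * b :: u) v (ltnW ul)) (F1 (a :: u) v
    (ltnW ul)) !mulr0 !subr0 addr0.
Qed.

Lemma dd_normalized F : normalized F -> normalized (dd F).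
Proof.
move=> F1 u v; apply: (@dd_normalized_upto (size u).+1) => // u' v' _; exact: F1.
Qed.

Lemma dd_bounded N F : bounded N F -> bounded N.+1 (dd F).
Proof.
move=> FN s; elim: s N F FN => [|a [|b t] IH] N F FN // sN; rewrite dd_cons.
rewrite (IH N.-1); last by case: N {FN} sN => //=.
  by rewrite !FN ?mulr0 ?subr0 ?addr0 //=; lia.
by move=> r rN; apply: FN => /=; lia.
Qed.

Lemma bar_d_is_cochain f : is_cochain (bar_d f).
Proof.
suff -> : bar_d f = outer (dd (inner f)).
  apply: outer_is_cochain; first exact/dd_mlin/inner_mlin.
  by have [N fN] := inner_bounded f; exists N.+1; apply: dd_bounded.
apply/funext => s; have [s2|] := ltnP (size s) 2.
  by rewrite outer_small // /bar_d big_geq //; lia.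
by case/seq_outer => x [u [y ->]]; rewrite bar_d_inner outerE.
Qed.

Definition dC f : cochain A := Cochain (asboolT (bar_d_is_cochain f)).

Lemma inner_dC f s : inner (dC f) s = dd (inner f) s.
Proof. exact: inner_bar_d. Qed.

Lemma dCP c f g : dC (c *: f + g) = c *: dC f + dC g.
Proof. by apply: val_inj; apply: bar_dP. Qed.

Lemma dCD f g : dC (f + g) = dC f + dC g.
Proof. by rewrite -[f]scale1r dCP !scale1r. Qed.

Lemma dCB f g : dC (f - g) = dC f - dC g.
Proof. by rewrite -scaleN1r addrC dCP scaleN1r addrC. Qed.

Lemma dC0 : dC 0 = 0.
Proof. by have := dCB 0 0; rewrite !subrr. Qed.

Lemma dCN f : dC (- f) = - dC f.
Proof. by rewrite -[- f]sub0r dCB dC0 sub0r. Qed.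

Lemma dC_dC f : dC (dC f) = 0.
Proof. by apply: val_inj; apply/funext => s; apply: bar_dd. Qed.

Definition twist f : cochain A := Cochain (asboolT (sgn_twist_cochain (cochainP f))).

Lemma dCM f g : dC (f * g) = dC f * g + twist f * dC g.
Proof. by apply: val_inj; apply: (cup_leibniz (cochainP f) (cochainP g)). Qed.

End Inner.
Arguments dd : simpl never.

(** * Gauge transformations *)

Definition lmap (k : fieldType) (A : comAlgType k) (L : A -> A) :=
  forall (c : k) u v, L (c *: u + v) = c *: L u + L v.

(* [A] has the k-basis x^i y^j (i < b) and [lin E] is the linear map sending
   x^i y^j to [E i j]. *)
Record coordinates (k : fieldType) (A : comAlgType k) (a b : nat) (x y : A)
    (lin : (nat -> nat -> A) -> A -> A) : Prop := Coordinates {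
  lin_linear : forall E, lmap (lin E);
  lin_mon : forall E i j, (i < b)%N -> lin E (x ^+ i * y ^+ j) = E i j;
  lin_ext : forall L M : A -> A, lmap L -> lmap M ->
    (forall i j, (i < b)%N -> L (x ^+ i * y ^+ j) = M (x ^+ i * y ^+ j)) -> L =1 M;
  coord_b : (0 < b)%N;
  coord_rel : x ^+ b = y ^+ a;
  coord_reg : forall u, x * u = 0 -> u = 0
}.

(** Kept abstract so that the same reductions also serve with [hom] constantly true, where no weight
    is available. *)
Record weights (k : fieldType) (A : comAlgType k) (a b : nat) (x y : A)
    (lin : (nat -> nat -> A) -> A -> A) (hom : int -> A -> Prop) : Prop := Weights {
  hom0 : forall w, hom w 0;
  homP : forall w c u v, hom w u -> hom w v -> hom w (c *: u + v);
  homM : forall w w' u v, hom w u -> hom w' v -> hom (w + w') (u * v);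
  hom1 : hom 0 1;
  homx : hom a%:Z x;
  homy : hom b%:Z y;
  hom_lin : forall E w d u, (forall i j, hom (a%:Z *+ i + b%:Z *+ j + w) (E i j)) ->
    hom d u -> hom (d + w) (lin E u)
}.

Section Gauge.
Variables (k : fieldType) (A : comAlgType k) (a b : nat) (x y : A).
Variable lin : (nat -> nat -> A) -> A -> A.
Variable hom : int -> A -> Prop.
Hypothesis C : coordinates a b x y lin.
Hypothesis W : weights a b x y lin hom.
Implicit Types (f g h : cochain A) (F G H : seq A -> A) (s u v : seq A) (w : int).

Lemma lmap0 (L : A -> A) : lmap L -> L 0 = 0.
Proof. by move=> Ll; have := Ll (-1) 0 0; rewrite scaler0 addr0 scaleN1r addNr. Qed.

Lemma lmapZ (L : A -> A) c (u : A) : lmap L -> L (c *: u) = c *: L u.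
Proof. by move=> Ll; rewrite -[c *: u]addr0 Ll lmap0 // addr0. Qed.

Lemma lmapD (L : A -> A) (u v : A) : lmap L -> L (u + v) = L u + L v.
Proof. by move=> Ll; rewrite -[u]scale1r Ll !scale1r. Qed.

Lemma lmap_comb (e : A) (L M : A -> A) : lmap L -> lmap M ->
  lmap (fun u : A => e * L u + M u).
Proof.
move=> Ll Ml c u v; rewrite Ll Ml; have [t tE] := scale_mul A c.
by rewrite !tE; ring.
Qed.

Lemma lin_comb (e : A) E E1 E2 : (forall i j, E i j = e * E1 i j + E2 i j) ->
  forall u : A, lin E u = e * lin E1 u + lin E2 u.
Proof.
move=> EE; apply: (lin_ext C); first exact: lin_linear C _.
  by apply: lmap_comb; apply: lin_linear C _.
by move=> i j ib; rewrite !(lin_mon C) // EE.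
Qed.

Lemma lin_eq0 E (u : A) : (forall i j, E i j = 0) -> lin E u = 0.
Proof.
move=> E0; rewrite (@lin_comb (-1) E E E) ?mulN1r ?addNr // => i j.
by rewrite !E0 mulr0 addr0.
Qed.

Lemma lin_mulC (e : A) E E1 (u : A) : (forall i j, E i j = e * E1 i j) ->
  lin E u = e * lin E1 u.
Proof.
move=> EE; rewrite (@lin_comb e E E1 (fun _ _ => 0)) => [|i j]; last by rewrite addr0.
by rewrite (@lin_eq0 (fun _ _ => 0)) // addr0.
Qed.

Lemma lin_one E : E 0%N 0%N = 0 -> lin E 1 = 0.
Proof. by move=> <-; rewrite -(lin_mon C _ _ (coord_b C)) !expr0 mulr1. Qed.

(* Gauge transformation in position [l]; up to sign it solves
   K(u, y m, v) - y K(u, m, v) = F(u, y, m, v) for u of size l. *)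
Fixpoint gauge_y l F s : A :=
  match s with
  | t :: s' =>
    match l with
    | 0%N => lin (fun i j => \sum_(m < j) y ^+ (j - m.+1) *
                    F (y :: x ^+ i * y ^+ m :: s')) t
    | l'.+1 => - gauge_y l' (fun r => F (t :: r)) s'
    end
  | _ => 0
  end.

Lemma gauge_y_lin l e F G H s :
  (forall t r, F (t :: r) = e * G (t :: r) + H (t :: r)) ->
  gauge_y l F s = e * gauge_y l G s + gauge_y l H s.
Proof.
elim: l F G H s => [|l IH] F G H [|t s] FGH /=; rewrite ?mulr0 ?addr0 //.
  apply: lin_comb => i j; rewrite mulr_sumr -big_split; apply: eq_bigr => m _ /=.
  by rewrite FGH mulrDr mulrCA.
rewrite (IH _ (fun r => G (t :: r)) (fun r => H (t :: r))) //.
by rewrite opprD mulrN.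
Qed.

Lemma gauge_y_mulC l e F G s :
  (forall t r, F (t :: r) = e * G (t :: r)) -> gauge_y l F s = e * gauge_y l G s.
Proof.
move=> FG; rewrite (@gauge_y_lin l (e - 1) F G G) => [|t r]; last by rewrite FG; ring.
by ring.
Qed.

Lemma gauge_y_eq0 l F s : (forall t r, F (t :: r) = 0) -> gauge_y l F s = 0.
Proof.
by move=> F0; rewrite (@gauge_y_mulC l 0 F F) ?mul0r // => t r; rewrite F0 mul0r.
Qed.

Lemma gauge_y_mlin l F : mlin F -> mlin (gauge_y l F).
Proof.
move=> Fm u v c; have [e eE] := scale_mul A c; move: Fm.
elim: u l F => [|t u IH] [|l] F Fm p q /=.
- exact: lin_linear C _ _ _ _.
- rewrite (@gauge_y_lin l e _ (fun r => F (p :: r)) (fun r => F (q :: r))); last first.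
    by move=> *; rewrite (Fm [::]) eE.
  by rewrite eE; ring.
- rewrite [X in _ = X + _]eE; apply: lin_comb => i j; rewrite mulr_sumr -big_split.
  apply: eq_bigr => m _ /=; rewrite (Fm [:: y, x ^+ i * y ^+ m & u]) eE.
  by rewrite mulrDr mulrCA.
- by rewrite IH; [rewrite !eE; ring | apply: mlin_cons].
Qed.

Lemma gauge_y_normalized l F : normalized F -> normalized (gauge_y l F).
Proof.
move=> F1 u; elim: u l F F1 => [|t u IH] [|l] F F1 v /=.
- by apply: lin_one; rewrite big_ord0.
- by rewrite gauge_y_eq0 ?oppr0 // => *; apply: (F1 [::]).
- apply: lin_eq0 => i j; rewrite big1 // => m _.
  by rewrite (F1 [:: y, x ^+ i * y ^+ m & u]) mulr0.
- by rewrite IH ?oppr0 // => u' v'; apply: (F1 (t :: u')).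
Qed.

(** Here and in [y_linear_upto], the extra argument [m] exempts the last slot, where a derivation
    along [y] has to survive. *)
Definition kills_y l F := forall u m v, (size u < l)%N -> F (u ++ y :: m :: v) = 0.
Definition y_linear_upto l F := forall u t m v, (size u < l)%N ->
  F (u ++ (y * t) :: m :: v) = y * F (u ++ t :: m :: v).

(** In slot [l], [y] is the basis element x^0 y^1, so the sum in [gauge_y] has the single term
    F(..., y, 1, ...), zero by normalization. The last slot is covered too. *)
Lemma gauge_y_kills_y l F : normalized F -> kills_y l F ->
  forall u v, (size u <= l)%N -> gauge_y l F (u ++ y :: v) = 0.
Proof.
move=> F1 Fy u; elim: u l F F1 Fy => [|t u IH] [|l] F F1 Fy v //= ul.
- rewrite -[y in lin _ y]mul1r -[1](expr0 x) -[y in lin _ (_ * y)]expr1.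
  rewrite (lin_mon C) ?(coord_b C) // big_ord1 expr0 !mul1r.
  exact: (F1 [:: y]).
- by rewrite gauge_y_eq0 ?oppr0 // => m r; apply: (Fy [::]).
- rewrite IH ?oppr0 // => [u' v'|u' m v' u'l]; first exact: (F1 (t :: u')).
  exact: (Fy (t :: u')).
Qed.

Lemma gauge_y_slot_linear l F u t v : y_linear_upto l F -> (size u < l)%N ->
  gauge_y l F (u ++ (y * t) :: v) = y * gauge_y l F (u ++ t :: v).
Proof.
elim: u l F => [|p u IH] [|l] F Fl //= ul.
- rewrite (@gauge_y_mulC l y _ (fun r => F (t :: r))) ?mulrN // => q r.
  exact: (Fl [::]).
- rewrite IH ?mulrN // => u' t' m' v' u'l; exact: (Fl (p :: u')).
Qed.

(** The equation for which the gauge was designed. On x^i y^j, passing from j to j+1 multiplies the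
    old terms of the sum by [y] and adds the term m = j. *)
Lemma gauge_y_y l F u t v : mlin F -> size u = l ->
  gauge_y l F (u ++ (y * t) :: v) = y * gauge_y l F (u ++ t :: v) + (-1) ^+ l * F (u
    ++ y :: t :: v).
Proof.
move=> Fm <-{l}; elim: u F Fm => [|p u IH] F Fm /=; last first.
  by rewrite IH; [rewrite exprS; ring | apply: mlin_cons].
rewrite expr0 mul1r; pose E i j := \sum_(m < j) y ^+ (j - m.+1) *
  F (y :: x ^+ i * y ^+ m :: v).
apply: (@lin_ext _ _ _ _ _ _ _ C (fun t => lin E (y * t))
  (fun t => y * lin E t + F (y :: t :: v))) => {t}.
- by move=> c p q; rewrite mulrDr -scalerAr (lin_linear C).
- apply: (@lmap_comb y (lin E) (fun t => F (y :: t :: v))).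
    exact: lin_linear C _.
  by move=> c p q; exact: (Fm [:: y]).
- move=> i j ib /=; rewrite mulrCA -exprS !(lin_mon C) // /E big_ord_recr /=.
  rewrite subnn expr0 mul1r mulr_sumr; congr (_ + _); apply: eq_bigr => m _.
  by rewrite mulrA -exprS; congr (_ ^+ _ * _); have := ltn_ord m; lia.
Qed.

Lemma gauge_y_bounded N l F : bounded N.+1 F -> bounded N (gauge_y l F).
Proof.
move=> FN s; elim: l N F FN s => [|l IH] N F FN [|t s] //= sN.
  by apply: lin_eq0 => i j; rewrite big1 // => m _; rewrite FN ?mulr0 //=; lia.
rewrite (IH N.-1) ?oppr0 //; last by lia.
by move=> r rN; apply: FN => /=; lia.
Qed.

(** Most terms keep [y] in a killed slot. The product with the left neighbour (or the left outer
    action) gives y F(u, m, v) by linearity, the product with the right one gives F(u, y m, v), and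
    the right outer action counts only if it leaves [y] last. *)
Lemma dd_y F u m v : kills_y (size u).+1 F -> y_linear_upto (size u) F ->
  dd F (u ++ y :: m :: v) = (-1) ^+ size u *
    (y * F (u ++ m :: v) - F (u ++ (y * m) :: v) +
     (if v is [::] then m * F (rcons u y) else 0)).
Proof.
elim: u F => [|t u IH] F Fy Fl;
  have F0 c r : F (y :: c :: r) = 0 by exact: (Fy [::]).
  rewrite !cat0s dd_cons expr0 mul1r; case: v => [|c v]; first by rewrite dd1 subr0.
  rewrite F0 // mulr0 (@dd_eq0 _ _ (fun r => F (y :: r))) //.
  by rewrite subr0 !addr0.
have := IH (fun r => F (t :: r)) (fun u' => Fy (t :: u')) (fun u' => Fl (t :: u')).
rewrite exprS mulN1r mulNr /= => <-.
case: u {IH} Fy Fl => [|c u] Fy Fl; rewrite ?cat_cons ?cat0s dd_cons.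
  by rewrite F0 [t * y]mulrC (Fl [::]) //; ring.
rewrite (Fy (c :: u)) ?(Fy (t * c :: u)) ?(Fy (t :: u)) //=; ring.
Qed.

(** By [dd_y], the differential at (u, y, t, m, v) is up to sign the defect of [y]-linearity in the
    slot after [u]; the earlier slots are linear by induction. *)
Lemma y_linear_of_dd l F : kills_y l F ->
  (forall u m v, dd F (u ++ y :: m :: v) = 0) -> y_linear_upto l F.
Proof.
move=> Fy dF; elim: l Fy => [//|l IH] Fy u t m v ul.
have Fl : y_linear_upto l F by apply: IH => u' m' v' u'l; apply: Fy; exact: ltnW.
have := dF u t (m :: v); rewrite dd_y; first last.
- by move=> u' t' m' v' u'u; apply: Fl; lia.
- by move=> u' m' v' u'u; apply: Fy; lia.
by rewrite addr0 -[RHS](mulr0 ((-1) ^+ size u)) => /(can_inj (signrMK _)) /subr0_eq.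
Qed.

(* Inserting 1 in position [l], up to sign: the gauge transformation that
   normalizes position [l]. *)
Fixpoint ins1 l F s : A :=
  match l with
  | 0%N => F (1 :: s)
  | l'.+1 => if s is t :: s' then - ins1 l' (fun r => F (t :: r)) s' else 0
  end.

Lemma ins1_lin l e F G H s :
  (forall t r, F (t :: r) = e * G (t :: r) + H (t :: r)) ->
  ins1 l F s = e * ins1 l G s + ins1 l H s.
Proof.
elim: l F G H s => [|l IH] F G H s FGH /=; first exact: FGH.
case: s => [|t s]; rewrite ?mulr0 ?addr0 //.
rewrite (IH _ (fun r => G (t :: r)) (fun r => H (t :: r))) //.
by rewrite opprD mulrN.
Qed.

Lemma ins1_eq0 l F s : (forall t r, F (t :: r) = 0) -> ins1 l F s = 0.
Proof.
move=> F0; rewrite (@ins1_lin l (-1) F F F) ?mulN1r ?addNr // => t r.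
by rewrite !F0 mulr0 addr0.
Qed.

Lemma ins1_mlin l F : mlin F -> mlin (ins1 l F).
Proof.
move=> Fm u v c; have [e eE] := scale_mul A c; move: Fm.
elim: l u F => [|l IH] [|t u] F Fm p q /=.
- exact: (Fm [:: 1]).
- exact: (Fm (1 :: t :: u)).
- rewrite (@ins1_lin l e _ (fun r => F (p :: r)) (fun r => F (q :: r))); last first.
    by move=> *; rewrite (Fm [::]) eE.
  by rewrite eE; ring.
- by rewrite IH; [rewrite !eE; ring | apply: mlin_cons].
Qed.

Definition kills_1 l F := forall u v, (size u < l)%N -> F (u ++ 1 :: v) = 0.

Lemma ins1_kills_1 l F : kills_1 l F -> kills_1 l (ins1 l F).
Proof.
elim: l F => [//|l IH] F F1 [|t u] v ul /=.
  by rewrite ins1_eq0 ?oppr0 // => *; apply: (F1 [::]).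
by rewrite IH ?oppr0 // => u' v'; apply: (F1 (t :: u')).
Qed.

Lemma ins1_bounded N l F : bounded N.+1 F -> bounded N (ins1 l F).
Proof.
elim: l N F => [|l IH] N F FN [|t s] //= sN; rewrite ?FN //.
by rewrite (IH N.-1) ?oppr0 //; [move=> r rN; apply: FN => /=|]; lia.
Qed.

(** Contraction by a unit: expanding dF at the doubled 1 produces F(u, 1, v) minus the differential
    of the insertion, up to sign, because the terms with a 1 in an earlier slot vanish. *)
Lemma dd_ins1 F u v : kills_1 (size u) F ->
  dd F (u ++ 1 :: 1 :: v) = 0 -> dd (ins1 (size u) F) (u ++ 1 :: v) = F (u ++ 1 :: v).
Proof.
elim: u F => [|t u IH] F F1.
  rewrite !cat0s dd_cons !mul1r subrr add0r.
  by move=> /subr0_eq.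
have G1 := ins1_kills_1 F1.
have dF G r : dd (fun r => - G r) r = - dd G r :> A.
  by rewrite (@dd_mulC _ _ G (-1)) ?mulN1r // => *; rewrite mulN1r.
have F1t : kills_1 (size u) (fun r => F (t :: r)) by move=> u'; apply: (F1 (t :: u')).
have := IH _ F1t.
case: u {IH F1t} F1 G1 => [|c u] F1 G1.
  rewrite !cat_cons !cat0s (dd_cons F t) (dd_cons (ins1 _ F) t) => IH.
  rewrite mulr1 (F1 [::]) // !mul1r mulr0 sub0r addNr sub0r => /eqP.
  by rewrite oppr_eq0 => /eqP /IH; rewrite (G1 [::]) //;
    rewrite mulr0 sub0r addNr sub0r dF opprK.
rewrite !cat_cons (dd_cons F t) (dd_cons (ins1 _ F) t) => IH.
rewrite (F1 (c :: u)) // (F1 (t * c :: u)) // (F1 (t :: u)) // !mulr0 subr0 add0r sub0r.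
move=> /eqP; rewrite oppr_eq0 => /eqP /IH.
rewrite (G1 (c :: u)) // (G1 (t * c :: u)) // (G1 (t :: u)) //.
by rewrite !mulr0 subr0 add0r sub0r dF opprK.
Qed.

(** * Weights of functions of several arguments *)

Definition weighted w F := forall s : seq (int * A), (forall p, p \in s ->
  hom p.1 p.2) ->
  hom ((\sum_(p <- s) p.1) + w) (F [seq p.2 | p <- s]).

Lemma hom_eq w w' (u : A) : hom w u -> w = w' -> hom w' u.
Proof. by move=> h <-. Qed.

Lemma homD w (u v : A) : hom w u -> hom w v -> hom w (u + v).
Proof. by move=> hu hv; rewrite -[u]scale1r; apply: (homP W). Qed.

Lemma homZ w c (u : A) : hom w u -> hom w (c *: u).
Proof. by move=> hu; rewrite -[c *: u]addr0; apply: (homP W) => //;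
  apply: (hom0 W). Qed.

Lemma homN w (u : A) : hom w u -> hom w (- u).
Proof. by rewrite -scaleN1r; apply: homZ. Qed.

Lemma homX w n (u : A) : hom w u -> hom (w *+ n) (u ^+ n).
Proof.
move=> hu; elim: n => [|n IH]; first by rewrite mulr0n expr0; apply: hom1 W.
by rewrite mulrS exprS; apply: (homM W).
Qed.

Lemma hom_sum (I : Type) (r : seq I) (P : pred I) (F : I -> A) w :
  (forall i, P i -> hom w (F i)) -> hom w (\sum_(i <- r | P i) F i).
Proof.
move=> hF; elim/big_rec: _ => [|i u Pi hu]; first exact: hom0 W _.
by apply: homD => //; apply: hF.
Qed.

Lemma weighted_cons w F d t : weighted w F -> hom d t ->
  weighted (d + w) (fun r => F (t :: r)).
Proof.
move=> hF ht s hs; apply: (hom_eq (hF ((d, t) :: s) _)).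
  by move=> p; rewrite inE => /predU1P[->|/hs].
by rewrite big_cons; ring.
Qed.

Lemma weighted_at w F d t (s : seq (int * A)) : weighted w F -> hom d t ->
  (forall p, p \in s -> hom p.1 p.2) ->
  hom (\sum_(p <- s) p.1 + d + w) (F (t :: [seq p.2 | p <- s])).
Proof.
by move=> hF ht hs; apply: (hom_eq (weighted_cons hF ht hs)); ring.
Qed.

Lemma weighted_nil w F : weighted w F -> hom w (F [::]).
Proof. by move=> hF; apply: (hom_eq (hF [::] _)) => //; rewrite big_nil add0r. Qed.

Lemma weightedD w F G : weighted w F -> weighted w G -> weighted w (fun s => F s + G s).
Proof. by move=> hF hG s hs; apply: homD; [apply: hF | apply: hG]. Qed.

Lemma weightedN w F : weighted w F -> weighted w (fun s => - F s).
Proof. by move=> hF s hs; apply: homN; apply: hF. Qed.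

Lemma weighted_dd w F : weighted w F -> weighted w (dd F).
Proof.
move=> hF s; elim: s w F hF => [|p [|q s] IH] w F hF hs; try exact: hom0 W _.
have hp : hom p.1 p.2 by apply: hs; rewrite inE eqxx.
have hq : hom q.1 q.2 by apply: hs; rewrite !inE eqxx orbT.
have hs' r : r \in s -> hom r.1 r.2 by move=> rs; apply: hs; rewrite !inE rs !orbT.
rewrite /= dd_cons !big_cons; apply: homD; last apply: homN; last first.
  apply: (hom_eq (IH _ _ (weighted_cons hF hp) _)); last by rewrite big_cons; ring.
  by move=> r; rewrite inE => /predU1P[->|/hs'].
apply: homD; first apply: homD; last 1 first.
- by apply: (hom_eq (homM W hq (weighted_at hF hp hs'))); ring.
- by apply: (hom_eq (homM W hp (weighted_at hF hq hs'))); ring.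
- by apply: homN; apply: (hom_eq (weighted_at hF (homM W hp hq) hs')); ring.
Qed.

Lemma weighted_ins1 w l F : weighted w F -> weighted w (ins1 l F).
Proof.
elim: l w F => [|l IH] w F hF s hs /=.
  by apply: (hom_eq (weighted_at hF (hom1 W) hs)); ring.
case: s hs => [|p s] hs; first exact: hom0 W _.
rewrite /=; apply: homN; rewrite big_cons; apply: (hom_eq (IH (p.1 + w) _ _ _ _)).
- by apply: weighted_cons => //; apply: hs; rewrite inE eqxx.
- by move=> r rs; apply: hs; rewrite inE rs orbT.
- by ring.
Qed.

Lemma weighted_gauge_y w l F : weighted w F -> weighted w (gauge_y l F).
Proof.
elim: l w F => [|l IH] w F hF [|p s] hs; try exact: hom0 W _.
  rewrite /= big_cons -addrA; apply: (hom_lin W); last by apply: hs; rewrite inE eqxx.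
  move=> i j; apply: hom_sum => m _.
  have hs' r : r \in s -> hom r.1 r.2 by move=> rs; apply: hs; rewrite !inE rs !orbT.
  have hm := homM W (homX i (homx W)) (homX m (homy W)).
  have hF' := weighted_at (weighted_cons hF (homy W)) hm hs'.
  apply: (hom_eq (homM W (homX (j - m.+1) (homy W)) hF')).
  have -> : b%:Z *+ j = b%:Z *+ (j - m.+1) + b%:Z *+ m + b%:Z.
    by rewrite -mulrnDr -mulrSr; congr (_ *+ _); have := ltn_ord m; lia.
  by ring.
rewrite /=; apply: homN; rewrite big_cons; apply: (hom_eq (IH (p.1 + w) _ _ _ _)).
- by apply: weighted_cons => //; apply: hs; rewrite inE eqxx.
- by move=> r rs; apply: hs; rewrite inE rs orbT.
- by ring.
Qed.

Lemma boundedW N M F : (N <= M)%N -> bounded N F -> bounded M F.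
Proof. by move=> NM FN s sM; apply: FN; apply: leq_trans sM. Qed.

Lemma inner_eq f F : inner f =1 F -> inner f = F.
Proof. by move=> fF; apply/funext. Qed.

Lemma weighted_dC w f : weighted w (inner f) -> weighted w (inner (dC f)).
Proof. by move=> hf; rewrite (inner_eq (inner_dC f)); apply: weighted_dd. Qed.

(** Units are removed one slot at a time, and [bounded] makes finitely many slots enough. The
    condition bears on [dC f], which covers cocycles and also primitives of normalized cochains. *)
Lemma normalize w N f : bounded N.+1 (inner f) -> weighted w (inner f) ->
  normalized (inner (dC f)) ->
  exists g, [/\ bounded N (inner g), weighted w (inner g) & normalized (inner (f - dC
    g))].
Proof.
move=> fN fw f1.
suff /(_ N.+1)[g [gN gw g1]] : forall l, exists g, [/\ bounded N (inner g),
    weighted w (inner g) & kills_1 l (inner (f - dC g))].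
  exists g; split=> // u v; have [/g1 -> //|uN] := ltnP (size u) N.+1.
  rewrite innerB inner_dC fN ?(dd_bounded gN) ?subrr //; rewrite size_cat; lia.
elim=> [|l [g [gN gw g1]]].
  exists 0; split=> //; exact: (fun _ _ => hom0 W _).
set f' := f - dC g in g1.
have f'N : bounded N.+1 (inner f').
  by move=> s sN; rewrite innerB inner_dC fN ?(dd_bounded gN) ?subrr.
have [h hE] : exists h : cochain A, inner h = ins1 l (inner f').
  apply: mk_cochain; first exact/ins1_mlin/inner_mlin.
  by exists N; apply: ins1_bounded.
exists (g + h); split.
- by move=> s sN; rewrite innerD (gN s sN) add0r hE; apply: ins1_bounded sN.
- suff weighted_h : weighted w (inner h) by exact: (weightedD gw weighted_h).
  by rewrite hE; apply: weighted_ins1; apply: (weightedD fw (weightedN (weighted_dC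
    gw))).
move=> u v; rewrite ltnS dCD opprD addrA -/f' innerB inner_dC hE => ul.
have [{}ul|lu] := ltnP (size u) l; last first.
  (* In slot [l] the correction cancels the value exactly. Its effect on earlier slots is nil by
     [dd_normalized_upto]. *)
  have <- : size u = l by lia.
  rewrite dd_ins1 ?subrr //; first by move=> u' v' u'u; apply: g1; lia.
  rewrite -inner_dC /f' dCB dC_dC subr0; exact: f1.
rewrite g1 // (@dd_normalized_upto _ _ l) ?subrr //.
exact: ins1_kills_1.
Qed.

Lemma relativize w N f : bounded N.+1 (inner f) -> weighted w (inner f) ->
  normalized (inner f) ->
  (forall u m v, inner (dC f) (u ++ y :: m :: v) = 0) ->
  exists g, [/\ bounded N (inner g), weighted w (inner g), normalized (inner g),
    forall u m v, inner (f - dC g) (u ++ y :: m :: v) = 0 &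
    forall u t m v, inner (f - dC g) (u ++ (y * t) :: m :: v) =
      y * inner (f - dC g) (u ++ t :: m :: v)].
Proof.
move=> fN fw f1 fy.
suff /(_ N.+1)[g [gN gw g1 gy]] : forall l, exists g, [/\ bounded N (inner g),
    weighted w (inner g), normalized (inner g) & kills_y l (inner (f - dC g))].
  (* Once [y] is killed outside the last slot, [y]-linearity there follows from the vanishing of the
     differential. *)
  have dN u m v : dd (inner (f - dC g)) (u ++ y :: m :: v) = 0.
    by rewrite -inner_dC dCB dC_dC subr0.
  have gl := y_linear_of_dd gy dN.
  have big s : (N < size s)%N -> inner (f - dC g) s = 0.
    by move=> sN; rewrite innerB inner_dC fN // (dd_bounded gN) ?subrr.
  exists g; split=> // [u m v|u t m v].
    have [/gy -> //|uN] := ltnP (size u) N.+1.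
    by apply: big; rewrite size_cat; lia.
  have [/gl -> //|uN] := ltnP (size u) N.+1.
  by rewrite !big ?mulr0 // size_cat; lia.
elim=> [|l [g [gN gw g1 gy]]].
  exists 0; split=> //; exact: (fun _ _ => hom0 W _).
set f' := f - dC g in gy.
have f'N : bounded N.+1 (inner f').
  by move=> s sN; rewrite innerB inner_dC fN ?(dd_bounded gN) ?subrr.
have f'1 : normalized (inner f').
  move=> u v; rewrite innerB f1 inner_dC dd_normalized ?subrr //.
have f'd u m v : dd (inner f') (u ++ y :: m :: v) = 0.
  by rewrite -inner_dC dCB dC_dC subr0.
have f'l := y_linear_of_dd gy f'd.
have [h hE] : exists h : cochain A, inner h = gauge_y l (inner f').
  apply: mk_cochain; first exact/gauge_y_mlin/inner_mlin.
  by exists N; apply: gauge_y_bounded.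
have h1 : normalized (inner h) by rewrite hE; apply: gauge_y_normalized.
have hy u v : (size u <= l)%N -> inner h (u ++ y :: v) = 0.
  by move=> ul; rewrite hE gauge_y_kills_y.
have hl u t v : (size u < l)%N -> inner h (u ++ (y * t) :: v) =
  y * inner h (u ++ t :: v).
  by move=> ul; rewrite hE gauge_y_slot_linear.
have dN : f - dC (g - h) = f' + dC h by rewrite dCB opprB addrA addrAC.
exists (g - h); rewrite dN; split=> //.
- by move=> s sN; rewrite innerB (gN s sN) sub0r hE (gauge_y_bounded _ f'N sN) oppr0.
- suff weighted_h : weighted w (inner h) by exact: (weightedD gw (weightedN
    weighted_h)).
  by rewrite hE; apply: weighted_gauge_y; apply: (weightedD fw (weightedN
    (weighted_dC gw))).
- by move=> u v; rewrite innerB g1 h1 subrr.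
move=> u m v; rewrite ltnS innerD inner_dC => ul.
rewrite dd_y; first last.
- by move=> u' t' m' v' u'u; apply: hl; lia.
- by move=> u' m' v' u'u; apply: hy; lia.
(* The gauge kills [y] even in the last slot, so the exceptional term of [dd_y] disappears. *)
have -> : (if v is [::] then m * inner h (rcons u y) else 0) = 0.
  by case: v => //; rewrite -cats1 hy ?mulr0.
rewrite addr0.
have [{}ul|lu] := ltnP (size u) l.
  by rewrite gy // hl // subrr mulr0 addr0.
have uE : size u = l by lia.
rewrite hE gauge_y_y //; last exact: inner_mlin.
(* The sign from [dd_y] and the sign from [gauge_y_y] are both (-1)^l and cancel. *)
by rewrite uE opprD addNKr mulrN mulrA -exprMn mulrNN mulr1 expr1n mul1r subrr.
Qed.

End Gauge.

(** * The generators and their relations *)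

Section Classes.
Variables (k : fieldType) (A : comAlgType k) (a b : nat) (x y : A).
Variable lin : (nat -> nat -> A) -> A -> A.
Hypothesis C : coordinates a b x y lin.
Hypothesis a0 : a%:R = 0 :> k.
Implicit Types (f g h : cochain A) (F G H : seq A -> A) (s : seq A) (w : int).

Definition inner0_fun (e : A) s := if s is [::] then e else 0.
Definition inner1_fun (L : A -> A) s := if s is [:: u] then L u else 0.
Definition inner2_fun (B : A -> A -> A) s := if s is [:: u; v] then B u v else 0.

Lemma inner0_mlin e : mlin (inner0_fun e).
Proof. by case=> [|? ?] *; rewrite /= scaler0 addr0. Qed.

Lemma inner1_mlin L : lmap L -> mlin (inner1_fun L).
Proof.
move=> Ll [|p [|q u]] [|r v] c s t /=; rewrite ?scaler0 ?addr0 //; exact: Ll.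
Qed.

Lemma inner2_mlin B : (forall u, lmap (B u)) -> (forall v, lmap (B^~ v)) ->
  mlin (inner2_fun B).
Proof.
move=> Bl Br [|p [|q [|q' u]]] [|r [|r' v]] c s t /=; rewrite ?scaler0 ?addr0 //.
  exact: Br.
exact: Bl.
Qed.

Lemma inner0_bounded e : exists N, bounded N (inner0_fun e).
Proof. by exists 1%N; case. Qed.

Lemma inner1_bounded L : exists N, bounded N (inner1_fun L).
Proof. by exists 2%N; case=> [|u [|v s]]. Qed.

Lemma inner2_bounded B : exists N, bounded N (inner2_fun B).
Proof. by exists 3%N; case=> [|u [|v [|w s]]]. Qed.

Definition const (e : A) : cochain A :=
  Cochain (asboolT (outer_is_cochain (inner0_mlin e) (inner0_bounded e))).

Definition cochain1 L (Ll : lmap L) : cochain A :=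
  Cochain (asboolT (outer_is_cochain (inner1_mlin Ll) (inner1_bounded L))).

Definition cochain2 B (Bl : forall u, lmap (B u)) (Br : forall v, lmap (B^~ v)) :
    cochain A :=
  Cochain (asboolT (outer_is_cochain (inner2_mlin Bl Br) (inner2_bounded B))).

Lemma inner_outer F s : inner (outer F) s = F s.
Proof. by rewrite /inner outerE mul1r mulr1. Qed.

Lemma inner_const e s : inner (const e) s = inner0_fun e s.
Proof. exact: inner_outer. Qed.

Lemma inner_cochain1 L Ll s : inner (@cochain1 L Ll) s = inner1_fun L s.
Proof. exact: inner_outer. Qed.

Lemma inner_cochain2 B Bl Br s : inner (@cochain2 B Bl Br) s = inner2_fun B s.
Proof. exact: inner_outer. Qed.

Lemma inner_constM e f s : inner (const e * f) s = e * inner f s.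
Proof.
rewrite innerM big_ord_recl /= take0 drop0 inner_const /= big1 ?addr0 // => i _.
by case: s i => [|p s] [i ile] //=; rewrite inner_const /= mul0r.
Qed.

Lemma const_comm e f : const e * f = f * const e.
Proof.
apply: cochain_inner_eq => s; rewrite inner_constM innerM big_ord_recr /=.
rewrite take_size drop_size inner_const big1 ?add0r ?[e * _]mulrC // => i _.
rewrite inner_const; case E: (drop i s) => [|p r]; last by rewrite /= mulr0.
by have := size_drop i s; rewrite E /=; have := ltn_ord i; lia.
Qed.

Lemma constM e e' : const (e * e') = const e * const e'.
Proof.
apply: cochain_inner_eq => s; rewrite inner_constM !inner_const.
by case: s => //= *; rewrite mulr0.
Qed.

Lemma constP c e e' : const (c *: e + e') = c *: const e + const e'.
Proof.
apply: cochain_inner_eq => s; rewrite innerD innerZ !inner_const.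
by case: s => //= *; rewrite scaler0 addr0.
Qed.

Lemma constB e e' : const (e - e') = const e - const e'.
Proof. by rewrite addrC -scaleN1r constP scaleN1r addrC. Qed.

Lemma const0 : const 0 = 0.
Proof. by apply: cochain_inner_eq => s; rewrite inner_const; case: s. Qed.

Lemma constN e : const (- e) = - const e.
Proof. by rewrite -[- e]sub0r constB const0 sub0r. Qed.

Lemma const1 : const 1 = 1.
Proof. by apply: cochain_inner_eq => s; rewrite inner_const inner1; case: s. Qed.

Lemma dC_const e : dC (const e) = 0.
Proof.
apply: cochain_inner_eq => s; rewrite inner_dC dd_eq0 // => *.
by rewrite inner_const.
Qed.

Lemma inner_cochain1Mr f L Ll s u :
  inner (f * @cochain1 L Ll) (rcons s u) = inner f s * L u.
Proof.
rewrite innerM size_rcons big_ord_recr /= drop_oversize ?size_rcons //.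
rewrite inner_outer /= mulr0 addr0 big_ord_recr /= -cats1 take_size_cat //.
rewrite drop_size_cat // inner_outer big1 ?add0r // => i _.
rewrite inner_outer drop_cat ltn_ord; case E: (drop i s) => [|p r].
  by have := size_drop i s; rewrite E /=; have := ltn_ord i; lia.
by case: r E => [|? ?] _ /=; rewrite mulr0.
Qed.

Lemma inner_cochain1Mr_nil f L Ll : inner (f * @cochain1 L Ll) [::] = 0.
Proof. by rewrite innerM big_ord1 inner_outer /= mulr0. Qed.

Lemma inner_cochain1Ml f L Ll u s :
  inner (@cochain1 L Ll * f) (u :: s) = L u * inner f s.
Proof.
rewrite innerM !big_ord_recl /= !inner_outer /= !mul0r !add0r.
rewrite take0 drop0 big1 ?addr0 // => i _.
by rewrite inner_outer; case: s i => [|? s] [i ile] //=; rewrite mul0r.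
Qed.

Lemma inner_cochain2M B Bl Br f u v s :
  inner (@cochain2 B Bl Br * f) (u :: v :: s) = B u v * inner f s.
Proof.
rewrite innerM !big_ord_recl /= !inner_outer /= !mul0r !add0r.
rewrite take0 drop0 big1 ?addr0 // => i _.
by rewrite inner_outer; case: s i => [|? s] [i ile] //=; rewrite mul0r.
Qed.

Lemma inner_cochain2M_small B Bl Br f s : (size s < 2)%N ->
  inner (@cochain2 B Bl Br * f) s = 0.
Proof.
move=> s2; rewrite innerM big1 // => i _; rewrite inner_cochain2.
by case: s s2 i => [|u [|v s]] // _ [[|[|i]] ile] //=; rewrite mul0r.
Qed.

Lemma inner_twist f s : inner (twist f) s = (-1) ^+ size s * inner f s.
Proof.
by rewrite {1}/inner /= /sgn_twist /= size_rcons !exprS !mulN1r opprK.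
Qed.

(** The degree of the left factor is even, so the Leibniz rule carries no sign. *)
Lemma dC_cochain2M B Bl Br f : dC (@cochain2 B Bl Br) = 0 ->
  @cochain2 B Bl Br * dC f = dC (@cochain2 B Bl Br * f).
Proof.
move=> dB; rewrite dCM dB mul0r add0r; congr (_ * _).
apply: cochain_inner_eq => s; rewrite inner_twist inner_cochain2.
by case: s => [|u [|v [|? ?]]]; rewrite /= ?mulr0 // !exprS expr0 !mulN1r !opprK mul1r.
Qed.

Lemma lin_ext2 (B1 B2 : A -> A -> A) :
  (forall u, lmap (B1 u)) -> (forall v, lmap (B1^~ v)) ->
  (forall u, lmap (B2 u)) -> (forall v, lmap (B2^~ v)) ->
  (forall i j i' j', (i < b)%N -> (i' < b)%N ->
    B1 (x ^+ i * y ^+ j) (x ^+ i' * y ^+ j') = B2 (x ^+ i * y ^+ j) (x ^+ i' * y ^+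
      j')) ->
  forall u v, B1 u v = B2 u v.
Proof.
move=> B1l B1r B2l B2r B12 u v; move: u; apply: (lin_ext C (B1r v) (B2r v)) => i j ib.
by move: v; apply: (lin_ext C (B1l _) (B2l _)) => i' j' ib'; apply: B12.
Qed.

(** * Derivatives and the carry on [A] *)

Lemma mulrn_a (u : A) : u *+ a = 0.
Proof. by rewrite -scaler_nat a0 scale0r. Qed.

(** The condition says that the rule [E] respects x^b = y^a, so it holds beyond the basis. *)
Lemma lin_mon_all E : (forall i j, E (i + b)%N j = E i (j + a)%N) ->
  forall m j, lin E (x ^+ m * y ^+ j) = E m j.
Proof.
move=> Eb m; elim/ltn_ind: m => m IH j; have [mb|bm] := ltnP m b.
  exact: (lin_mon C).
rewrite -(subnK bm) exprD (coord_rel C) -mulrA -exprD [(a + j)%N]addnC IH.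
  by rewrite Eb.
by have := coord_b C; lia.
Qed.

Lemma lin_mon_carry E i j : (b <= i < b + b)%N ->
  lin E (x ^+ i * y ^+ j) = E (i - b)%N (j + a)%N.
Proof.
move=> /andP[bi ib]; rewrite -{1}(subnK bi) exprD (coord_rel C) -mulrA -exprD.
by rewrite [(a + j)%N]addnC (lin_mon C) //; lia.
Qed.

Lemma lmap_mul (u : A) : lmap ( *%R u).
Proof. by move=> c p q; rewrite mulrDr scalerAr. Qed.

Lemma lmap_comp (L M : A -> A) : lmap L -> lmap M -> lmap (fun u : A => L (M u)).
Proof. by move=> Ll Ml c p q; rewrite Ml Ll. Qed.

(* d/dy; it is well defined because a = 0 in k *)
Definition dy := lin (fun i j => (x ^+ i * y ^+ j.-1) *+ j).
(* d/dx on the basis, which is not a derivation of [A]: see [dx_coboundary] *)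
Definition dx := lin (fun i j => (x ^+ i.-1 * y ^+ j) *+ i).
(** Half the second derivative in y, written with binomials to make sense in characteristic 2. For j
    < 2 the truncated exponent has coefficient 0. *)
Definition dyy := lin (fun i j => (x ^+ i * y ^+ (j - 2)) *+ 'C(j, 2)).

(* [carry u v] is the quotient of u v by x^b - y^a, for u and v written as
   polynomials of degree < b in x. *)
Definition carry (u v : A) := lin (fun i j => lin (fun i' j' =>
  if (b <= i + i')%N then x ^+ (i + i' - b) * y ^+ (j + j') else 0) v) u.

Lemma carry_linl v : lmap (carry^~ v).
Proof. exact: lin_linear C _. Qed.

Lemma carry_linr u : lmap (carry u).
Proof.
move=> c p q; rewrite /carry; have [e eE] := scale_mul A c; rewrite [X in _ = X + _]eE.
by apply: (lin_comb C) => i j; rewrite (lin_linear C) eE.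
Qed.

Lemma carry_mon i j i' j' : (i < b)%N -> (i' < b)%N ->
  carry (x ^+ i * y ^+ j) (x ^+ i' * y ^+ j') =
  if (b <= i + i')%N then x ^+ (i + i' - b) * y ^+ (j + j') else 0.
Proof. by move=> ib ib'; rewrite /carry !(lin_mon C). Qed.

Lemma monM i j i' j' :
  (x ^+ i * y ^+ j) * (x ^+ i' * y ^+ j') = x ^+ (i + i') * y ^+ (j + j').
Proof. by rewrite mulrACA -!exprD. Qed.

(** Reduction by x^b = y^a replaces j by j + a, and these two coefficients agree in k. *)
Lemma dy_mon m j : dy (x ^+ m * y ^+ j) = (x ^+ m * y ^+ j.-1) *+ j.
Proof.
apply: lin_mon_all => {}m {}j; rewrite mulrnDr mulrn_a addr0; case: j => // j.
by rewrite addSn /= exprD (coord_rel C) -mulrA -exprD addnC.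
Qed.

Lemma dy_lmap : lmap dy. Proof. exact: lin_linear C _. Qed.
Lemma dx_lmap : lmap dx. Proof. exact: lin_linear C _. Qed.
Lemma dyy_lmap : lmap dyy. Proof. exact: lin_linear C _. Qed.

Lemma dyM u v : dy (u * v) = u * dy v + v * dy u.
Proof.
apply: (lin_ext2 (B1 := fun u v => dy (u * v)) (B2 := fun u v => u * dy v + v * dy u)).
- by move=> {}u; apply: lmap_comp dy_lmap (lmap_mul u).
- by move=> {}v c p q /=; rewrite mulrDl -scalerAl dy_lmap.
- move=> {}u c p q; rewrite dy_lmap; have [e eE] := scale_mul A c; rewrite !eE; ring.
- move=> {}v c p q /=; rewrite dy_lmap; have [e eE] := scale_mul A c; rewrite !eE; ring.
move=> i j i' j' _ _; rewrite monM !dy_mon !mulrnAr !monM mulrnDr addrC.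
congr (_ + _); [case: j' => // j' | case: j => // j]; first by rewrite addnS.
by rewrite addSn addnC [(j + j')%N]addnC.
Qed.

Lemma dy1 : dy 1 = 0.
Proof. by have := dy_mon 0 0; rewrite !expr0 mulr1 mulr0n. Qed.

Lemma dy_y : dy y = 1.
Proof. by have := dy_mon 0 1; rewrite !expr0 expr1 !mul1r mulr1n. Qed.

Lemma dx_mon i j : (i < b)%N -> dx (x ^+ i * y ^+ j) = (x ^+ i.-1 * y ^+ j) *+ i.
Proof. exact: (lin_mon C). Qed.

Lemma dyy_mon i j : (i < b)%N ->
  dyy (x ^+ i * y ^+ j) = (x ^+ i * y ^+ (j - 2)) *+ 'C(j, 2).
Proof. exact: (lin_mon C). Qed.

Lemma lmap_coboundary (L : A -> A) : lmap L ->
  (forall u, lmap (fun v : A => u * L v - L (u * v) + v * L u)) *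
  (forall v, lmap (fun u : A => u * L v - L (u * v) + v * L u)).
Proof.
move=> Ll; split=> [u|v] c p q; have [e eE] := scale_mul A c.
  by rewrite mulrDr -scalerAr !Ll !eE; ring.
by rewrite [(c *: p + q) * v]mulrDl -scalerAl !Ll !eE; ring.
Qed.

(** In k[x,y] the product u v is its reduced form plus (x^b - y^a) times the carry. Applying d/dx
    and returning to [A], only b x^(b-1) times the carry remains of the second part. *)
Lemma dx_coboundary u v :
  u * dx v - dx (u * v) + v * dx u = (x ^+ b.-1 *+ b) * carry u v.
Proof.
have [L1 L2] := lmap_coboundary dx_lmap.
apply: (lin_ext2 (B1 := fun u v => u * dx v - dx (u * v) + v * dx u)
  (B2 := fun u v => (x ^+ b.-1 *+ b) * carry u v)) => //.
- by move=> {}u; apply: lmap_comp (lmap_mul _) (carry_linr _).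
- by move=> {}v; apply: lmap_comp (lmap_mul _) (carry_linl _).
move=> i j i' j' ib ib'; rewrite monM carry_mon // (dx_mon _ ib) (dx_mon _ ib')
  !mulrnAr !monM.
have -> : (x ^+ (i + i'.-1) * y ^+ (j + j')) *+ i' =
    (x ^+ (i + i').-1 * y ^+ (j + j')) *+ i' by case: i' {ib'} => // i'; rewrite addnS.
have -> : (x ^+ (i' + i.-1) * y ^+ (j' + j)) *+ i =
    (x ^+ (i + i').-1 * y ^+ (j + j')) *+ i.
  by rewrite [(j' + j)%N]addnC [(i' + _)%N]addnC; case: i {ib} => // i; rewrite addSn.
case: leqP => [bi|ib'']; last first.
  by rewrite dx_mon // mulr0 addrAC -mulrnDr addnC subrr.
rewrite [dx _]lin_mon_carry; last by lia.
rewrite mulrnAl mulrA -exprD addrAC -mulrnDr.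
have -> : (b.-1 + (i + i' - b) = (i + i').-1)%N by lia.
(* If i + i' = b, the truncated exponent is harmless because its coefficient is 0. *)
suff -> : (x ^+ (i + i' - b).-1 * y ^+ (j + j' + a)) *+ (i + i' - b) =
   (x ^+ (i + i').-1 * y ^+ (j + j')) *+ (i + i' - b).
  by rewrite -mulrnBr; [congr (_ *+ _); lia | lia].
case E: (i + i' - b)%N => [//|m]; rewrite [(_ + a)%N]addnC exprD -(coord_rel C) mulrA.
by rewrite -exprD /=; congr (_ ^+ _ * _ *+ _); lia.
Qed.

Lemma bin2D m n : ('C(m + n, 2) = 'C(m, 2) + 'C(n, 2) + m * n)%N.
Proof.
elim: n => [|n IH]; first by rewrite bin0n addn0 muln0 !addn0.
by rewrite addnS !binS !bin1 IH mulnS; lia.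
Qed.

(** In k[x,y] the divided second derivative D satisfies D(uv) = u D(v) + v D(u) + u' v'. The
    relation x^b - y^a has derivative 0 in y, as a = 0 in k, while D sends it to minus the binomial
    times y^(a-2); this is the factor of the carry. *)
Lemma dyy_coboundary u v : (2 <= a)%N ->
  u * dyy v - dyy (u * v) + v * dyy u =
  - (dy u * dy v) - (y ^+ (a - 2) *+ 'C(a, 2)) * carry u v.
Proof.
move=> a2; have [L1 L2] := lmap_coboundary dyy_lmap.
apply: (lin_ext2 (B1 := fun u v => u * dyy v - dyy (u * v) + v * dyy u)
  (B2 := fun u v => - (dy u * dy v) - (y ^+ (a - 2) *+ 'C(a, 2)) * carry u v)) => //.
- move=> {}u c p q; rewrite dy_lmap carry_linr; have [e eE] := scale_mul A c.
  by rewrite !eE; ring.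
- move=> {}v c p q; rewrite /= dy_lmap carry_linl; have [e eE] := scale_mul A c.
  by rewrite !eE; ring.
move=> i j i' j' ib ib'; rewrite monM carry_mon // !dy_mon (dyy_mon _ ib) (dyy_mon _
  ib').
rewrite !mulrnAr !mulrnAl !monM -mulrnA.
set z := x ^+ (i + i') * y ^+ (j + j' - 2).
have -> : (x ^+ (i + i') * y ^+ (j + (j' - 2))) *+ 'C(j', 2) = z *+ 'C(j', 2).
  by rewrite /z {z}; case: j' => [|[|j']] //; congr (_ * _ ^+ _ *+ _); lia.
have -> : (x ^+ (i' + i) * y ^+ (j' + (j - 2))) *+ 'C(j, 2) = z *+ 'C(j, 2).
  rewrite /z {z} [(i' + i)%N]addnC; case: j => [|[|j]] //; congr (_ * _ ^+ _ *+ _); lia.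
have -> : (x ^+ (i + i') * y ^+ (j.-1 + j'.-1)) *+ (j * j') = z *+ (j * j').
  rewrite /z {z}; case: j j' => [|j] [|j'] //; rewrite ?muln0 //.
  by congr (_ * _ ^+ _ *+ _); lia.
case: leqP => [bi|ib'']; last first.
  rewrite dyy_mon // mulr0 mul0rn subr0 -/z bin2D !mulrnDr; ring.
rewrite [dyy _]lin_mon_carry; last by lia.
have -> : (y ^+ (a - 2) * (x ^+ (i + i' - b) * y ^+ (j + j'))) *+ 'C(a, 2) =
    (x ^+ (i + i' - b) * y ^+ (j + j' + a - 2)) *+ 'C(a, 2).
  by rewrite mulrCA -exprD; congr (_ * _ ^+ _ *+ _); lia.
set w := x ^+ (i + i' - b) * _.
(* For j + j' < 2 the exponent in [z] is truncated and [z] need not equal [w], but then all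
   coefficients are 0. *)
have [jj|jj] := leqP 2 (j + j').
  have -> : z = w.
    rewrite /z /w -{1}(subnK bi) exprD (coord_rel C) -mulrA -exprD.
    by congr (_ * _ ^+ _); lia.
  by rewrite !bin2D !mulrnDr !mulrnA mulrn_a; ring.
have e1 : 'C(j, 2) = 0%N by rewrite bin_small //; lia.
have e2 : 'C(j', 2) = 0%N by rewrite bin_small //; lia.
have e3 : (j * j' = 0)%N by case: (j) (j') jj => [|[|?]] [|[|?]].
have e4 : 'C(j + j', 2) = 0%N by rewrite bin_small.
by rewrite bin2D e1 e2 e3 e4 add0n mulrnDr !mulrnA mulrn_a !mulr0n; ring.
Qed.

Hypothesis b_neq0 : b%:R != 0 :> k.

Lemma reg_xb (u : A) : (x ^+ b.-1 *+ b) * u = 0 -> u = 0.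
Proof.
rewrite -mulr_natl -scaler_nat -mulrA -scalerAl mul1r => /eqP.
rewrite scaler_eq0 (negPf b_neq0) /= => /eqP.
elim: b.-1 => [|m IH]; first by rewrite expr0 mul1r.
by rewrite exprS -mulrA => /(coord_reg C).
Qed.

(** By [dx_coboundary], b x^(b-1) times the carry is a coboundary, hence a cocycle, and the factor
    can be cancelled. *)
Lemma carry_cocycle u v t :
  u * carry v t - carry (u * v) t + carry u (v * t) - t * carry u v = 0.
Proof.
apply: reg_xb; set e := _ *+ _; transitivity
  (u * (e * carry v t) - e * carry (u * v) t + e * carry u (v * t) - t * (e * carry u
    v)).
  by ring.
rewrite -!dx_coboundary [u * (v * t)]mulrA; ring.
Qed.

Lemma dd_inner1 (L : A -> A) s : dd (inner1_fun L) s =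
  if s is [:: u; v] then u * L v - L (u * v) + v * L u else 0.
Proof.
case: s => [|u [|v [|t s]]] //; rewrite dd_cons /= ?dd1 ?subr0 //.
by rewrite dd_eq0 // !mulr0 !subr0 addr0.
Qed.

Lemma dd_inner2 (B : A -> A -> A) s : dd (inner2_fun B) s =
  if s is [:: u; v; t] then u * B v t - B (u * v) t + B u (v * t) - t * B u v else 0.
Proof.
case: s => [|u [|v [|t s]]] //; first by rewrite dd_cons /= dd1 !mulr0 !subr0 addr0.
rewrite dd_cons [dd _ (v :: _)]dd_cons; case: s => [|q s] /=; first by rewrite dd1;
  ring.
by rewrite dd_eq0 //; ring.
Qed.

(** * The cochains Y, X, T and their relations *)

Definition Y_cochain : cochain A := cochain1 dy_lmap.
Definition X_cochain : cochain A := cochain1 dx_lmap.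
Definition T_cochain : cochain A := cochain2 carry_linr carry_linl.

Lemma dC_cochain1 L Ll s : inner (dC (@cochain1 L Ll)) s =
  if s is [:: u; v] then u * L v - L (u * v) + v * L u else 0.
Proof.
rewrite inner_dC (@dd_eq _ _ _ (inner1_fun L)) ?dd_inner1 // => *.
exact: inner_cochain1.
Qed.

Lemma dC_cochain2 B Bl Br s : inner (dC (@cochain2 B Bl Br)) s =
  if s is [:: u; v; t] then u * B v t - B (u * v) t + B u (v * t) - t * B u v else 0.
Proof.
rewrite inner_dC (@dd_eq _ _ _ (inner2_fun B)) ?dd_inner2 // => *.
exact: inner_cochain2.
Qed.

Lemma dC_Y : dC Y_cochain = 0.
Proof.
apply: cochain_inner_eq => s; rewrite dC_cochain1; case: s => [|u [|v [|t s]]] //.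
by rewrite dyM inner0; ring.
Qed.

Lemma dC_T : dC T_cochain = 0.
Proof.
apply: cochain_inner_eq => s; rewrite dC_cochain2.
by case: s => [|u [|v [|t [|q s]]]] //; rewrite carry_cocycle.
Qed.

Lemma dC_X : dC X_cochain = const (x ^+ b.-1 *+ b) * T_cochain.
Proof.
apply: cochain_inner_eq => s; rewrite dC_cochain1 inner_constM inner_cochain2.
by case: s => [|u [|v [|t s]]]; rewrite /= ?mulr0 // dx_coboundary.
Qed.

Lemma inner_cochain1M L1 L1l L2 L2l s : inner (@cochain1 L1 L1l * @cochain1 L2 L2l) s =
  if s is [:: u; v] then L1 u * L2 v else 0.
Proof.
case/lastP: s => [|s v]; first exact: inner_cochain1Mr_nil.
rewrite inner_cochain1Mr inner_cochain1.
by case: s => [|u [|t [|? ?]]] //=; rewrite mul0r.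
Qed.

Lemma Y_square : (2 <= a)%N -> exists h,
  Y_cochain * Y_cochain = - (const (y ^+ (a - 2) *+ 'C(a, 2)) * T_cochain) + dC h.
Proof.
move=> a2; exists (- cochain1 dyy_lmap); apply: cochain_inner_eq => s.
rewrite innerD dCN !innerN inner_constM inner_cochain2 dC_cochain1 inner_cochain1M.
case: s => [|u [|v [|t s]]]; rewrite /= ?mulr0 ?oppr0 ?addr0 //.
by rewrite dyy_coboundary //; ring.
Qed.

Lemma YT_comm : exists h, T_cochain * Y_cochain = Y_cochain * T_cochain + dC h.
Proof.
have Bl u : lmap (fun v => dy (carry u v)) by apply: lmap_comp dy_lmap (carry_linr u).
have Br v : lmap (fun u => dy (carry u v)) by apply: lmap_comp dy_lmap (carry_linl v).
exists (cochain2 Bl Br); apply: cochain_inner_eq => s; rewrite innerD dC_cochain2.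
have YTE : inner (Y_cochain * T_cochain) s = if s is [:: u; v;
  t] then dy u * carry v t else 0.
  case: s => [|u s]; first by rewrite innerM big_ord1 inner_cochain1 mul0r.
  rewrite inner_cochain1Ml inner_cochain2.
  by case: s => [|v [|t [|? ?]]]; rewrite /= ?mulr0.
have TYE : inner (T_cochain * Y_cochain) s = if s is [:: u; v;
  t] then carry u v * dy t else 0.
  rewrite /T_cochain; case: s {YTE} => [|u [|v s]];
    try by rewrite inner_cochain2M_small.
  rewrite inner_cochain2M.
  by rewrite inner_cochain1; case: s => [|t [|? ?]]; rewrite /= ?mulr0.
rewrite YTE TYE; case: s {YTE TYE} => [|u [|v [|t [|? ?]]]]; rewrite ?addr0 //.
(* Differentiating the cocycle identity: where [dy] hits the outer factors [u] and [t] it gives Y T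
   and T Y, and the other terms form the boundary of [dy] after [carry]. *)
have := congr1 dy (carry_cocycle u v t); rewrite (lmap0 dy_lmap).
have dyN p : dy (- p) = - dy p by rewrite -scaleN1r (lmapZ _ _ dy_lmap) scaleN1r.
rewrite !(lmapD _ _ dy_lmap) !dyN !dyM => dE.
by apply/eqP; rewrite -subr_eq0 -[X in _ == X]oppr0 -dE; apply/eqP; ring.
Qed.

End Classes.

(** * Normal form of cocycles *)

Section NormalForm.
Variables (k : fieldType) (A : comAlgType k) (a b : nat) (x y : A).
Variable lin : (nat -> nat -> A) -> A -> A.
Hypothesis C : coordinates a b x y lin.
Hypothesis a0 : a%:R = 0 :> k.
Implicit Types (f g h : cochain A) (F G H : seq A -> A) (s : seq A) (w : int).

Local Notation Y := (Y_cochain C).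
Local Notation T := (T_cochain C).
Local Notation X := (X_cochain C).
Local Notation dy := (dy x y lin).
Local Notation dx := (dx x y lin).
Local Notation carry := (carry b x y lin).

(* the normalized Hochschild cochains of [A] over k[y] instead of k *)
Definition relative f := normalized (inner f) /\ slot_linear y (inner f).

Lemma relativeP c f g : relative f -> relative g -> relative (c *: f + g).
Proof.
move=> [f1 fy] [g1 gy]; split=> [u v|u t v]; rewrite !innerD !innerZ.
  by rewrite f1 g1 scaler0 addr0.
by rewrite fy gy mulrDr scalerAr.
Qed.

Lemma relative0 : relative 0.
Proof. by split=> [u v|u t v]; rewrite ?inner0 ?mulr0. Qed.

Lemma relativeD f g : relative f -> relative g -> relative (f + g).
Proof. by move=> hf hg; rewrite -[f]scale1r; apply: relativeP. Qed.

Lemma relativeN f : relative f -> relative (- f).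
Proof.
by move=> hf; rewrite -scaleN1r -[_ *: _]addr0; apply: relativeP relative0.
Qed.

Lemma relativeB f g : relative f -> relative g -> relative (f - g).
Proof. by move=> hf /relativeN; apply: relativeD. Qed.

Lemma relative_sum n (F : 'I_n -> cochain A) :
  (forall i, relative (F i)) -> relative (\sum_i F i).
Proof.
move=> hF; elim/big_rec: _ => [|i f _ hf]; [exact: relative0 | exact: relativeD].
Qed.

Lemma relative_dC f : relative f -> relative (dC f).
Proof.
move=> [f1 fy]; split=> [u v|u t v]; rewrite !inner_dC.
  exact: dd_normalized.
exact: dd_slot_linear.
Qed.

Lemma relative_const e : relative (const e).
Proof.
by split=> [[|p u] v|[|p u] t v]; rewrite ?inner_const ?mulr0 //= !inner_const mulr0.
Qed.

Lemma relative_constM e f : relative f -> relative (const e * f).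
Proof.
move=> [f1 fy]; split=> [u v|u t v]; rewrite !inner_constM.
  by rewrite f1 mulr0.
by rewrite fy mulrCA.
Qed.

Lemma carry_y u v : carry (y * u) v = y * carry u v.
Proof.
move: u; apply: (lin_ext C (L := fun u => carry (y * u) v)
  (M := fun u => y * carry u v)).
- exact: lmap_comp (carry_linl C v) (lmap_mul y).
- exact: lmap_comp (lmap_mul y) (carry_linl C v).
move=> i j ib; move: v; apply: (lin_ext C).
- exact: (carry_linr C).
- exact: lmap_comp (lmap_mul y) (carry_linr C _).
move=> i' j' ib'; rewrite mulrCA -exprS !(carry_mon C) //.
by case: ifP; rewrite ?mulr0 // mulrCA -exprS.
Qed.

Lemma carryC u v : carry u v = carry v u.
Proof.
apply: (lin_ext2 C (B1 := carry) (B2 := fun u v => carry v u)).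
- exact: (carry_linr C).
- exact: (carry_linl C).
- exact: (carry_linl C).
- exact: (carry_linr C).
by move=> i j i' j' ib ib'; rewrite !(carry_mon C) // addnC [(j + j')%N]addnC.
Qed.

Lemma carry1 v : carry 1 v = 0.
Proof.
rewrite -[1](mulr1) -[X in X * _](expr0 x) -(expr0 y).
move: v; apply: (lin_ext C (M := fun=> 0)); first exact: (carry_linr C).
  by move=> c p q; rewrite scaler0 addr0.
by move=> i j ib; rewrite (carry_mon C) ?(coord_b C) // add0n leqNgt ib.
Qed.

Lemma inner_TM f u v s : inner (T * f) (u :: v :: s) = carry u v * inner f s.
Proof. exact: inner_cochain2M. Qed.

Lemma inner_TM_small f s : (size s < 2)%N -> inner (T * f) s = 0.
Proof. exact: inner_cochain2M_small. Qed.

Lemma relative_TM f : relative f -> relative (T * f).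
Proof.
move=> [f1 fy]; split=> [u v|u t v].
  case: u => [|p [|q u]]; rewrite ?cat_cons ?cat0s.
  - case: v => [|q v]; first by rewrite inner_TM_small.
    by rewrite inner_TM carry1 mul0r.
  - by rewrite inner_TM carryC carry1 mul0r.
  - by rewrite inner_TM f1 mulr0.
case: u => [|p [|q u]]; rewrite ?cat_cons ?cat0s.
- case: v => [|q v]; first by rewrite !inner_TM_small // mulr0.
  by rewrite !inner_TM carry_y mulrA.
- by rewrite !inner_TM carryC carry_y carryC mulrA.
- by rewrite !inner_TM fy mulrCA.
Qed.

Lemma inner_MY f s u : inner (f * Y) (rcons s u) = inner f s * dy u.
Proof. exact: inner_cochain1Mr. Qed.

(** Putting [y] in the last slot isolates [f1]: a relative cochain vanishes on y = y 1, and [dy y]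
    is 1. *)
Lemma relative_split f0 f1 : relative f0 -> relative f1 -> f0 + f1 * Y = 0 ->
  f0 = 0 /\ f1 = 0.
Proof.
move=> [n0 l0] [n1 l1] E.
have f1E : f1 = 0.
  apply: cochain_inner_eq => s.
  have : inner (f0 + f1 * Y) (rcons s y) = 0 by rewrite E.
  rewrite innerD inner_MY -[y in X in X + _ = _](mulr1 y) -cats1 l0 n0 mulr0 add0r.
  by rewrite (dy_y C a0) mulr1.
by split=> //; move: E; rewrite f1E mul0r addr0.
Qed.

Variable hom : int -> A -> Prop.
Hypothesis W : weights a b x y lin hom.
Local Notation weighted := (weighted hom).

Lemma weighted_const w e : hom w e -> weighted w (inner (const e)).
Proof.
move=> he [|p s] _; rewrite inner_const; last exact: hom0 W _.
by rewrite big_nil add0r.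
Qed.

Lemma weighted_mul w w' f g : weighted w (inner f) -> weighted w' (inner g) ->
  weighted (w + w') (inner (f * g)).
Proof.
move=> hf hg s hs; rewrite innerM; apply: (hom_sum W) => j _.
rewrite -map_take -map_drop.
apply: (hom_eq (homM W (hf (take j s) _) (hg (drop j s) _))) => [p /mem_take/hs //|p
  /mem_drop/hs //|].
by rewrite -[in RHS](cat_take_drop j s) big_cat /=; ring.
Qed.

Lemma weighted_eq w w' F : weighted w F -> w = w' -> weighted w' F.
Proof. by move=> h <-. Qed.

Lemma weighted_Y : weighted (- b%:Z) (inner Y).
Proof.
move=> [|[d p] [|q s]] hs; rewrite inner_cochain1; try exact: hom0 W _.
rewrite /= big_seq1; apply: (hom_lin W); last by apply: (hs (d, p)); rewrite inE.
move=> i [|j] /=; first by rewrite mulr0n; apply: hom0 W _.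
rewrite -scaler_nat; apply: (homZ W).
apply: (hom_eq (homM W (homX W i (homx W)) (homX W j (homy W)))).
by rewrite [b%:Z *+ j.+1]mulrSr; ring.
Qed.

Lemma mulrn_int (z : int) n : z *+ n = z * n%:Z.
Proof. by rewrite -mulr_natr natz. Qed.

Lemma weighted_T : weighted (- (a * b)%N%:Z) (inner T).
Proof.
move=> [|[d p] [|[e q] [|r s]]] hs; rewrite inner_cochain2; try exact: hom0 W _.
have hp : hom d p by apply: (hs (d, p)); rewrite inE eqxx.
have hq : hom e q by apply: (hs (e, q)); rewrite !inE eqxx orbT.
rewrite /= big_cons big_seq1 /= -addrA; apply: (hom_lin W) => // i j.
rewrite addrCA; apply: (hom_lin W) => // i' j'; case: ifP => [bi|_];
  last exact: hom0 W _.
apply: (hom_eq (homM W (homX W _ (homx W)) (homX W _ (homy W)))).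
rewrite !mulrn_int; have -> : (i + i' - b)%N%:Z = i%:Z + i'%:Z - b%:Z by lia.
by rewrite !PoszD PoszM; ring.
Qed.

(* The hypotheses on [dC f] hold both for a cocycle and for a primitive of a
   cocycle of the form f0 + f1 * Y. *)
Lemma decompose w N f :
  bounded N.+1 (inner f) -> weighted w (inner f) -> normalized (inner (dC f)) ->
  (forall u m v, inner (dC f) (u ++ y :: m :: v) = 0) ->
  exists f0 f1 g, [/\ f = f0 + f1 * Y + dC g,
    relative f0, relative f1, bounded N.+1 (inner f0) & bounded N (inner f1)] /\
    (weighted w (inner f0) /\ weighted (w + b%:Z) (inner f1)).
Proof.
move=> fN fw f1 fy; have [g [gN gw fg1]] := normalize W fN fw f1.
pose f' : cochain A := f - dC g; rewrite -/f' in fg1.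
have f'd : dC f' = dC f by rewrite dCB dC_dC subr0.
have f'N : bounded N.+1 (inner f').
  by move=> s sN; rewrite innerB inner_dC fN ?(dd_bounded gN) ?subrr.
have f'w : weighted w (inner f') by apply: (weightedD W fw (weightedN W (weighted_dC
  W gw))).
have f'y u m v : inner (dC f') (u ++ y :: m :: v) = 0 by rewrite f'd fy.
have [h [hN hhw h1 hy hl]] := relativize C W f'N f'w fg1 f'y.
pose f2 : cochain A := f' - dC h; rewrite -/f2 in hy hl.
have f2d : dC f2 = dC f by rewrite dCB dC_dC subr0.
have f2N : bounded N.+1 (inner f2).
  by move=> s sN; rewrite innerB inner_dC f'N ?(dd_bounded hN) ?subrr.
have f2w : weighted w (inner f2) by apply: (weightedD W f'w (weightedN W (weighted_dC
  W hhw))).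
have f21 : normalized (inner f2).
  by move=> u v; rewrite innerB inner_dC fg1 dd_normalized ?subrr.
have fE : f = f2 + dC (g + h) by rewrite dCD [dC g + _]addrC addrA /f2 /f' !subrK.
clearbody f2.
(* [dd_y] at the end of the list keeps its exceptional term, which makes the last slot a derivation
   along [y]. *)
have f2last u t : inner f2 (rcons u (y * t)) = y * inner f2 (rcons u t) +
    t * inner f2 (rcons u y).
  have := fy u t [::]; rewrite -f2d inner_dC dd_y; first last.
  - by move=> *; apply: hl.
  - by move=> *; apply: hy.
  rewrite -[RHS](mulr0 ((-1) ^+ size u)) => /(can_inj (signrMK _)) E.
  by rewrite -!cats1 in E *; apply/esym/subr0_eq; rewrite -E; ring.
(* The coefficient of Y is found by putting [y] in the last slot, as [dy y] is 1. *)
have [f3 f3E] : exists f3 : cochain A, inner f3 = fun s => inner f2 (rcons s y).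
  apply: mk_cochain => [u v c p q|].
    by rewrite !rcons_cat /= (inner_mlin f2).
  by exists N => s sN; apply: f2N; rewrite size_rcons.
have f3w : weighted (w + b%:Z) (inner f3).
  rewrite f3E => s hs; rewrite -[y]/(b%:Z, y).2 -map_rcons.
  apply: (hom_eq (f2w (rcons s (b%:Z, y)) _)) => [p|].
    by rewrite mem_rcons inE => /predU1P[->|/hs //]; exact: homy W.
  by rewrite big_rcons /=; ring.
have f3r : relative f3.
  split=> [u v|u t v]; rewrite f3E !rcons_cat /= ?f21 //.
  case: v => [|p v] /=; exact: hl.
exists (f2 - f3 * Y), f3, (g + h); split; last split => //; last first.
  apply: (weightedD W f2w); apply: (weightedN W).
  by apply: (weighted_eq (weighted_mul f3w weighted_Y)); ring.
split=> //.
- by rewrite subrK.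
- split=> [u v|u t v]; rewrite !innerB.
    rewrite f21 sub0r; case/lastP: v => [|v p].
      by rewrite cats1 inner_MY (dy1 C a0) mulr0 oppr0.
    by rewrite -rcons_cons -rcons_cat inner_MY f3r.1 mul0r oppr0.
  case/lastP: v => [|v p].
    rewrite !cats1 !inner_MY f2last (dyM C a0) (dy_y C a0) f3E; ring.
  rewrite -!rcons_cons -!rcons_cat !inner_MY f3r.2.
  rewrite !rcons_cat /=; case: v => [|q v] /=; rewrite hl; ring.
- move=> s sN; rewrite innerB f2N // sub0r; case/lastP: s sN => [//|s t].
  by rewrite size_rcons => sN; rewrite inner_MY f3E f2N ?mul0r ?oppr0 // size_rcons.
- by move=> s sN; rewrite f3E f2N // size_rcons.
Qed.

(* Solves g(x^(j+1), v) - x g(x^j, v) = F(x, x^j, v) for j + 1 < b. *)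
Definition gauge_x F s := if s is p :: v then
  lin (fun i j => \sum_(l < i) x ^+ (i - l.+1) * y ^+ j * F (x :: x ^+ l :: v)) p
    else 0.

Lemma gauge_x_mlin F : mlin F -> mlin (gauge_x F).
Proof.
move=> Fm [|p u] v c q r; have [e eE] := scale_mul A c;
  first exact: lin_linear C _ _ _ _.
rewrite [X in _ = X + _]eE /=; apply: (lin_comb C) => i j.
rewrite mulr_sumr -big_split; apply: eq_bigr => l _ /=;
  rewrite (Fm [:: x, x ^+ l & u]) eE.
by rewrite mulrDr mulrCA.
Qed.

Lemma gauge_x_normalized F : normalized F -> normalized (gauge_x F).
Proof.
move=> F1 [|p u] v /=; first by apply: (lin_one C); rewrite big_ord0.
apply: (lin_eq0 C) => i j; rewrite big1 // => l _.
by rewrite (F1 [:: x, x ^+ l & u]) mulr0.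
Qed.

Lemma gauge_x_slot_linear F : slot_linear y F -> slot_linear y (gauge_x F).
Proof.
move=> Fy [|p u] t v /=; last first.
  apply: (lin_mulC C) => i j; rewrite mulr_sumr; apply: eq_bigr => l _.
  by rewrite (Fy [:: x, x ^+ l & u]) mulrCA.
set E := fun i j => _; move: t; apply: (lin_ext C (L := fun t => lin E (y * t))
  (M := fun t => y * lin E t)).
- exact: lmap_comp (lin_linear C _) (lmap_mul y).
- exact: lmap_comp (lmap_mul y) (lin_linear C _).
move=> i j ib; rewrite mulrCA -exprS !(lin_mon C) // /E mulr_sumr.
by apply: eq_bigr => l _; rewrite exprS !mulrA [y * _]mulrC.
Qed.

Lemma gauge_x_bounded N F : bounded N.+1 F -> bounded N (gauge_x F).
Proof.
move=> FN [|p v] // sN; apply: (lin_eq0 C) => i j; rewrite big1 // => l _.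
by rewrite FN ?mulr0.
Qed.

Lemma gauge_x_x F j v : (j < b)%N ->
  gauge_x F (x ^+ j :: v) = \sum_(l < j) x ^+ (j - l.+1) * F (x :: x ^+ l :: v).
Proof.
move=> jb; rewrite /gauge_x -[x ^+ j]mulr1 -(expr0 y) (lin_mon C) //.
by apply: eq_bigr => l _; rewrite expr0 mulr1.
Qed.

Lemma weighted_gauge_x w F : weighted w F -> weighted w (gauge_x F).
Proof.
move=> hF [|p s] hs; first exact: hom0 W _.
rewrite /= big_cons -addrA; apply: (hom_lin W); last by apply: hs; rewrite inE eqxx.
move=> i j; apply: (hom_sum W) => l _.
have hs' r : r \in s -> hom r.1 r.2 by move=> rs; apply: hs; rewrite !inE rs !orbT.
have hF' := weighted_at (weighted_cons hF (homx W)) (homX W l (homx W)) hs'.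
apply: (hom_eq (homM W (homM W (homX W (i - l.+1) (homx W)) (homX W j (homy W))) hF')).
rewrite !mulrn_int; have -> : (i - l.+1)%N%:Z =
  i%:Z - l%:Z - 1 by have := ltn_ord l; lia.
by ring.
Qed.

(** On lists starting with x the gauge reduces to F(x, 1, ...) = 0. What is left of the differential
    is x g(x^j, ...) - g(x^(j+1), ...), which telescopes to the last term of the sum. *)
Lemma dd_gauge_x F j s : normalized F -> (j.+1 < b)%N ->
  dd (gauge_x F) (x :: x ^+ j :: s) = - F (x :: x ^+ j :: s).
Proof.
move=> F1 jb; have gx0 r : gauge_x F (x :: r) = 0.
  rewrite -[X in X :: r](expr1 x) gauge_x_x; last by lia.
  by rewrite big_ord1 expr0 (F1 [:: x]) mulr0.
rewrite dd_cons dd_eq0 // gx0 mulr0 addr0 subr0 -exprS !gauge_x_x; try lia.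
rewrite big_ord_recr /= subnn expr0 mul1r mulr_sumr opprD addrA -sumrB.
rewrite big1 ?add0r // => l _.
by rewrite mulrA -exprS subSn ?subrr.
Qed.

(* Once F(x, x^j, ...) = 0 for all j < b - 1, the vanishing of dF(x, x^j, ...)
   expresses F(x^i, x^j, ...) through t = F(x, x^(b-1), ...), which gives T * t. *)
Lemma periodicity w N f :
  bounded N.+1 (inner f) -> weighted w (inner f) -> relative f ->
  (forall j s, (j.+1 < b)%N -> inner (dC f) (x :: x ^+ j :: s) = 0) ->
  exists e t g, [/\ f = const (inner f [::]) + const e * X + T * t + dC g,
    relative t, relative g, bounded N (inner t) & weighted (w + (a * b)%N%:Z) (inner
      t)] /\
    (b = 1%N -> t = 0).
Proof.
move=> fN fw [f1 fy] fx.
have [h hE] : exists h : cochain A, inner h = gauge_x (inner f).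
  apply: mk_cochain; first exact/gauge_x_mlin/inner_mlin.
  by exists N; apply: gauge_x_bounded.
have [f' f'E] : exists f', f' = f + dC h by exists (f + dC h).
have hr : relative h.
  by rewrite /relative hE; split; [apply: gauge_x_normalized | apply:
    gauge_x_slot_linear].
have f'r : relative f' by rewrite f'E; apply: relativeD; [split | apply: relative_dC].
have f'd : dC f' = dC f by rewrite f'E dCD dC_dC addr0.
have f'w : weighted w (inner f').
  by rewrite f'E; apply: (weightedD W fw); apply: (weighted_dC W); rewrite hE;
    apply: weighted_gauge_x.
have f'N : bounded N.+1 (inner f').
  move=> s sN; rewrite f'E innerD inner_dC fN // add0r hE.
  by apply: (dd_bounded _ sN); apply: gauge_x_bounded.
have f'x j s : (j.+1 < b)%N -> inner f' (x :: x ^+ j :: s) = 0.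
  by move=> jb; rewrite f'E innerD inner_dC hE dd_gauge_x // subrr.
have [t tE] : exists t : cochain A, inner t = fun s => inner f' (x :: x ^+ b.-1 :: s).
  apply: mk_cochain; last by exists N => s sN; apply: f'N => /=; lia.
  by move=> u v c p q; rewrite (inner_mlin f' [:: x, x ^+ b.-1 & u]).
have [n1 ny] := f'r.
have rec j p v : (j.+1 < b)%N -> inner f' (x ^+ j.+1 :: p :: v) =
    x * inner f' (x ^+ j :: p :: v) + inner f' (x :: x ^+ j * p :: v).
  move=> jb; have := fx j (p :: v) jb; rewrite -f'd inner_dC dd_cons dd_cons -exprS.
  rewrite (f'x _ _ jb) dd_eq0 => [E|q r]; last exact: f'x.
  by apply/esym/subr0_eq; rewrite -E; ring.
have two p q v : inner f' (p :: q :: v) = carry p q * inner t v.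
  have base i i' : (i < b)%N -> (i' < b)%N ->
      inner f' (x ^+ i :: x ^+ i' :: v) = carry (x ^+ i) (x ^+ i') * inner t v.
    move=> ib ib'; have := carry_mon C 0 0 ib ib'; rewrite !expr0 !mulr1 => ->.
    elim: i ib => [|i IH] ib.
      by rewrite expr0 (n1 [::]) add0n leqNgt ib' mul0r.
    rewrite rec // IH ?(ltnW ib) // -exprD.
    (* One more factor x gives three cases: still no carry; a carry made earlier, where x^(i+i') =
       y^a x^(i+i'-b) and [f'] vanishes on it next to x; or the first carry, whose value is [t]. *)
    case: (ltngtP (i + i').+1 b) => [lt|gt|eq].
    - rewrite f'x // addr0; have -> : (b <= i + i')%N = false by lia.
      by rewrite mul0r mulr0.
    - have bi : (b <= i + i')%N by lia.
      rewrite bi addSn mulrA -exprS subSn // -[X in _ + X](_ : 0 = _) ?addr0 //.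
      rewrite -(subnK bi) exprD (coord_rel C) mulrC.
      have ey m u s : inner f' (x :: y ^+ m * u :: s) = y ^+ m * inner f' (x :: u :: s).
        elim: m => [|m IHm]; first by rewrite !expr0 !mul1r.
        by rewrite !exprS -!mulrA (ny [:: x]) IHm.
      by rewrite ey f'x ?mulr0 //; lia.
    - rewrite addSn eq subnn expr0 mul1r.
      have -> : (b <= i + i')%N = false by lia.
      by rewrite mul0r mulr0 add0r tE -eq.
  have fl r s : lmap (fun u : A => inner f' (r ++ u :: s)).
    by move=> c u u'; rewrite (inner_mlin f').
  have ymul (L : A -> A) : (forall u, L (y * u) = y * L u) ->
      forall m u, L (u * y ^+ m) = y ^+ m * L u.
    move=> Ly; elim=> [|m IH] u; first by rewrite expr0 mulr1 mul1r.
    by rewrite exprS mulrCA Ly IH mulrA.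
  apply: (lin_ext2 C (B1 := fun p q => inner f' (p :: q :: v))
    (B2 := fun p q => carry p q * inner t v)).
  - by move=> r; apply: (fl [:: r]).
  - by move=> r; apply: (fl [::]).
  - by move=> r c u u'; rewrite (carry_linr C) mulrDl scalerAl.
  - by move=> r c u u' /=; rewrite (carry_linl C) mulrDl scalerAl.
  move=> i j i' j' ib ib'.
  rewrite (ymul (fun p => inner f' (p :: _ :: v))); last by move=> u; apply: (ny [::]).
  rewrite (ymul (fun q => inner f' (_ :: q :: v))); last by move=> u;
    apply: (ny [:: _]).
  rewrite base // (ymul (fun p => carry p _)); last by move=> u; apply: carry_y.
  rewrite (ymul (fun q => carry _ q)) ?mulrA //.
  by move=> u; rewrite carryC carry_y carryC.
(* In degree 1 the vanishing of the differential at (x, x^i) forces the Leibniz rule on powers of x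
   below b. *)
have one p : inner f' [:: p] = inner f' [:: x] * dx p.
  move: p; apply: (lin_ext C (L := fun p => inner f' [:: p])
    (M := fun p => inner f' [:: x] * dx p)).
  - by move=> c u u'; apply: (inner_mlin f' [::]).
  - exact: lmap_comp (lmap_mul _) (dx_lmap C).
  move=> i j ib; rewrite (dx_mon C _ ib).
  have -> : inner f' [:: x ^+ i * y ^+ j] = y ^+ j * inner f' [:: x ^+ i].
    elim: j => [|j IH]; first by rewrite expr0 mulr1 mul1r.
    by rewrite exprS mulrCA (ny [::]) IH mulrA.
  suff -> : inner f' [:: x ^+ i] = inner f' [:: x] * (x ^+ i.-1 *+ i).
    by rewrite mulrCA [y ^+ j * _]mulrnAr [y ^+ j * _]mulrC.
  elim: i ib => [|i IH] ib; first by rewrite expr0 (n1 [::]) mulr0n mulr0.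
  have := fx i [::] ib; rewrite -f'd inner_dC dd_cons dd1 subr0 -exprS => E.
  transitivity (x * inner f' [:: x ^+ i] + x ^+ i * inner f' [:: x]).
    by apply/esym/subr0_eq; rewrite -E; ring.
  rewrite IH ?(ltnW ib) // mulrCA [x ^+ i * _]mulrC -mulrDr; congr (_ * _).
  case: i {IH E ib} => [|i]; first by rewrite mulr0n mulr0 add0r.
  by rewrite mulrnAr -exprS [RHS]mulrSr.
exists (inner f' [:: x]), t, (- h); split; last first.
  (* For b = 1 the values of [t] are f'(x, 1, ...), zero by normalization. *)
  move=> b1; apply: cochain_inner_eq => s; rewrite tE b1 /= expr0.
  exact: (n1 [:: x]).
split.
- have -> : inner f [::] = inner f' [::] by rewrite f'E innerD inner_dC addr0.
  have -> : f = f' - dC h by rewrite f'E addrK.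
  rewrite dCN; congr (_ - _); apply: cochain_inner_eq => s.
  rewrite !innerD inner_constM inner_const inner_cochain1.
  case: s => [|p [|q s]].
  - by rewrite inner_TM_small // mulr0 !addr0.
  - by rewrite inner_TM_small //= addr0 add0r one.
  - by rewrite inner_TM /= mulr0 !add0r two.
- split=> [u v|u r v]; rewrite tE; first exact: (n1 [:: _, _ & u]).
  exact: (ny [:: _, _ & u]).
- exact: relativeN.
- by move=> s sN; rewrite tE; apply: f'N => /=; lia.
- rewrite tE => s hs.
  apply: (hom_eq (weighted_at (weighted_cons f'w (homx W)) (homX W b.-1 (homx W)) hs)).
  have bE : b.-1%:Z = b%:Z - 1 by have := coord_b C; lia.
  by rewrite mulrn_int PoszM bE; ring.
Qed.

Hypothesis b_neq0 : b%:R != 0 :> k.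

Lemma dC_constM e f : dC (const e * f) = const e * dC f.
Proof.
rewrite dCM dC_const mul0r add0r; congr (_ * _); apply: cochain_inner_eq => s.
by rewrite inner_twist inner_const; case: s => [|p s]; rewrite /= ?mulr0 // expr0 mul1r.
Qed.

Lemma dC_TM f : dC (T * f) = T * dC f.
Proof. by rewrite dC_cochain2M // dC_T. Qed.

Lemma carry_x j : (j.+1 < b)%N -> carry x (x ^+ j) = 0.
Proof.
move=> jb; have b1 : (1 < b)%N by lia.
have := carry_mon C 0 0 b1 (ltnW jb); rewrite !expr0 expr1 !mulr1 => ->.
by rewrite add1n leqNgt jb.
Qed.

Lemma carry_xb : (1 < b)%N -> carry x (x ^+ b.-1) = 1.
Proof.
move=> b1; have b1b : (b.-1 < b)%N by lia.
have := carry_mon C 0 0 b1 b1b; rewrite !expr0 expr1 !mulr1 => ->.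
have -> : (1 + b.-1)%N = b by lia.
by rewrite leqnn subnn expr0.
Qed.

(** Evaluation at (x, x^(b-1), ...) undoes multiplication by T, because the carry there is 1; this
    needs x to be a basis element. *)
Lemma T_split e f t : (1 < b)%N ->
  T * f = const e * dC X + T * dC t -> f = const (e * (x ^+ b.-1 *+ b)) + dC t.
Proof.
move=> b1 E; apply: cochain_inner_eq => s.
have : inner (T * f) (x :: x ^+ b.-1 :: s) =
  inner (const e * dC X + T * dC t) (x :: x ^+ b.-1 :: s) by rewrite E.
rewrite inner_TM (dC_X C) !innerD !inner_constM inner_TM carry_xb // !mul1r => ->.
rewrite inner_const inner_cochain2 mulrA; congr (_ + _).
by case: s => [|p s]; rewrite /= ?mulr0 // carry_xb // mulr1.
Qed.

Lemma b1_X : b = 1%N -> X = 0.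
Proof.
move=> b1; apply: cochain_inner_eq => s; rewrite inner_cochain1.
case: s => [|p [|? ?]] //=; apply: (lin_ext C (L := dx) (M := fun=> 0)).
- exact: (dx_lmap C).
- by move=> c u v; rewrite scaler0 addr0.
move=> i j ib; rewrite (dx_mon C _ ib); have -> : i = 0%N by lia.
by rewrite mulr0n.
Qed.

Lemma T_const_sum n (c : nat -> A) :
  T * (\sum_(m < n) const (c m) * T ^+ m) = \sum_(m < n) const (c m) * T ^+ m.+1.
Proof.
rewrite mulr_sumr; apply: eq_bigr => m _.
by rewrite mulrA -const_comm -mulrA -exprS.
Qed.

(** Each division by T leaves a relative cocycle with a smaller bound on its arguments and with
    weight raised by a b, so induction on the bound applies. *)
Lemma relative_normal_form w N f :
  bounded N (inner f) -> weighted w (inner f) -> relative f -> dC f = 0 ->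
  exists (c : nat -> A) g, (forall m, hom (w + (a * b)%N%:Z *+ m) (c m)) /\
    f = \sum_(m < N) const (c m) * T ^+ m + dC g.
Proof.
elim: N w f => [|N IH] w f fN fw fr df.
  exists (fun=> 0), 0; split=> [m|]; first exact: hom0 W _.
  by rewrite big_ord0 add0r dC0; apply: cochain_inner_eq => s; apply: fN.
have [|e [t [g [[fE tr gr tN tw] t1]]]] := periodicity fN fw fr.
  by move=> j s _; rewrite df.
have [eX dt] : const e * X = 0 /\ dC t = 0.
  have [b1|b1] := ltnP 1 b; last first.
    have b1' : b = 1%N by have := coord_b C; lia.
    by rewrite b1_X // t1 // mulr0 dC0.
  have /(T_split b1) : T * 0 = const e * dC X + T * dC t.
    rewrite mulr0 -{1}df fE !dCD dC_const dC_dC addr0 add0r dC_TM.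
    by rewrite dC_constM.
  (* A boundary has no component in degree 0, so e b x^(b-1) = 0 and regularity gives e = 0. *)
  move=> E; have : inner (const (e * (x ^+ b.-1 *+ b)) + dC t) [::] = 0 by rewrite -E.
  rewrite innerD inner_dC addr0 inner_const [inner0_fun _ _]/=.
  rewrite mulrC => /(reg_xb C b_neq0) e0.
  by move: E; rewrite e0 mul0r const0 add0r mul0r => /esym.
have [c [g' [cw tE]]] := IH _ _ tN tw tr dt.
exists (fun m => if m is m'.+1 then c m' else inner f [::]), (T * g' + g); split.
  case=> [|m]; first by rewrite mulr0n addr0; apply: weighted_nil fw.
  by apply: (hom_eq (cw m)); rewrite mulrS addrA.
rewrite {1}fE eX addr0 {1}tE mulrDr T_const_sum dCD dC_TM big_ord_recl /=.
by rewrite expr0 mulr1 !addrA.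
Qed.

Lemma normal_form w N f :
  bounded N.+1 (inner f) -> weighted w (inner f) -> dC f = 0 ->
  exists (c c' : nat -> A) g, [/\
    forall m, hom (w + (a * b)%N%:Z *+ m) (c m),
    forall m, hom (w + b%:Z + (a * b)%N%:Z *+ m) (c' m) &
    f = \sum_(m < N.+1) const (c m) * T ^+ m +
        (\sum_(m < N.+1) const (c' m) * T ^+ m) * Y + dC g].
Proof.
move=> fN fw df.
have [||f0 [f1 [g [[fE r0 r1 f0N f1N] [w0 w1]]]]] := decompose fN fw.
- by move=> u v; rewrite df.
- by move=> u m v; rewrite df.
(* Y is a cocycle, so the boundary of f0 + f1 Y is again of this shape and splits. *)
have [df0 df1] : dC f0 = 0 /\ dC f1 = 0.
  apply: relative_split; try exact: relative_dC.
  by rewrite -[RHS]df fE !dCD dC_dC addr0 dCM (dC_Y C a0) mulr0 addr0.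
have [c [g0 [cw f0E]]] := relative_normal_form f0N w0 r0 df0.
have f1N' := boundedW (leqnSn N) f1N.
have [c' [g1 [cw' f1E]]] := relative_normal_form f1N' w1 r1 df1.
exists c, c', (g0 + g1 * Y + g); split=> //.
rewrite fE {1}f0E {1}f1E mulrDl !dCD dCM (dC_Y C a0) mulr0 addr0.
by rewrite -!addrA; congr (_ + _); rewrite addrCA.
Qed.

End NormalForm.

(** * Relations between the coefficients of a normal form *)

Section Uniqueness.
Variables (k : fieldType) (A : comAlgType k) (a b : nat) (x y : A).
Variable lin : (nat -> nat -> A) -> A -> A.
Hypothesis C : coordinates a b x y lin.
Hypothesis a0 : a%:R = 0 :> k.
Hypothesis b_neq0 : b%:R != 0 :> k.
Implicit Types (f g h : cochain A).

Local Notation Y := (Y_cochain C).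
Local Notation T := (T_cochain C).
Local Notation X := (X_cochain C).

Lemma weights_true : weights a b x y lin (fun _ _ => True).
Proof. by split. Qed.

(** [periodicity] applies to the primitive [h], because its boundary vanishes on (x, x^j, ...) for j
    + 1 < b. Dividing the resulting equation by T gives one of the same kind with fewer
    coefficients. *)
Lemma relative_unique M (c : nat -> A) h :
  \sum_(m < M) const (c m) * T ^+ m = dC h -> relative y h ->
  ((0 < M)%N -> c 0%N = 0) /\
  (forall m, (m.+1 < M)%N -> exists e, c m.+1 = x ^+ b.-1 * e).
Proof.
elim: M c h => [//|M IH] c h; rewrite big_ord_recl expr0 mulr1 /=.
rewrite (_ : \sum_(m < M) _ = T * \sum_(m < M) const (c m.+1) * T ^+ m); last first.
  rewrite mulr_sumr; apply: eq_bigr => m _.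
  by rewrite mulrA -const_comm -mulrA -exprS.
pose w : cochain A := \sum_(m < M) const (c m.+1) * T ^+ m; rewrite -/w => E hr.
have c0 : c 0%N = 0.
  have : inner (const (c 0%N) + T * w) [::] = inner (dC h) [::] by rewrite E.
  by rewrite innerD inner_const inner_TM_small // addr0 inner_dC.
split=> //; have [b1|b1] := ltnP 1 b; last first.
  move=> m _; exists (c m.+1); have -> : b = 1%N by have := coord_b C; lia.
  by rewrite expr0 mul1r.
have [N hN] := inner_bounded h; have hN' := boundedW (leqnSn N) hN.
have h_weighted : weighted (fun _ _ => True) 0 (inner h) by [].
have [|e [t [g [[hE tr _ _ _] _]]]] := periodicity C weights_true hN' h_weighted hr.
  by move=> j s jb; rewrite -E innerD inner_const inner_TM (carry_x C) // mul0r addr0.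
have wE : w = const (e * (x ^+ b.-1 *+ b)) + dC t.
  apply: (T_split (C := C) b_neq0 b1); move: E; rewrite c0 const0 add0r => ->.
  by rewrite {1}hE !dCD dC_const dC_dC addr0 add0r (dC_TM C b_neq0) dC_constM.
case: M @w wE E IH => [//|M] w wE E IH.
(* The part e X of [h] enters the lowest remaining coefficient; this is where multiples of x^(b-1)
   arise. *)
pose c' m := if m is m'.+1 then c m'.+2 else c 1%N - e * (x ^+ b.-1 *+ b).
have [] := IH c' t _ tr.
  rewrite -[RHS](addKr (const (e * (x ^+ b.-1 *+ b)))) -wE /w !big_ord_recl /=.
  rewrite !expr0 !mulr1 addrA; congr (_ + _).
  by rewrite constB addrC.
move=> /(_ isT) /subr0_eq c1 cS [|m] mM.
  by exists (e *+ b); rewrite c1 mulrnAr mulrC mulrnAr.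
by have [e' e'E] := cS m mM; exists e'.
Qed.

Lemma normal_form_unique M (c c' : nat -> A) h :
  \sum_(m < M) const (c m) * T ^+ m + (\sum_(m < M) const (c' m) * T ^+ m) * Y = dC h ->
  [/\ (0 < M)%N -> c 0%N = 0 /\ c' 0%N = 0,
    forall m, (m.+1 < M)%N -> exists e, c m.+1 = x ^+ b.-1 * e &
    forall m, (m.+1 < M)%N -> exists e, c' m.+1 = x ^+ b.-1 * e].
Proof.
pose f0 : cochain A := \sum_(m < M) const (c m) * T ^+ m.
pose f1 : cochain A := \sum_(m < M) const (c' m) * T ^+ m; rewrite -/f0 -/f1 => E.
have rel_sum (d : nat -> A) : relative y (\sum_(m < M) const (d m) * T ^+ m).
  apply: relative_sum => m; apply: relative_constM.
  elim: (nat_of_ord m) => [|n IH]; last by rewrite exprS; apply: relative_TM.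
  by rewrite expr0 -const1; apply: relative_const.
have r0 : relative y f0 by apply: rel_sum.
have r1 : relative y f1 by apply: rel_sum.
have [N hN] := inner_bounded h; have hN' := boundedW (leqnSn N) hN.
have h_weighted : weighted (fun _ _ => True) 0 (inner h) by [].
(* [h] need not be relative, but its boundary f0 + f1 Y is normalized and kills [y] outside the last
   slot, which is enough for [decompose]. *)
have [||h0 [h1 [g [[hE rh0 rh1 _ _] _]]]] := decompose C a0 weights_true hN' h_weighted.
- move=> u v; rewrite -E innerD r0.1 add0r; case/lastP: v => [|v p].
    by rewrite cats1 inner_MY (dy1 C a0) mulr0.
  by rewrite -rcons_cons -rcons_cat inner_MY r1.1 mul0r.
- have y0 f u v : relative y f -> inner f (u ++ y :: v) = 0.
    by move=> [f1' fy]; rewrite -[y](mulr1 y) fy f1' mulr0.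
  move=> u m v; rewrite -E innerD y0 // add0r; case/lastP: v => [|v p].
    by rewrite -(cat1s y) catA cats1 inner_MY y0 ?mul0r.
  by rewrite -!rcons_cons -rcons_cat inner_MY y0 // mul0r.
have rB f h' : relative y f -> relative y h' -> relative y (f - dC h').
  by move=> hf hh; apply: relativeB => //; apply: relative_dC.
have [] := relative_split (C := C) a0 (rB _ _ r0 rh0) (rB _ _ r1 rh1).
  rewrite mulrBl addrACA E hE !dCD dC_dC addr0 dCM (dC_Y C a0) mulr0 addr0.
  by rewrite -opprD subrr.
move=> /subr0_eq E0 /subr0_eq E1.
have [c0 cS] := relative_unique E0 rh0; have [c0' cS'] := relative_unique E1 rh1.
by split=> // M0; split; [apply: c0 | apply: c0'].
Qed.

End Uniqueness.

(** * The semigroup algebra *)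

Section Sgalg.
Variables (k : fieldType) (a b : nat).
Hypotheses (a_gt0 : (0 < a)%N) (b_gt0 : (0 < b)%N) (coprime_ab : coprime a b).
Local Notation A := (sgalg k a b).

(* Every exponent n occurring in [A] is a * ix n + b * jx n with ix n < b. *)
Definition ix n := ((n * (egcdn a b).1) %% b)%N.
Definition jx n := ((n - a * ix n) %/ b)%N.

Lemma ix_lt n : (ix n < b)%N.
Proof. by rewrite ltn_mod. Qed.

(** By coprimality [(egcdn a b).1] is an inverse of a modulo b. *)
Lemma ixE i j : (i < b)%N -> ix (a * i + b * j) = i.
Proof.
move=> ib; rewrite /ix; case: (egcdnP b a_gt0) => u v;
  rewrite (eqP coprime_ab) => uv _ /=.
have -> : ((a * i + b * j) * u = (v * i + j * u) * b + i)%N.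
  have -> : ((a * i + b * j) * u = (u * a) * i + b * j * u)%N by lia.
  by rewrite uv; lia.
by rewrite modnMDl modn_small.
Qed.

Lemma jxE i j : (i < b)%N -> jx (a * i + b * j) = j.
Proof. by move=> ib; rewrite /jx ixE // addKn mulKn. Qed.

Fact sX_mem : 'X^a \in @sgalg_pred k a b.
Proof. by apply/asboolP => S. Qed.

Fact sY_mem : 'X^b \in @sgalg_pred k a b.
Proof. by apply/asboolP => S. Qed.

Definition sx : A := SGAlg sX_mem.
Definition sy : A := SGAlg sY_mem.

Lemma sgalg_val_mon i j : val (sx ^+ i * sy ^+ j) = 'X^(a * i + b * j) :> {poly k}.
Proof. by rewrite rmorphM !rmorphXn /= -!exprM -exprD. Qed.

(** Polynomials whose exponents all have the form a i + b j are a subalgebra containing both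
    generators, so they contain the smallest one. *)
Lemma sgalg_exp (u : A) n : (val u)`_n != 0 -> n = (a * ix n + b * jx n)%N.
Proof.
pose S : {pred {poly k}} := fun p => `[< forall n, p`_n != 0 ->
  exists i j, n = (a * i + b * j)%N >].
have : val u \in S.
  move: (sgalg_mem u) => /asboolP; apply; last 2 first.
  - apply/asboolP => m; rewrite coefXn; case: (m =P a) => [-> _|]; last by rewrite eqxx.
    by exists 1%N, 0%N; rewrite muln0 muln1 addn0.
  - apply/asboolP => m; rewrite coefXn; case: (m =P b) => [-> _|]; last by rewrite eqxx.
    by exists 0%N, 1%N; rewrite muln0 muln1.
  split.
  - apply/asboolP => m; rewrite coef1; case: (m =P 0%N) => [-> _|];
      last by rewrite eqxx.
    by exists 0%N, 0%N; rewrite !muln0.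
  - move=> c p q /asboolP pS /asboolP qS; apply/asboolP => m; rewrite coefD coefZ.
    have [/eqP pm|/pS //] := boolP (p`_m == 0).
    by rewrite pm mulr0 add0r; apply: qS.
  - move=> p q /asboolP pS /asboolP qS; apply/asboolP => m; rewrite coefM => pq.
    have [[i [pi qi]]|no] := pselect (exists i : 'I_m.+1, p`_i != 0 /\ q`_(m - i) != 0).
      have [i1 [j1 e1]] := pS _ pi; have [i2 [j2 e2]] := qS _ qi.
      by exists (i1 + i2)%N, (j1 + j2)%N; have := ltn_ord i; lia.
    case/eqP: pq; rewrite big1 // => i _; apply/eqP; rewrite mulf_eq0.
    apply/negPn/negP; rewrite negb_or => /andP pq; apply: no; exists i; exact: pq.
move=> /asboolP uS /uS [i [j ->]].
(* Multiples of b in i are traded for multiples of a in j. *)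
have -> : (a * i + b * j = a * (i %% b) + b * (j + a * (i %/ b)))%N.
  by rewrite {1}(divn_eq i b); lia.
by rewrite ixE ?jxE ?ltn_mod.
Qed.

(** The target is arbitrary because maps into [A], into the presented algebra and into the
    polynomial ring are all built this way. *)
Definition slin (V : lmodType k) (E : nat -> nat -> V) (u : A) : V :=
  \sum_(n < size (val u)) (val u)`_n *: E (ix n) (jx n).

Lemma slin_wide (V : lmodType k) (E : nat -> nat -> V) (u : A) N :
  (size (val u) <= N)%N -> slin E u = \sum_(n < N) (val u)`_n *: E (ix n) (jx n).
Proof.
move=> uN; rewrite /slin (big_ord_widen N (fun n => (val u)`_n *: E (ix n) (jx n))) //.
rewrite big_mkcond; apply: eq_bigr => n _; case: ltnP => // un.
by rewrite nth_default ?scale0r.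
Qed.

Lemma slin_linear (V : lmodType k) (E : nat -> nat -> V) c (u v : A) :
  slin E (c *: u + v) = c *: slin E u + slin E v.
Proof.
pose N := maxn (size (val (c *: u + v))) (maxn (size (val u)) (size (val v))).
rewrite !(@slin_wide _ _ _ N) ?leq_max ?leqnn ?orbT // scaler_sumr -big_split.
by apply: eq_bigr => n _; rewrite linearP /= coefD coefZ scalerDl scalerA.
Qed.

Lemma slin_mon (V : lmodType k) (E : nat -> nat -> V) i j : (i < b)%N ->
  slin E (sx ^+ i * sy ^+ j) = E i j.
Proof.
move=> ib; rewrite /slin sgalg_val_mon size_polyXn big_ord_recr /= coefXn eqxx.
rewrite ixE // jxE // scale1r big1 ?add0r // => n _.
by rewrite coefXn (ltn_eqF (ltn_ord n)) scale0r.
Qed.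

Lemma sgalg_valZ c (u : A) : val (c *: u) = c *: val u :> {poly k}.
Proof. by []. Qed.

Lemma sgalg_expand (u : A) : u = slin (fun i j => sx ^+ i * sy ^+ j) u.
Proof.
apply: val_inj; rewrite -[LHS]coefK poly_def raddf_sum; apply: eq_bigr => n _.
rewrite -[RHS]/(val (_ *: _)) sgalg_valZ sgalg_val_mon.
by have [->|/sgalg_exp <- //] := eqVneq (val u)`_n 0; rewrite !scale0r.
Qed.

Lemma slin_ext (V : lmodType k) (L M : A -> V) :
  (forall c u v, L (c *: u + v) = c *: L u + L v) ->
  (forall c u v, M (c *: u + v) = c *: M u + M v) ->
  (forall i j, (i < b)%N -> L (sx ^+ i * sy ^+ j) = M (sx ^+ i * sy ^+ j)) -> L =1 M.
Proof.
move=> Ll Ml LM u; rewrite [u]sgalg_expand /slin.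
have Z (F : A -> V) : (forall c u v, F (c *: u + v) = c *: F u + F v) -> F 0 = 0.
  by move=> Fl; have := Fl (-1) 0 0; rewrite scaler0 addr0 scaleN1r addNr.
elim/big_rec: _ => [|n v _ IH]; first by rewrite !Z.
by rewrite Ll Ml IH LM // ix_lt.
Qed.

Lemma sgalg_coordinates : coordinates a b sx sy (slin (V := A)).
Proof.
split=> //.
- by move=> E c u v; apply: slin_linear.
- by move=> E i j; apply: slin_mon.
- by move=> L M; apply: slin_ext.
- apply: val_inj; rewrite !rmorphXn /= -!exprM mulnC; congr (_ ^+ _); lia.
- move=> u /(congr1 val); rewrite rmorphM /= => /eqP; rewrite mulf_eq0.
  by rewrite -size_poly_eq0 size_polyXn /= => /eqP u0; apply: val_inj.
Qed.

Lemma sgalg_weights : weights a b sx sy (slin (V := A)) (@sgalg_hom k a b).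
Proof.
split.
- by move=> w i; rewrite coef0 eqxx.
- move=> w c u v hu hv i; rewrite -[sgalg_val _]/(c *: val u + val v) coefD coefZ => h.
  have [/eqP ui|/hu //] := boolP ((val u)`_i == 0).
  by apply: hv; move: h; rewrite ui mulr0 add0r.
- move=> w w' u v hu hv i; rewrite -[sgalg_val _]/(val u * val v) coefM => h.
  have [[j [uj vj]]|no] := pselect (exists j : 'I_i.+1,
      (val u)`_j != 0 /\ (val v)`_(i - j) != 0).
    by rewrite -(hu _ uj) -(hv _ vj); have := ltn_ord j; lia.
  case/eqP: h; rewrite big1 // => j _; apply/eqP; rewrite mulf_eq0.
  apply/negPn/negP; rewrite negb_or => /andP uv; apply: no; exists j; exact: uv.
- by move=> i; rewrite /= coef1; case: i => [|i]; rewrite ?eqxx.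
- by move=> i; rewrite /= coefXn; case: (i =P a) => [->|]; rewrite ?eqxx.
- by move=> i; rewrite /= coefXn; case: (i =P b) => [->|]; rewrite ?eqxx.
move=> E w d u hE hu i; rewrite -[sgalg_val _]/(val _) /slin raddf_sum coef_sum => h.
have [[j hj]|no] := pselect (exists j : 'I_(size (val u)),
   (val u)`_j != 0 /\ (val (E (ix j) (jx j)))`_i != 0).
  rewrite (hE _ _ _ hj.2) -(hu _ hj.1); congr (_ + _).
  by rewrite !mulrn_int -!PoszM -PoszD -(sgalg_exp hj.1).
case/eqP: h; rewrite big1 // => j _; rewrite [LHS](_ : _ =
  (val u)`_j * (val (E (ix j) (jx j)))`_i); last exact: coefZ.
apply/eqP.
rewrite mulf_eq0; apply/negPn/negP; rewrite negb_or => /andP uv; apply: no.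
by exists j; exact: uv.
Qed.

End Sgalg.

(** * Hochschild classes *)

Section QuotientMorphism.
Variables (k : pzRingType) (R : algType k) (I : tsideal R).

Lemma to_alg_quot0 : to_alg_quot I 0 = 0.
Proof. by apply: (addrI (to_alg_quot I 0)); rewrite -pi_alg_quotD !addr0. Qed.

Fact to_alg_quot_zmod : zmod_morphism (to_alg_quot I).
Proof.
move=> p q; rewrite pi_alg_quotD; congr (_ + _).
by apply: (addrI (to_alg_quot I q)); rewrite -pi_alg_quotD !subrr to_alg_quot0.
Qed.

Fact to_alg_quot_monoid : monoid_morphism (to_alg_quot I).
Proof. by split=> // p q; rewrite to_alg_quotM. Qed.

Fact to_alg_quot_scalable : scalable (to_alg_quot I).
Proof. by move=> c p; rewrite to_alg_quotZ. Qed.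

HB.instance Definition _ := GRing.isZmodMorphism.Build R (alg_quot I) (to_alg_quot I)
  to_alg_quot_zmod.
HB.instance Definition _ := GRing.isMonoidMorphism.Build R (alg_quot I) (to_alg_quot I)
  to_alg_quot_monoid.
HB.instance Definition _ := GRing.isScalable.Build k R (alg_quot I) *:%R (to_alg_quot I)
  to_alg_quot_scalable.

Lemma to_alg_quot_eqP p q : to_alg_quot I p = to_alg_quot I q <-> p - q \in I.
Proof. by rewrite Quotient.idealrBE; split=> [/eqP|/eqP]. Qed.

End QuotientMorphism.

Section HochschildClass.
Variables (k : fieldType) (A : comAlgType k).

Fact cocycle_of_dC (f : cochain A) : dC f = 0 -> f \in @cocycle_pred k A.
Proof. by move=> df; apply/eqP; exact: (congr1 (@cochain_fun k A) df). Qed.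

Definition cocycle_of (f : cochain A) (df : dC f = 0) : cocycle A :=
  Cocycle (cocycle_of_dC df).

Lemma HH_class_eqP (z w : cocycle A) : HH_class z = HH_class w <->
  exists h : cochain A, cocycle_cochain z = cocycle_cochain w + dC h.
Proof.
rewrite /HH_class to_alg_quot_eqP; split=> [/asboolP[h zh]|[h zh]].
  exists h; apply/eqP; rewrite addrC -subr_eq; apply/eqP; apply: val_inj.
  exact: zh.
by apply/asboolP; exists h; rewrite [LHS]/= zh addrC addKr.
Qed.

Lemma cocycle_dC (z : cocycle A) : dC z = 0.
Proof. by apply: val_inj; apply: cocycleP. Qed.

End HochschildClass.

(** * Generators and normal form in cohomology *)

Section HHGenerators.
Variables (k : fieldType) (A : comAlgType k) (a b : nat) (x y : A).
Variable lin : (nat -> nat -> A) -> A -> A.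
Hypothesis C : coordinates a b x y lin.
Hypothesis a0 : a%:R = 0 :> k.
Hypothesis b_neq0 : b%:R != 0 :> k.

Local Notation cl := (to_alg_quot (coboundary_ideal A)).

Definition const_cocycle (e : A) : cocycle A := cocycle_of (dC_const e).
Definition Y_cocycle : cocycle A := cocycle_of (dC_Y C a0).
Definition T_cocycle : cocycle A := cocycle_of (dC_T C b_neq0).

Definition hc (e : A) : HH A := HH_class (const_cocycle e).
Definition hY : HH A := HH_class Y_cocycle.
Definition hT : HH A := HH_class T_cocycle.

Lemma cl_const e : cl (const_cocycle e) = hc e. Proof. by []. Qed.

Fact hc_linear : linear hc.
Proof.
move=> c e e'; rewrite /hc /HH_class -linearP; congr (cl _); apply: val_inj.
exact: constP.
Qed.

Fact hc_monoid : monoid_morphism hc.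
Proof.
split=> [|e e'].
  by rewrite /hc -(rmorph1 cl); congr (cl _); apply: val_inj; exact: const1.
by rewrite /hc /HH_class -rmorphM; congr (cl _); apply: val_inj; exact: constM.
Qed.

HB.instance Definition _ := GRing.isLinear.Build k A (HH A) *:%R hc hc_linear.
HB.instance Definition _ := GRing.isMonoidMorphism.Build A (HH A) hc hc_monoid.

Definition nf_cocycle M (c c' : nat -> A) : cocycle A :=
  \sum_(m < M) const_cocycle (c m) * T_cocycle ^+ m +
  (\sum_(m < M) const_cocycle (c' m) * T_cocycle ^+ m) * Y_cocycle.

Lemma cl_nf M c c' : HH_class (nf_cocycle M c c') =
  \sum_(m < M) hc (c m) * hT ^+ m + (\sum_(m < M) hc (c' m) * hT ^+ m) * hY.
Proof.
rewrite /HH_class /nf_cocycle rmorphD rmorphM !rmorph_sum.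
by congr (_ + _ * _); apply: eq_bigr => m _; rewrite rmorphM rmorphXn.
Qed.

Lemma val_nf M c c' : cocycle_cochain (nf_cocycle M c c') =
  \sum_(m < M) const (c m) * T_cochain C ^+ m + (\sum_(m < M) const (c' m) *
    T_cochain C ^+ m) * Y_cochain C.
Proof.
rewrite -[LHS]/(val (nf_cocycle M c c')) /nf_cocycle rmorphD rmorphM !rmorph_sum.
by congr (_ + _ * _); apply: eq_bigr => m _; rewrite rmorphM rmorphXn.
Qed.

Lemma HH_normal_form (z : HH A) : exists M c c', z = HH_class (nf_cocycle M c c').
Proof.
have [{}z ->] := alg_quotP z; have [N zN] := inner_bounded (cocycle_cochain z).
have zw : weighted (fun _ _ => True) 0 (inner (cocycle_cochain z)) by [].
have [c [c' [g [_ _ zE]]]] := normal_form C a0 (@weights_true k A a b x y lin) b_neq0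
  (boundedW (leqnSn N) zN) zw (cocycle_dC z).
exists N.+1, c, c'; apply/HH_class_eqP; exists g.
by rewrite val_nf zE.
Qed.

Lemma HH_class_nf0 M c c' : HH_class (nf_cocycle M c c') = 0 ->
  [/\ (0 < M)%N -> c 0%N = 0 /\ c' 0%N = 0,
    forall m, (m.+1 < M)%N -> exists e, c m.+1 = x ^+ b.-1 * e &
    forall m, (m.+1 < M)%N -> exists e, c' m.+1 = x ^+ b.-1 * e].
Proof.
rewrite -(rmorph0 cl) => /HH_class_eqP[h]; rewrite add0r val_nf => E.
exact: normal_form_unique a0 b_neq0 _ _ _ _ E.
Qed.

Lemma hYT_comm : hT * hY = hY * hT.
Proof.
have [h E] := YT_comm C a0 b_neq0.
rewrite /hT /hY /HH_class -!rmorphM; apply/HH_class_eqP; exists h; exact: E.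
Qed.

Lemma hc_comm e z : hc e * z = z * hc e.
Proof.
have [{}z ->] := alg_quotP z; rewrite -cl_const -!rmorphM; congr (cl _).
by apply: val_inj; exact: const_comm.
Qed.

(** Constants are central, so the normal form reduces this to the commutation of [hT] with [hY]. *)
Lemma HH_comm (z : HH A) : GRing.comm z hT /\ GRing.comm z hY.
Proof.
have [M [c [c' ->]]] := HH_normal_form z; rewrite cl_nf.
have hcc e (u : HH A) : GRing.comm (hc e) u by exact: hc_comm.
have TY : GRing.comm hT hY by exact: hYT_comm.
have sumc (d : nat -> A) u : GRing.comm hT u ->
    GRing.comm (\sum_(m < M) hc (d m) * hT ^+ m) u.
  move=> Tu; apply: commr_sym; apply: commr_sum => m _.
  apply: commrM; first exact/commr_sym/hcc.
  by apply: commrX; apply: commr_sym.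
split; apply: commr_sym; apply: commrD; try (apply: commrM);
  by [apply/commr_sym/sumc | exact: commr_refl | exact: commr_sym].
Qed.

Lemma hc_xb_T : hc (x ^+ b.-1) * hT = 0.
Proof.
rewrite /hc /hT /HH_class -rmorphM -(rmorph0 cl); apply/HH_class_eqP.
exists ((b%:R)^-1 *: X_cochain C); rewrite add0r -[X in dC X]addr0 dCP dC0 addr0
  (dC_X C).
rewrite scalerAl -[LHS]/(const _ * T_cochain C); congr (_ * _).
rewrite -[_ *: _]addr0 -const0 -constP addr0; congr const.
by rewrite -scaler_nat scalerA mulVf // scale1r.
Qed.

Lemma hY_square : (2 <= a)%N -> hY ^+ 2 = hc (- (y ^+ (a - 2) *+ 'C(a, 2))) * hT.
Proof.
move=> a2; have [h E] := Y_square C a0 a2.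
rewrite expr2 /hc /hY /hT /HH_class -!rmorphM; apply/HH_class_eqP; exists h.
rewrite -[LHS]/(Y_cochain C * Y_cochain C) E -mulNr; congr (_ * _ + _).
exact/esym/constN.
Qed.

End HHGenerators.

(** * Degrees and weights *)

Section Bigrading.
Variables (k : fieldType) (A : comAlgType k) (a b : nat) (x y : A).
Variable lin : (nat -> nat -> A) -> A -> A.
Variable hom : int -> A -> Prop.
Hypothesis C : coordinates a b x y lin.
Hypothesis W : weights a b x y lin hom.
Implicit Types (f g h : cochain A) (F G : seq A -> A) (w : int).

Lemma has_weight_inner w f : has_weight hom w f -> weighted hom w (inner f).
Proof.
move=> hf s hs; rewrite /inner -[1]/(0 : int, 1 : A).2 -map_rcons.
apply: (hom_eq (hf ((0, 1) :: rcons s (0, 1)) _)).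
  by move=> p; rewrite inE mem_rcons inE => /predU1P[->|/predU1P[->|/hs //]];
    exact: hom1 W.
by rewrite big_cons big_rcons /=; ring.
Qed.

Lemma inner_has_weight w f : weighted hom w (inner f) -> has_weight hom w f.
Proof.
move=> hf s hs; have [s2|] := ltnP (size s) 2.
  by rewrite (cochain_small (cochainP f)) ?size_map //; exact: hom0 W _.
case: s hs => [//|p s]; case/lastP: s => [//|s q] hs _ /=.
rewrite map_rcons innerE big_cons big_rcons.
have hs' r : r \in s -> hom r.1 r.2.
  by move=> rs; apply: hs; rewrite inE mem_rcons inE rs !orbT.
have hp : hom p.1 p.2 by apply: hs; rewrite inE eqxx.
have hq : hom q.1 q.2 by apply: hs; rewrite inE mem_rcons inE eqxx orbT.
by apply: (hom_eq (homM W (homM W hp (hf s hs')) hq)); rewrite /=; ring.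
Qed.

Definition pure_degree i f := forall s, size s != i -> inner f s = 0.

Lemma has_degree_inner i f : has_degree i f <-> pure_degree i f.
Proof.
split=> fi s si; first by apply: fi; rewrite /= size_rcons !eqSS.
have [s2|] := ltnP (size s) 2; first by rewrite (cochain_small (cochainP f)).
case/seq_outer => p [u [q sE]]; rewrite sE innerE fi ?mulr0 ?mul0r //.
by move: si; rewrite sE /= size_rcons !eqSS.
Qed.

Definition bihom i w f := pure_degree i f /\ weighted hom w (inner f).

Lemma bihomP i w c f g : bihom i w f -> bihom i w g -> bihom i w (c *: f + g).
Proof.
move=> [fi fw] [gi gw]; split=> s si; rewrite innerD innerZ.
  by rewrite fi // gi // scaler0 addr0.
by apply: (homP W); [apply: fw | apply: gw].
Qed.

Lemma bihom0 i w : bihom i w 0.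
Proof. by split=> // s _; exact: hom0 W _. Qed.

Lemma bihom_sum i w (I : Type) (r : seq I) (P : pred I) (F : I -> cochain A) :
  (forall j, P j -> bihom i w (F j)) -> bihom i w (\sum_(j <- r | P j) F j).
Proof.
move=> hF; elim/big_rec: _ => [|j f Pj hf]; first exact: bihom0.
by rewrite -[F j]scale1r; apply: bihomP => //; apply: hF.
Qed.

Lemma bihomZ i w c f : bihom i w f -> bihom i w (c *: f).
Proof. by move=> hf; rewrite -[_ *: _]addr0; apply: bihomP => //; apply: bihom0. Qed.

Lemma bihomM i j w w' f g : bihom i w f -> bihom j w' g ->
  bihom (i + j)%N (w + w') (f * g).
Proof.
move=> [fi fw] [gj gw]; split; last exact: (weighted_mul W fw gw).
move=> s sij; rewrite innerM big1 // => m _.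
have [mi|mi] := eqVneq (nat_of_ord m) i; last first.
  by rewrite fi ?mul0r // size_takel // -ltnS.
by rewrite gj ?mulr0 // size_drop mi; have := ltn_ord m; lia.
Qed.

Lemma bihom_const w e : hom w e -> bihom 0 w (const e).
Proof.
move=> he; split; last exact: (weighted_const W).
by move=> [|p s] //= _; rewrite inner_const.
Qed.

Lemma bihom1 : bihom 0 0 1.
Proof. by rewrite -const1; apply: bihom_const; exact: hom1 W. Qed.

Lemma bihomX i w f m : bihom i w f -> bihom (i * m)%N (w *+ m) (f ^+ m).
Proof.
move=> hf; elim: m => [|m IH]; first by rewrite muln0 mulr0n expr0; exact: bihom1.
by rewrite mulnS mulrS exprS; apply: bihomM.
Qed.

Lemma bihom_Y : bihom 1 (- b%:Z) (Y_cochain C).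
Proof.
split; last exact: (weighted_Y C W).
by move=> [|p [|q s]] // _; rewrite inner_cochain1.
Qed.

Lemma bihom_T : bihom 2 (- (a * b)%N%:Z) (T_cochain C).
Proof.
split; last exact: (weighted_T C W).
by move=> [|p [|q [|r s]]] // _; rewrite inner_cochain2.
Qed.

Lemma dd_local F G s : (forall r, size r = (size s).-1 -> F r = G r) -> dd F s = dd G s.
Proof.
elim: s F G => [|p [|q s] IH] F G FG //; rewrite !dd_cons !FG //.
by congr (_ - _); apply: IH => r rs; apply: FG; rewrite /= rs.
Qed.

(** The primitive [g] may have components in other degrees. Its part on lists of size i - 1
    suffices, because [dd] only sees lists one shorter; for i = 0 both sides vanish. *)
Lemma pure_coboundary i f g : pure_degree i f ->
  (forall s, size s = i -> inner f s = inner (dC g) s) -> exists h, f = dC h.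
Proof.
move=> fi fg; case: i fi fg => [|i] fi fg.
  exists 0; rewrite dC0; apply: cochain_inner_eq => -[|p s]; last exact: fi.
  by rewrite fg // inner_dC.
pose G s := if size s == i then inner g s else 0.
have [h hE] : exists h : cochain A, inner h = G.
  apply: mk_cochain => [u v c p q|].
    rewrite /G !size_cat /=; case: ifP => _; first exact: (inner_mlin g).
    by rewrite scaler0 addr0.
  by exists i.+1 => s si; rewrite /G gtn_eqF.
exists h; apply: cochain_inner_eq => s; rewrite inner_dC hE.
have [si|si] := eqVneq (size s) i.+1.
  rewrite fg // inner_dC; apply: dd_local => r; rewrite si /= => ri.
  by rewrite /G ri eqxx.
rewrite fi //; case: s si => [//|p s] /=; rewrite eqSS => si.
rewrite (@dd_local _ (fun=> 0)) ?dd_eq0 // => r /= rs.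
by rewrite /G rs (negPf si).
Qed.

Hypothesis a0 : a%:R = 0 :> k.
Hypothesis b_neq0 : b%:R != 0 :> k.

Lemma inner_sum (I : Type) (r : seq I) (F : I -> cochain A) s :
  inner (\sum_(j <- r) F j) s = \sum_(j <- r) inner (F j) s.
Proof. by apply: (big_morph (fun f : cochain A => inner f s)). Qed.

(** [normal_form] controls weights but may produce terms of other degrees. Dropping them changes
    nothing in degree i, and [pure_coboundary] turns the remaining error into a boundary. *)
Lemma bihom_normal_form i w f : bihom i w f -> dC f = 0 ->
  exists N (d d' : nat -> A) g, [/\
    forall m, d m = 0 \/ (2 * m = i)%N /\ hom (w + (a * b)%N%:Z *+ m) (d m),
    forall m, d' m = 0 \/ (2 * m).+1 = i /\ hom (w + b%:Z + (a * b)%N%:Z *+ m) (d' m) &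
    f = \sum_(m < N) const (d m) * T_cochain C ^+ m +
        (\sum_(m < N) const (d' m) * T_cochain C ^+ m) * Y_cochain C + dC g].
Proof.
move=> [fi fw] df; have [N fN] := inner_bounded f.
have [c [c' [g [cw cw' fE]]]] := normal_form C a0 W b_neq0 (boundedW (leqnSn N) fN)
  fw df.
pose d m := if (2 * m)%N == i then c m else 0.
pose d' m := if (2 * m).+1 == i then c' m else 0.
have Tm m := bihomX m bihom_T.
have TmY m := bihomM (Tm m) bihom_Y.
(* As T^m and T^m Y are homogeneous, setting a coefficient to 0 or not amounts to restricting its
   term to degree i. *)
have part (e : A) j v t : bihom j v t ->
    inner (const (if j == i then e else 0) * t) =
    fun s => if size s == i then inner (const e * t) s else 0.
  move=> [tj _]; apply/funext => s; rewrite !inner_constM.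
  case: (eqVneq (size s) i) => [<-|si]; case: (eqVneq j) => [ji|ji]; rewrite ?mul0r //.
  - by rewrite tj ?mulr0 // eq_sym.
  - by rewrite tj ?mulr0 // ji.
have TE m : inner (const (d m) * T_cochain C ^+ m) =
    fun s => if size s == i then inner (const (c m) * T_cochain C ^+ m) s else 0.
  exact: part (Tm m).
have TYE m : inner (const (d' m) * T_cochain C ^+ m * Y_cochain C) =
    fun s => if size s == i then inner (const (c' m) * T_cochain C ^+ m * Y_cochain
      C) s else 0.
  by rewrite /d' -!mulrA -addn1; apply: part (TmY m).
set F := \sum_(m < N.+1) const (d m) * T_cochain C ^+ m +
  (\sum_(m < N.+1) const (d' m) * T_cochain C ^+ m) * Y_cochain C.
have FE s : inner F s = if size s == i then inner (f - dC g) s else 0.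
  rewrite fE addrK /F !mulr_suml !innerD !inner_sum; case: ifP => si.
    by congr (_ + _); apply: eq_bigr => m _; rewrite ?TE ?TYE si.
  by rewrite !big1 ?addr0 // => m _; rewrite ?TE ?TYE si.
have [h hE] : exists h, f - F = dC h.
  apply: (@pure_coboundary i _ g) => s si; rewrite innerB FE.
    by rewrite (negPf si) subr0 fi.
  by rewrite si eqxx innerB opprB addrCA subrr addr0.
exists N.+1, d, d', h; split=> [m|m|].
- by rewrite /d; case: eqP => [im|_]; [right | left].
- by rewrite /d'; case: eqP => [im|_]; [right | left].
- by rewrite -hE addrC subrK.
Qed.

End Bigrading.

(** * The presentation *)

Section MonomialBigrading.
Variables (k : fieldType) (a b : nat).
Local Notation R := {mpoly k[4]}.

Definition mbihom (i : nat) (w : int) (p : R) :=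
  {in msupp p, forall m, mon_deg m = i /\ mon_wt a b m = w}.

Lemma mbihomE i w p : mbihom i w p <->
  (forall m, p@_m != 0 -> mon_deg m = i /\ mon_wt a b m = w).
Proof. by split=> h m; move: (h m); rewrite mcoeff_msupp. Qed.

Lemma mbihomP i w c (p q : R) : mbihom i w p -> mbihom i w q -> mbihom i w (c *: p + q).
Proof.
move=> /mbihomE hp /mbihomE hq; apply/mbihomE => m; rewrite mcoeffD mcoeffZ => h.
have [pm|/hp //] := eqVneq (p@_m) 0.
by apply: hq; move: h; rewrite pm mulr0 add0r.
Qed.

Lemma mbihom0 i w : mbihom i w 0.
Proof. by move=> m; rewrite msupp0. Qed.

Lemma mbihom_sum i w (I : Type) (r : seq I) (Q : pred I) (F : I -> R) :
  (forall j, Q j -> mbihom i w (F j)) -> mbihom i w (\sum_(j <- r | Q j) F j).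
Proof.
move=> hF; elim/big_rec: _ => [|j p Qj hp]; first exact: mbihom0.
by rewrite -[F j]scale1r; apply: mbihomP => //; apply: hF.
Qed.

Lemma mbihomM i j v w (p q : R) :
  mbihom i v p -> mbihom j w q -> mbihom (i + j) (v + w) (p * q).
Proof.
move=> hp hq m /msuppM_le /allpairsP[[m1 m2] /= [/hp[<- <-] /hq[<- <-] ->]].
rewrite /mon_deg /mon_wt !mnmDE !mulrnDr; split; first by lia.
by ring.
Qed.

Lemma mbihomU l : mbihom (mon_deg U_(l)) (mon_wt a b U_(l)) 'X_l.
Proof. by move=> m; rewrite msuppX inE => /eqP ->. Qed.

Lemma mbihom1 : mbihom 0 0 1.
Proof.
move=> m; rewrite msupp1 inE => /eqP ->.
by rewrite /mon_deg /mon_wt !mnm0E !mulr0n.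
Qed.

Lemma mbihomX i w (p : R) m : mbihom i w p -> mbihom (i * m) (w *+ m) (p ^+ m).
Proof.
move=> hp; elim: m => [|m IH]; first by rewrite muln0 mulr0n expr0; exact: mbihom1.
by rewrite mulnS mulrS exprS; apply: mbihomM.
Qed.

Lemma mbihom_eq i j v w (p : R) : mbihom i v p -> i = j -> v = w -> mbihom j w p.
Proof. by move=> h <- <-. Qed.

Lemma mbihom_X1 : mbihom 0 a%:Z 'X_iX1.
Proof.
apply: (mbihom_eq (@mbihomU iX1)); rewrite /mon_deg /mon_wt !mnm1E //=.
by rewrite mulr1n !mulr0n; ring.
Qed.

Lemma mbihom_X2 : mbihom 0 b%:Z 'X_iX2.
Proof.
apply: (mbihom_eq (@mbihomU iX2)); rewrite /mon_deg /mon_wt !mnm1E //=.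
by rewrite mulr1n !mulr0n; ring.
Qed.

Lemma mbihom_Y : mbihom 1 (- b%:Z) 'X_iY.
Proof.
apply: (mbihom_eq (@mbihomU iY)); rewrite /mon_deg /mon_wt !mnm1E //=.
by rewrite mulr1n !mulr0n; ring.
Qed.

Lemma mbihom_T : mbihom 2 (- (a * b)%N%:Z) 'X_iT.
Proof.
apply: (mbihom_eq (@mbihomU iT)); rewrite /mon_deg /mon_wt !mnm1E //=.
by rewrite mulr1n !mulr0n; ring.
Qed.

End MonomialBigrading.

(** * The isomorphism with the presented algebra *)

Section Presented.
Variables (k : fieldType) (n a b : nat).
Hypotheses (char_k : n \in [pchar k]) (a_gt0 : (0 < a)%N) (b_gt0 : (0 < b)%N).
Hypotheses (coprime_ab : coprime a b) (n_dvd_a : (n %| a)%N).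
Local Notation A := (sgalg k a b).
Local Notation P := (presented k a b).
Local Notation R := {mpoly k[4]}.
Local Notation pi := (to_alg_quot (relations_ideal k a b)).
Local Notation C := (sgalg_coordinates k a_gt0 b_gt0 coprime_ab).
Local Notation W := (sgalg_weights k a_gt0 b_gt0 coprime_ab).

Lemma a_eq0 : a%:R = 0 :> k.
Proof. by apply/eqP; rewrite -(dvdn_pcharf char_k). Qed.

Lemma b_neq0 : b%:R != 0 :> k.
Proof.
rewrite -(dvdn_pcharf char_k); apply/negP => n_dvd_b.
have := pcharf_prime char_k; have : (n %| gcdn a b)%N by rewrite dvdn_gcd n_dvd_a.
by rewrite (eqP coprime_ab) dvdn1 => /eqP ->.
Qed.

Lemma a_ge2 : (2 <= a)%N.
Proof. by apply: leq_trans (dvdn_leq a_gt0 n_dvd_a);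
  apply: prime_gt1 (pcharf_prime char_k). Qed.

(** In characteristic 2, a = 2m and the binomial is m (a-1) with a-1 odd, so its parity is that of
    m. Otherwise 2 is invertible, and twice the binomial is a (a-1) = 0 in k. *)
Lemma bin2_char (u : A) : - (u *+ 'C(a, 2)) =
  if (2 \in [pchar k]) && ~~ (4 %| a)%N then u else 0.
Proof.
rewrite -scaler_nat bin2; case: (boolP (2 \in [pchar k])) => c2 /=.
  have n2 : n = 2 by have := pcharf_eq char_k 2; rewrite c2 inE => /esym/eqP.
  have [m ma] : exists m, a = m.*2.
    by exists a./2; move: n_dvd_a; rewrite n2 dvdn2 => /even_halfK.
  have -> : (a * a.-1)./2 = (m * a.-1)%N by rewrite ma -doubleMl doubleK.
  have -> : (4 %| a)%N = ~~ odd m.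
    by rewrite ma -muln2 (@dvdn_pmul2r 2 2 m) // dvdn2.
  have -> : (m * a.-1)%:R = (odd m)%:R :> k.
    rewrite -[LHS](GRing.natr_mod_pchar c2) modn2 oddM; congr (_%:R).
    have -> : odd a.-1 by rewrite ma; case: m ma => [ma|m _]; [move: a_gt0;
      rewrite ma | rewrite doubleS /= odd_double].
    by rewrite andbT.
  case: (odd m); rewrite /= ?scale0r ?oppr0 // scale1r.
  by rewrite -scaleN1r (oppr_pchar2 c2) scale1r.
suff -> : (a * a.-1)./2%:R = 0 :> k by rewrite scale0r oppr0.
have : ((a * a.-1)./2.*2)%:R = 0 :> k.
  rewrite even_halfK ?natrM ?a_eq0 ?mul0r // oddM.
  by case: (a) => //= m; rewrite andNb.
rewrite -muln2 natrM => /eqP; rewrite mulf_eq0 => /orP[/eqP //|two0].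
by case/negP: c2; rewrite inE /= two0.
Qed.

(** The coefficient in Y^2 = eps T, so that both cases of the presentation are treated at once. *)
Definition eps : A :=
  if (2 \in [pchar k]) && ~~ (4 %| a)%N then sy k a b ^+ (a - 2) else 0.

Local Notation hT := (hT C b_neq0).
Local Notation hY := (hY C a_eq0).

Lemma hY_eps : hY ^+ 2 = hc eps * hT.
Proof. by rewrite (hY_square C a_eq0 b_neq0 a_ge2) bin2_char. Qed.

Definition pX1 : P := pi 'X_iX1.
Definition pX2 : P := pi 'X_iX2.
Definition pY : P := pi 'X_iY.
Definition pT : P := pi 'X_iT.

Lemma presentedC (p q : P) : p * q = q * p.
Proof.
by have [{}p ->] := alg_quotP p; have [{}q ->] := alg_quotP q; rewrite -!rmorphM mulrC.
Qed.

Lemma presentedACA (p q r s : P) : p * q * (r * s) = p * r * (q * s).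
Proof. by rewrite -!mulrA; congr (_ * _); rewrite !mulrA; congr (_ * _);
  apply: presentedC. Qed.

Lemma presented_reorder (p q r s t : P) : p * (q * (r * s)) * t = p * r * (s * t) * q.
Proof.
rewrite [q * _]presentedC -[LHS]mulrA -[(r * s) * q * t]mulrA [q * t]presentedC.
by rewrite !mulrA.
Qed.

Lemma pi_relation i : (i < 3)%N -> pi (relations k a b)`_i = 0.
Proof.
move=> i3; rewrite -(rmorph0 pi); apply/to_alg_quot_eqP; rewrite subr0.
apply/asboolP; exists (fun j => (j == i)%:R).
rewrite (bigD1 (Ordinal i3)) //= eqxx mul1r big1 ?addr0 // => j ji.
by rewrite (_ : (nat_of_ord j == i) = false) ?mul0r //; apply: negPf.
Qed.

Lemma pX1b : pX1 ^+ b = pX2 ^+ a.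
Proof.
apply/eqP; rewrite -subr_eq0 -!rmorphXn -rmorphB; apply/eqP.
exact: (@pi_relation 0).
Qed.

Lemma pX1T : pX1 ^+ b.-1 * pT = 0.
Proof. rewrite -rmorphXn -rmorphM; exact: (@pi_relation 1). Qed.

(** The counterpart of [hc] on the presented side. It is multiplicative thanks to the relation
    [pX1b]. *)
Definition lam : A -> P := slin (fun i j => pX1 ^+ i * pX2 ^+ j).

Fact lam_linear : linear lam.
Proof. by move=> c u v; apply: slin_linear. Qed.

HB.instance Definition _ := GRing.isLinear.Build k A P *:%R lam lam_linear.

Local Notation sx := (sx k a b).
Local Notation sy := (sy k a b).

Lemma lam_mon i j : lam (sx ^+ i * sy ^+ j) = pX1 ^+ i * pX2 ^+ j.
Proof.
elim/ltn_ind: i j => i IH j; have [ib|bi] := ltnP i b; first exact: slin_mon.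
rewrite -(subnK bi) !exprD pX1b (coord_rel C) -!mulrA -!exprD IH //.
by lia.
Qed.

Lemma lamM u v : lam (u * v) = lam u * lam v.
Proof.
move: u; apply: (slin_ext a_gt0 b_gt0 coprime_ab) => [c p q|c p q|i j _].
- by rewrite mulrDl -scalerAl linearP.
- by rewrite linearP mulrDl scalerAl.
move: v; apply: (slin_ext a_gt0 b_gt0 coprime_ab) => [c p q|c p q|i' j' _].
- by rewrite mulrDr -scalerAr linearP.
- by rewrite linearP mulrDr scalerAr.
by rewrite mulrACA -!exprD !lam_mon presentedACA -!exprD.
Qed.

Lemma lam1 : lam 1 = 1.
Proof. by have := lam_mon 0 0; rewrite !expr0 !mulr1. Qed.

HB.instance Definition _ := GRing.isMonoidMorphism.Build A P lam (conj lam1 lamM).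

Lemma lam_sx : lam sx = pX1.
Proof. by have := lam_mon 1 0; rewrite !expr0 !expr1 !mulr1. Qed.

Lemma lam_sy : lam sy = pX2.
Proof. by have := lam_mon 0 1; rewrite !expr0 !expr1 !mul1r. Qed.

Lemma pY_eps : pY ^+ 2 = lam eps * pT.
Proof.
have := @pi_relation 2 isT; rewrite /relations [nth _ _ _]/= /eps; case: ifP => _.
  rewrite rmorphB rmorphXn rmorphM rmorphXn => /subr0_eq YT.
  by rewrite rmorphXn /= lam_sy; exact: YT.
by rewrite rmorphXn raddf0 mul0r.
Qed.

(** In general only linear; it provides homogeneous polynomials representing homogeneous elements of
    [A]. *)
Definition lift : A -> R := slin (fun i j => 'X_iX1 ^+ i * 'X_iX2 ^+ j).

Lemma pi_lift u : pi (lift u) = lam u.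
Proof.
rewrite /lift /lam /slin raddf_sum; apply: eq_bigr => m _ /=.
by rewrite to_alg_quotZ rmorphM !rmorphXn.
Qed.

Lemma mbihom_lift w u : sgalg_hom w u -> mbihom a b 0 w (lift u).
Proof.
move=> hu; apply: mbihom_sum => m _; have [u0|um] := eqVneq ((val u)`_m) 0.
  by rewrite u0 scale0r; apply: mbihom0.
rewrite -[_ *: _]addr0; apply: mbihomP; last exact: mbihom0.
have h1 := @mbihomX _ _ _ _ _ _ (ix a b m) (@mbihom_X1 k a b).
have h2 := @mbihomX _ _ _ _ _ _ (jx a b m) (@mbihom_X2 k a b).
apply: (mbihom_eq (mbihomM h1 h2)) => //.
rewrite -(hu _ um) [in RHS](sgalg_exp a_gt0 b_gt0 coprime_ab um).
by rewrite PoszD !PoszM !mulrn_int.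
Qed.

Definition nf_sum (M : nat) (c : nat -> A) : P := \sum_(m < M) lam (c m) * pT ^+ m.

Lemma nf_sum_widen M N c : (M <= N)%N -> (forall m, (M <= m)%N -> c m = 0) ->
  nf_sum M c = nf_sum N c.
Proof.
move=> MN c0; rewrite /nf_sum (big_ord_widen N (fun m => lam (c m) * pT ^+ m)) //.
rewrite big_mkcond; apply: eq_bigr => m _; case: ltnP => // Mm.
by rewrite c0 // raddf0 mul0r.
Qed.

Lemma nf_sumP M s c d : nf_sum M (fun m => s *: c m + d m) =
  s *: nf_sum M c + nf_sum M d.
Proof.
rewrite /nf_sum scaler_sumr -big_split; apply: eq_bigr => m _ /=.
by rewrite linearP mulrDl scalerAl.
Qed.

Lemma nf_sum1 M e : nf_sum M.+1 (fun m => if m == M then e else 0) = lam e * pT ^+ M.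
Proof.
rewrite /nf_sum big_ord_recr /= eqxx big1 ?add0r // => m _.
by rewrite (ltn_eqF (ltn_ord m)) raddf0 mul0r.
Qed.

Lemma nf_sum0 M : nf_sum M (fun=> 0) = 0.
Proof. by apply: big1 => m _; rewrite raddf0 mul0r. Qed.

Lemma prod_ord4 (S : pzSemiRingType) (F : 'I_4 -> S) :
  \prod_(i < 4) F i = F iX1 * F iX2 * F iY * F iT.
Proof.
rewrite !big_ord_recl big_ord0 mulr1 !mulrA.
by congr (F _ * F _ * F _ * F _); apply: val_inj.
Qed.

Lemma pi_mon (m : 'X_{1..4}) :
  pi 'X_[m] = pX1 ^+ m iX1 * pX2 ^+ m iX2 * pY ^+ m iY * pT ^+ m iT.
Proof.
by rewrite mpolyXE_id prod_ord4 !rmorphM !rmorphXn.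
Qed.

(** Since Y^2 = eps T, even powers of Y turn into powers of T, and a monomial contributes to a
    single coefficient, with or without Y. *)
Lemma presented_normal_form (p : P) : exists M c c', p = nf_sum M c + nf_sum M c' * pY.
Proof.
(* Coefficients vanishing from M on allow two sums to be brought to the same length. *)
suff [M [c [c' [_ pE]]]] : exists M c c',
    (forall m, (M <= m)%N -> c m = 0 /\ c' m = 0) /\ p = nf_sum M c + nf_sum M c' * pY.
  by exists M, c, c'.
have [{}p ->] := alg_quotP p; rewrite [p]mpolyE raddf_sum /=.
elim/big_rec: _ => [|m q _ [N [d [d' [dN ->]]]]].
  by exists 0%N, (fun=> 0), (fun=> 0); split=> //; rewrite !nf_sum0 mul0r addr0.
have [M [c [c' [cM mE]]]] : exists M c c',
    (forall m, (M <= m)%N -> c m = 0 /\ c' m = 0) /\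
    pi 'X_[m] = nf_sum M c + nf_sum M c' * pY.
  rewrite pi_mon; set e := sx ^+ m iX1 * sy ^+ m iX2 * eps ^+ (m iY)./2.
  set M := ((m iY)./2 + m iT)%N; pose c i := if i == M then e else 0.
  have cM i : (M.+1 <= i)%N -> c i = 0 by move=> Mi; rewrite /c gtn_eqF.
  have YE : pX1 ^+ m iX1 * pX2 ^+ m iX2 * pY ^+ m iY * pT ^+ m iT =
      nf_sum M.+1 c * pY ^+ odd (m iY).
    rewrite nf_sum1 /e rmorphM /= lam_mon -[in LHS](odd_double_half (m iY)).
    rewrite exprD -mul2n exprM pY_eps rmorphXn /M exprD.
    rewrite [(_ * pT) ^+ _](exprMn_comm _ (presentedC _ _)).
    exact: presented_reorder.
  rewrite YE; case: (odd (m iY)).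
    exists M.+1, (fun=> 0), c; split=> [i /cM //|].
    by rewrite nf_sum0 add0r.
  exists M.+1, c, (fun=> 0); split=> [i /cM //|].
  by rewrite nf_sum0 mul0r addr0 mulr1.
pose K := maxn M N; exists K, (fun i => p@_m *: c i + d i), (fun i => p@_m *: c' i +
  d' i).
split=> [i|].
  rewrite geq_max => /andP[/cM[-> ->] /dN[-> ->]].
  by rewrite scaler0 addr0.
rewrite to_alg_quotZ mE (@nf_sum_widen M K c) ?leq_maxl //; last by move=> i /cM[].
rewrite (@nf_sum_widen M K c') ?leq_maxl //; last by move=> i /cM[].
rewrite (@nf_sum_widen N K d) ?leq_maxr //; last by move=> i /dN[].
rewrite (@nf_sum_widen N K d') ?leq_maxr //; last by move=> i /dN[].
by rewrite !nf_sumP mulrDl scalerDr addrACA scalerAl.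
Qed.

(** * Evaluation of polynomials in the cohomology *)

Definition hgen (i : 'I_4) : HH A :=
  match val i with 0 => hc sx | 1 => hc sy | 2 => hY | _ => hT end.

Lemma hgen_comm i (z : HH A) : GRing.comm z (hgen i).
Proof.
have [zT zY] := HH_comm C a_eq0 b_neq0 z.
by case: i => [[|[|[|i]]] ile] //; rewrite /hgen /GRing.comm /= hc_comm.
Qed.

Definition ev : R -> HH A := mmap (GRing.in_alg (HH A)) hgen.

(** [HH] is built as a quotient of a noncommutative algebra, so this rests on the images of the
    variables commuting with every class. *)
Fact ev_monoid : monoid_morphism ev.
Proof.
have [|p m m'|evM ev1] := @commr_mmap_is_multiplicative 4 k (HH A) hgen
  (GRing.in_alg (HH A)); last by split.
  by move=> i z; apply: hgen_comm.
by rewrite /GRing.comm /= mulr_algl mulr_algr.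
Qed.

Fact ev_linear : linear ev.
Proof. by move=> c p q; rewrite /ev mmapD mmapZ /= mulr_algl. Qed.

HB.instance Definition _ := GRing.isLinear.Build k R (HH A) *:%R ev ev_linear.
HB.instance Definition _ := GRing.isMonoidMorphism.Build R (HH A) ev ev_monoid.

Lemma ev_gen i : ev 'X_i = hgen i.
Proof. by rewrite /ev mmapX mmap1U. Qed.

Lemma ev_relation i : (i < 3)%N -> ev (relations k a b)`_i = 0.
Proof.
case: i => [|[|[|i]]] // _; rewrite [nth _ _ _]/=.
- rewrite rmorphB !rmorphXn /= !ev_gen /hgen /= -!rmorphXn (coord_rel C).
  by rewrite subrr.
- rewrite rmorphM rmorphXn /= !ev_gen /hgen /= -rmorphXn.
  exact: hc_xb_T.
have := hY_eps; rewrite /eps; case: ifP => _ YE.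
  rewrite rmorphB rmorphXn rmorphM rmorphXn /= !ev_gen /hgen /= -[hc _ ^+ _]rmorphXn.
  by rewrite YE subrr.
by rewrite rmorphXn /= ev_gen /hgen /= YE raddf0 mul0r.
Qed.

Lemma ev_eq p q : pi p = pi q -> ev p = ev q.
Proof.
move=> /to_alg_quot_eqP/asboolP[c pq]; apply/eqP; rewrite -subr_eq0 -raddfB pq.
rewrite raddf_sum big1 // => i _ /=; rewrite rmorphM /= ev_relation ?mulr0 //.
Qed.

Definition phi (x : P) : HH A := ev (repr x).

Lemma phi_pi p : phi (pi p) = ev p.
Proof. by apply: ev_eq; rewrite /to_alg_quot reprK. Qed.

Fact phi_linear : linear phi.
Proof.
move=> c p q; have [{}p ->] := alg_quotP p; have [{}q ->] := alg_quotP q.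
by rewrite -linearP !phi_pi linearP.
Qed.

Fact phi_monoid : monoid_morphism phi.
Proof.
split=> [|p q]; first by rewrite -(rmorph1 pi) phi_pi rmorph1.
have [{}p ->] := alg_quotP p; have [{}q ->] := alg_quotP q.
by rewrite -rmorphM !phi_pi rmorphM.
Qed.

HB.instance Definition _ := GRing.isLinear.Build k P (HH A) *:%R phi phi_linear.
HB.instance Definition _ := GRing.isMonoidMorphism.Build P (HH A) phi phi_monoid.

Lemma phi_lam u : phi (lam u) = hc u.
Proof.
move: u; apply: (slin_ext a_gt0 b_gt0 coprime_ab) => [c p q|c p q|i j _].
- by rewrite !linearP.
- by rewrite linearP.
rewrite lam_mon rmorphM !rmorphXn /= !phi_pi !ev_gen /hgen /=.
by rewrite rmorphM !rmorphXn.
Qed.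

Lemma phi_nf_sum M c : phi (nf_sum M c) = \sum_(m < M) hc (c m) * hT ^+ m.
Proof.
rewrite raddf_sum; apply: eq_bigr => m _ /=.
by rewrite rmorphM rmorphXn /= phi_lam phi_pi ev_gen.
Qed.

Lemma phi_nf M c c' : phi (nf_sum M c + nf_sum M c' * pY) =
  HH_class (nf_cocycle C a_eq0 b_neq0 M c c').
Proof.
by rewrite rmorphD rmorphM /= !phi_nf_sum phi_pi ev_gen cl_nf.
Qed.

Lemma phi_surj z : exists p, phi p = z.
Proof.
have [M [c [c' ->]]] := HH_normal_form C a_eq0 b_neq0 z.
by exists (nf_sum M c + nf_sum M c' * pY); apply: phi_nf.
Qed.

Lemma nf_sum_eq0 M c : ((0 < M)%N -> c 0%N = 0) ->
  (forall m, (m.+1 < M)%N -> exists e, c m.+1 = sx ^+ b.-1 * e) -> nf_sum M c = 0.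
Proof.
move=> c0 cS; apply: big1 => -[[|m] mM] _ /=; first by rewrite c0 // raddf0 mul0r.
have [e ->] := cS m mM; rewrite mulrC rmorphM rmorphXn /= lam_sx exprS.
by rewrite -mulrA [pX1 ^+ _ * _]mulrA pX1T mul0r mulr0.
Qed.

(** A normal form that dies in cohomology has constant coefficients 0 and the others divisible by
    x^(b-1), so X1^(b-1) T = 0 already makes it vanish in the presented algebra. *)
Lemma phi_inj : injective phi.
Proof.
apply: raddf_inj => p; have [M [c [c' ->]]] := presented_normal_form p.
rewrite /= phi_nf => /HH_class_nf0[c0 cS cS'].
rewrite !nf_sum_eq0 ?mul0r ?addr0 //; by [move=> /c0[] | ].
Qed.

Lemma phi_bij : bijective phi.
Proof.
have [psi psiK] := choice phi_surj.
by exists psi => // p; apply: phi_inj; rewrite psiK.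
Qed.

Local Notation hom := (@sgalg_hom k a b).
Local Notation T_cocycle := (T_cocycle C b_neq0).
Local Notation Y_cocycle := (Y_cocycle C a_eq0).
Local Notation nf_cocycle := (nf_cocycle C a_eq0 b_neq0).

(** Degree and weight are tested on representing cocycles, so every monomial needs a homogeneous
    representative. *)
Definition mon_cocycle (m : 'X_{1..4}) : cocycle A :=
  const_cocycle sx ^+ m iX1 * const_cocycle sy ^+ m iX2 *
  Y_cocycle ^+ m iY * T_cocycle ^+ m iT.

Lemma class_mon m : HH_class (mon_cocycle m) = ev 'X_[m].
Proof.
rewrite mpolyXE_id prod_ord4 !rmorphM !rmorphXn /= !ev_gen.
by rewrite /HH_class !rmorphM !rmorphXn.
Qed.

Lemma bihom_mon m : bihom hom (mon_deg m) (mon_wt a b m) (cocycle_cochain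
  (mon_cocycle m)).
Proof.
have -> : cocycle_cochain (mon_cocycle m) =
    const sx ^+ m iX1 * const sy ^+ m iX2 * Y_cochain C ^+ m iY * T_cochain C ^+ m iT.
  by rewrite -[LHS]/(val (mon_cocycle m)) !rmorphM !rmorphXn.
have hX1 := bihomX W (m iX1) (bihom_const W (homx W)).
have hX2 := bihomX W (m iX2) (bihom_const W (homy W)).
have hY' := bihomX W (m iY) (bihom_Y C W).
have hT' := bihomX W (m iT) (bihom_T C W).
have := bihomM W (bihomM W (bihomM W hX1 hX2) hY') hT'.
by rewrite !mul0n !add0n mul1n !mulNrn.
Qed.

Lemma phi_bihom_to i w x : presented_bihom i w x -> HH_bihom hom i w (phi x).
Proof.
move=> [p [-> hp]]; rewrite phi_pi.
pose z : cocycle A := \sum_(m <- msupp p) p@_m *: mon_cocycle m; exists z.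
have zE : cocycle_cochain z = \sum_(m <- msupp p) p@_m *: cocycle_cochain
  (mon_cocycle m).
  by rewrite -[LHS]/(val z) raddf_sum.
have [z1 z2] : bihom hom i w (cocycle_cochain z).
  rewrite zE big_seq; apply: (bihom_sum W) => m /hp[<- <-].
  exact/(bihomZ W)/bihom_mon.
split; [|exact/has_degree_inner|exact: (inner_has_weight W)].
rewrite [p in LHS]mpolyE /HH_class !raddf_sum; apply: eq_bigr => m _ /=.
by rewrite linearZ /= -class_mon to_alg_quotZ.
Qed.

(** A homogeneous cocycle has a normal form with homogeneous coefficients. Injectivity of [phi]
    carries it back to [x], and [lift] makes a homogeneous polynomial of it. *)
Lemma phi_bihom_from i w x : HH_bihom hom i w (phi x) -> presented_bihom i w x.
Proof.
move=> [z [zx /has_degree_inner zi /(has_weight_inner W) zw]].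
have [N [d [d' [g [dw dw' zE]]]]] :=
  bihom_normal_form C W a_eq0 b_neq0 (conj zi zw) (cocycle_dC z).
have xE : x = nf_sum N d + nf_sum N d' * pY.
  by apply: phi_inj; rewrite zx phi_nf; apply/HH_class_eqP; exists g; rewrite val_nf zE.
exists (\sum_(m < N) lift (d m) * 'X_iT ^+ m +
        (\sum_(m < N) lift (d' m) * 'X_iT ^+ m) * 'X_iY); split.
  rewrite xE rmorphD rmorphM !rmorph_sum; congr (_ + _ * _);
  by apply: eq_bigr => m _; rewrite rmorphM rmorphXn /= pi_lift.
have Tm m := @mbihomX _ _ _ _ _ _ m (@mbihom_T k a b).
have lift0 : lift 0 = 0 by rewrite /lift /slin /= size_poly0 big_ord0.
rewrite -[X in X + _]scale1r mulr_suml.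
apply: mbihomP; apply: mbihom_sum => m _.
  have [->|[mi dm]] := dw m; first by rewrite lift0 mul0r; apply: mbihom0.
  by apply: (mbihom_eq (mbihomM (mbihom_lift dm) (Tm m))) => //; rewrite mulNrn addrK.
have [->|[mi dm]] := dw' m; first by rewrite lift0 !mul0r; apply: mbihom0.
apply: (mbihom_eq (mbihomM (mbihomM (mbihom_lift dm) (Tm m)) (@mbihom_Y k a b))).
  by rewrite addn1.
by rewrite mulNrn !addrK.
Qed.

End Presented.

Theorem theoremB (k : fieldType) (n a b : nat)
    (char_k : n \in [pchar k]) (a_gt0 : (0 < a)%N) (b_gt0 : (0 < b)%N)
    (coprime_ab : coprime a b) (n_dvd_a : (n %| a)%N) :
  exists phi : {lrmorphism presented k a b -> HH (sgalg k a b)},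
    bijective phi /\
    forall (i : nat) (w : int) (x : presented k a b),
      presented_bihom i w x <-> HH_bihom (@sgalg_hom k a b) i w (phi x).
Proof.
exists (phi char_k a_gt0 b_gt0 coprime_ab n_dvd_a); split; first exact: phi_bij.
by move=> i w x; split; [apply: phi_bihom_to | apply: phi_bihom_from].
Qed.
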